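(* Let $(K,\Omega+\Theta)$ be a 2-shifted symplectic Lie group and let $(\mathcal{H},\Phi,\sigma+\eta)$ be an isotropic morphism into it, where $\mathcal{H}\rightrightarrows N$ is a Lie groupoid. The following are equivalent: (a) The isotropic structure $\sigma+\eta$ is lagrangian. (b) The map $(\mathtt{a}_{\mathcal{H}},\lambda_\sigma,\mathrm{Lie}(\Phi)):A_{\mathcal{H}}\to(TN\oplus T^*N)\oplus\mathfrak{k}_N$ is injective and its image is a Dirac structure in $\mathbb{T}_\eta N\times\mathfrak{k}$. (c) $\dim\mathcal{H}-2\dim N=\tfrac12\dim K$, and $\ker(\sigma)_h\cap\ker(T\Phi)_h\cap\ker(T\mathtt{s})_h\cap\ker(T\mathtt{t})_h=\{0\}$ for all $h\in\mathcal{H}$ (and it is enough to check this last condition for $h\in N$).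
   Context: Everything is real and $C^\infty$. For a Lie groupoid $\mathcal{H}\rightrightarrows N$, $\mathtt{s},\mathtt{t}$ are source and target, $\mathtt{m}:\mathcal{H}_{(2)}=\{(g,h):\mathtt{s}(g)=\mathtt{t}(h)\}\to\mathcal{H}$ the multiplication, $\epsilon:N\to\mathcal{H}$ the unit map ($N$ is identified with its image). The Lie algebroid is $A_{\mathcal{H}}=\ker(T\mathtt{s})|_N$ with anchor $\mathtt{a}_{\mathcal{H}}=T\mathtt{t}$ and bracket induced by right-invariant vector fields (same convention for Lie groups). $\mathfrak{k}_N=N\times\mathfrak{k}$. 2-shifted symplectic Lie group: a Lie group $K$ with $\Omega\in\Omega^2(K\times K)$, whose pullbacks along $k\mapsto(1,k)$ and $k\mapsto(k,1)$ vanish, and $\Theta\in\Omega^3(K)$, such that $\delta\Omega=0$, $\delta\Theta=\mathrm{pr}_1^*\Theta+\mathrm{pr}_2^*\Theta-\mathtt{m}^*\Theta=-d\Omega$, $d\Theta=0$, where $\delta\Omega=(k_2,k_3)^*\Omega-(k_1k_2,k_3)^*\Omega+(k_1,k_2k_3)^*\Omega-(k_1,k_2)^*\Omega$ on $K^3$, and such that the symmetric ad-invariant form $\langle u,v\rangle=-\Omega_{(1,1)}((u,0),(0,v))+\Omega_{(1,1)}((0,u),(v,0))$ on $\mathfrak{k}$ is nondegenerate. This makes $\mathfrak{k}$ a quadratic Lie algebra. An isotropic morphism $(\mathcal{H},\Phi,\sigma+\eta)$ into $(K,\Omega+\Theta)$ is a Lie groupoid morphism $\Phi:\mathcal{H}\to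 K$ with $\sigma\in\Omega^2(\mathcal{H})$, $\epsilon^*\sigma=0$, and $\eta\in\Omega^3(N)$ satisfying $\mathrm{pr}_1^*\sigma+\mathrm{pr}_2^*\sigma-\mathtt{m}^*\sigma=\Phi^*\Omega$, $\Phi^*\Theta=\mathtt{s}^*\eta-\mathtt{t}^*\eta-d\sigma$, $d\eta=0$. Set $\lambda_\sigma:A_{\mathcal{H}}\to T^*N$, $\lambda_\sigma(u)=(i_u\sigma)|_{TN}$. The isotropic structure is lagrangian if the chain map of two-term complexes of vector bundles over $N$ from $\big(A_{\mathcal{H}}\xrightarrow{(\mathtt{a}_{\mathcal{H}},\mathrm{Lie}(\Phi))}TN\oplus\mathfrak{k}_N\big)$ to $\big(T^*N\xrightarrow{\mathtt{a}_{\mathcal{H}}^*}A_{\mathcal{H}}^*\big)$ given by $\lambda_\sigma:A_{\mathcal{H}}\to T^*N$ and $-\lambda_\sigma^*-\mathrm{Lie}(\Phi)^*\circ\langle\cdot,\cdot\rangle^\flat:TN\oplus\mathfrak{k}_N\to A_{\mathcal{H}}^*$ is a quasi-isomorphism. The Courant algebroid $\mathbb{T}_\eta N\times\mathfrak{k}$ ($\eta$ closed): vector bundle $(TN\oplus T^*N)\oplus\mathfrak{k}_N$, anchor the projection to $TN$, pairing $(X_1+\alpha_1+w_1,X_2+\alpha_2+w_2)\mapsto i_{X_2}\alpha_1+i_{X_1}\alpha_2+\langle w_1,w_2\rangle$, bracket $[\![X_1+\alpha_1+w_1,X_2+\alpha_2+w_2]\!]=[X_1,X_2]+(\mathcal{L}_{X_1}\alpha_2-i_{X_2}d\alpha_1+i_{X_2}i_{X_1}\eta+\langle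 dw_1,w_2\rangle)+(\mathcal{L}_{X_1}w_2-\mathcal{L}_{X_2}w_1+[w_1,w_2])$. A Dirac structure is a subbundle equal to its own orthogonal (lagrangian) whose sections are closed under the bracket. *)

(* Defs.v *)
From HB Require Import structures.
From mathcomp Require Import all_boot all_order all_algebra.
From mathcomp Require Import all_classical all_reals all_analysis.
Set Implicit Arguments.
Unset Strict Implicit.
Unset Printing Implicit Defensive.
Import Order.TTheory GRing.Theory Num.Theory numFieldNormedType.Exports.
Local Open Scope classical_set_scope.
Local Open Scope ring_scope.

(** * Smooth functions and smooth manifolds

    A smooth manifold is encoded by its algebra of smooth real functions
    (Sikorski's differential spaces).  The topology is the one generated by the
    sets [{q | 0 < f q}], for [f] smooth.  Subspaces such as the manifold of
    composable pairs, and products, then carry an induced structure without any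
    choice of charts. *)

Fixpoint differentiable_n (R : realType) (k m : nat) (g : 'rV[R]_k -> R) : Prop :=
  if m is m'.+1 then
    (forall x, differentiable g x) /\
    (forall v, differentiable_n m' (fun x => 'd g x v))
  else True.

Definition smooth (R : realType) (k : nat) (g : 'rV[R]_k -> R) : Prop :=
  forall m, differentiable_n m g.

Record dspace (R : realType) := DSpace {
  pt :> Type;
  Cinf : set (pt -> R) }.

(** Functions that are locally of the form [g (h_1, ..., h_k)] with [g] smooth on
    R^k and the [h_i] in [G].  Here "locally" refers to the initial topology of
    [G], a base of which consists of the sets [{q | 0 < b (h q)}]. *)
Definition smooth_closure (R : realType) (T : Type) (G : set (T -> R)) :
    set (T -> R) :=
  [set f | forall p, exists (k : nat) (h : T -> 'rV[R]_k) (b g : 'rV[R]_k -> R),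
    [/\ forall i, G (fun q => h q 0 i), smooth b, smooth g, 0 < b (h p) &
        forall q, 0 < b (h q) -> f q = g (h q)]].

(** Hausdorff, second countable, of pure dimension [n]; nonempty, so that the
    dimension is determined by the space.  A chart at [p] is given on
    [{q | 0 < u q}] by [x]; after shrinking, its coordinates are restrictions of
    global smooth functions, and every smooth function is on that domain the
    pullback of a smooth function on all of R^n. *)
Definition is_manifold (R : realType) (n : nat) (M : dspace R) : Prop :=
  [/\ exists p : M, True,
      smooth_closure (@Cinf R M) `<=` @Cinf R M,
      forall p q : M, (forall f, Cinf f -> f p = f q) -> p = q,
      exists u : nat -> M -> R, (forall k, Cinf (u k)) /\
        forall f, Cinf f -> forall p, 0 < f p ->
          exists k, 0 < u k p /\ (forall q, 0 < u k q -> 0 < f q) &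
      forall p : M, exists (u : M -> R) (x : M -> 'rV[R]_n),
        [/\ Cinf u, 0 < u p, forall i, Cinf (fun q => x q 0 i),
            open (x @` [set q | 0 < u q]) &
            forall f, Cinf f -> exists g : 'rV[R]_n -> R,
              smooth g /\ (forall q, 0 < u q -> f q = g (x q))]].

Record manifold (R : realType) := Manifold {
  mspace :> dspace R;
  mdim : nat;
  manifoldP : is_manifold mdim mspace }.

Definition smooth_map (R : realType) (M N : dspace R) (F : M -> N) : Prop :=
  forall f, Cinf f -> Cinf (f \o F).

Definition prod_space (R : realType) (M N : dspace R) : dspace R :=
  @DSpace R (M * N)%type
    (smooth_closure ([set f \o fst | f in @Cinf R M] `|`
                     [set f \o snd | f in @Cinf R N])).

Definition sub_space (R : realType) (M : dspace R) (P : M -> Prop) : dspace R :=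
  @DSpace R {p : M | P p}
    (smooth_closure [set (fun q => f (sval q)) | f in @Cinf R M]).

(** * Tangent vectors and vector fields

    [T_p M] is a subspace of the single vector space [vect M]: tangent vectors
    are derivations at [p] of the smooth functions, extended by [0] to all other
    functions so that equality is Leibniz equality. *)

Definition vect (R : realType) (M : dspace R) : Type := (M -> R) -> R.

Definition tangent (R : realType) (M : dspace R) (p : M) : set (vect M) :=
  [set v | [/\ forall (a : R) f g, Cinf f -> Cinf g ->
                 v (fun q => a * f q + g q) = a * v f + v g,
               forall f g, Cinf f -> Cinf g ->
                 v (fun q => f q * g q) = f p * v g + g p * v f &
               forall f, ~ Cinf f -> v f = 0]].

Definition tmap (R : realType) (M N : dspace R) (F : M -> N) (v : vect M) :
    vect N :=
  patch (fun=> 0) (@Cinf R N) (fun f => v (f \o F)).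

Definition vfield (R : realType) (M : dspace R) (X : M -> vect M) : Prop :=
  (forall p, tangent p (X p)) /\
  (forall f, Cinf f -> Cinf (fun p => X p f)).

Definition vbracket (R : realType) (M : dspace R) (X Y : M -> vect M) (p : M) :
    vect M :=
  patch (fun=> 0) (@Cinf R M)
    (fun f => X p (fun q => Y q f) - Y p (fun q => X q f)).

(** The dual of the subspace [V] of [U]; the functionals are extended by [0]. *)
Definition dual (R : realType) (U : lmodType R) (V : set U) : set (U -> R) :=
  [set xi | (forall (a : R) u v, V u -> V v -> xi (a *: u + v) = a * xi u + xi v)
            /\ (forall u, ~ V u -> xi u = 0)].

Definition restr (R : realType) (U : Type) (V : set U) (xi : U -> R) : U -> R :=
  patch (fun=> 0) V xi.

Definition one_form (R : realType) (M : dspace R) (al : M -> vect M -> R) : Prop :=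
  (forall p, dual (tangent p) (al p)) /\
  (forall X, vfield X -> Cinf (fun p => al p (X p))).

(** * Differential forms of degree 2 and 3

    Only the values on tangent vectors at the given point are meaningful;
    [eq_form2] is the corresponding equality. *)

Definition form2 (R : realType) (M : dspace R) : Type :=
  M -> vect M -> vect M -> R.
Definition form3 (R : realType) (M : dspace R) : Type :=
  M -> vect M -> vect M -> vect M -> R.

Section Forms.
Variables (R : realType) (M : dspace R).

Definition is_form2 (om : form2 M) : Prop :=
  [/\ forall p (a : R) u u' v, tangent p u -> tangent p u' -> tangent p v ->
        om p (a *: u + u') v = a * om p u v + om p u' v,
      forall p u v, tangent p u -> tangent p v -> om p v u = - om p u v &
      forall X Y, vfield X -> vfield Y -> Cinf (fun p => om p (X p) (Y p))].

Definition is_form3 (th : form3 M) : Prop :=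
  [/\ forall p (a : R) u u' v w,
        tangent p u -> tangent p u' -> tangent p v -> tangent p w ->
        th p (a *: u + u') v w = a * th p u v w + th p u' v w,
      forall p u v w, tangent p u -> tangent p v -> tangent p w ->
        th p v u w = - th p u v w,
      forall p u v w, tangent p u -> tangent p v -> tangent p w ->
        th p u w v = - th p u v w &
      forall X Y Z, vfield X -> vfield Y -> vfield Z ->
        Cinf (fun p => th p (X p) (Y p) (Z p))].

Definition eq_form2 (om om' : form2 M) : Prop :=
  forall p u v, tangent p u -> tangent p v -> om p u v = om' p u v.

(** [exterior_d2 om th] states that [d om = th], and [closed3 th] that [d th = 0];
    both use the invariant formula for the exterior derivative, which determines
    it because every tangent vector extends to a vector field. *)
Definition exterior_d2 (om : form2 M) (th : form3 M) : Prop :=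
  forall X Y Z, vfield X -> vfield Y -> vfield Z -> forall p,
    th p (X p) (Y p) (Z p) =
      X p (fun q => om q (Y q) (Z q)) - Y p (fun q => om q (X q) (Z q))
      + Z p (fun q => om q (X q) (Y q))
      - om p (vbracket X Y p) (Z p) + om p (vbracket X Z p) (Y p)
      - om p (vbracket Y Z p) (X p).

Definition closed3 (th : form3 M) : Prop :=
  forall X Y Z W, vfield X -> vfield Y -> vfield Z -> vfield W -> forall p,
    X p (fun q => th q (Y q) (Z q) (W q)) - Y p (fun q => th q (X q) (Z q) (W q))
    + Z p (fun q => th q (X q) (Y q) (W q)) - W p (fun q => th q (X q) (Y q) (Z q))
    - th p (vbracket X Y p) (Z p) (W p) + th p (vbracket X Z p) (Y p) (W p)
    - th p (vbracket X W p) (Y p) (Z p) - th p (vbracket Y Z p) (X p) (W p)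
    + th p (vbracket Y W p) (X p) (Z p) - th p (vbracket Z W p) (X p) (Y p) = 0.

End Forms.

Definition pull2 (R : realType) (M N : dspace R) (F : M -> N)
    (om : form2 N) : form2 M :=
  fun p u v => om (F p) (tmap F u) (tmap F v).

Definition pull3 (R : realType) (M N : dspace R) (F : M -> N)
    (th : form3 N) : form3 M :=
  fun p u v w => th (F p) (tmap F u) (tmap F v) (tmap F w).

(** * Lie groups and 2-shifted symplectic structures *)

Record lie_group (R : realType) := LieGroup {
  lgroup :> manifold R;
  gmul : lgroup -> lgroup -> lgroup;
  gone : lgroup;
  ginv : lgroup -> lgroup;
  gmulA : forall a b c, gmul a (gmul b c) = gmul (gmul a b) c;
  gmul1l : forall a, gmul gone a = a;
  gmul1r : forall a, gmul a gone = a;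
  gmulVl : forall a, gmul (ginv a) a = gone;
  gmulVr : forall a, gmul a (ginv a) = gone;
  gmul_smooth : @smooth_map R (prod_space lgroup lgroup) lgroup
                  (fun ab => gmul ab.1 ab.2);
  ginv_smooth : @smooth_map R lgroup lgroup ginv }.

Section LieGroup.
Variables (R : realType) (K : lie_group R).

Definition lie_alg : set (vect K) := tangent (gone K).

Definition right_inv (u : vect K) (g : K) : vect K :=
  tmap (fun k : K => gmul k g) u.

Definition lie_bracket (u v : vect K) : vect K :=
  vbracket (right_inv u) (right_inv v) (gone K).

Definition K2 : dspace R := prod_space K K.
Definition K3 : dspace R := prod_space K2 K.

Definition inK1 (k : K) : K2 := (k, gone K).
Definition inK2 (k : K) : K2 := (gone K, k).

Definition delta_form2 (Om : form2 K2) : form2 K3 :=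
  pull2 (fun k : K3 => (k.1.2, k.2) : K2) Om
  - pull2 (fun k : K3 => (gmul k.1.1 k.1.2, k.2) : K2) Om
  + pull2 (fun k : K3 => (k.1.1, gmul k.1.2 k.2) : K2) Om
  - pull2 (fun k : K3 => (k.1.1, k.1.2) : K2) Om.

Definition delta_form3 (Th : form3 K) : form3 K2 :=
  pull3 (fun k : K2 => k.1) Th + pull3 (fun k : K2 => k.2) Th
  - pull3 (fun k : K2 => gmul k.1 k.2) Th.

Definition lie_pairing (Om : form2 K2) (u v : vect K) : R :=
  - Om (gone K, gone K) (tmap inK1 u) (tmap inK2 v)
  + Om (gone K, gone K) (tmap inK2 u) (tmap inK1 v).

(** [lie_pairing Om] is symmetric because [Om] is antisymmetric, and ad-invariant
    because [delta_form2 Om = 0]. *)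
Definition shifted_symplectic (Om : form2 K2) (Th : form3 K) : Prop :=
  (is_form2 Om /\ is_form3 Th) /\
  [/\ eq_form2 (pull2 inK2 Om) 0 /\ eq_form2 (pull2 inK1 Om) 0,
      eq_form2 (delta_form2 Om) 0,
      exterior_d2 Om (- delta_form3 Th),
      closed3 Th &
      forall u, lie_alg u -> (forall v, lie_alg v -> lie_pairing Om u v = 0) ->
        u = 0].

End LieGroup.

(** * Lie groupoids *)

(** [cmul] is only meaningful on composable pairs. *)
Record lie_groupoid (R : realType) := LieGroupoid {
  arr : manifold R;
  obj : manifold R;
  src : arr -> obj;
  tgt : arr -> obj;
  eps : obj -> arr;
  cinv : arr -> arr;
  cmul : arr -> arr -> arr;
  src_eps : forall x, src (eps x) = x;
  tgt_eps : forall x, tgt (eps x) = x;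
  src_cmul : forall g h, src g = tgt h -> src (cmul g h) = src h;
  tgt_cmul : forall g h, src g = tgt h -> tgt (cmul g h) = tgt g;
  cmulA : forall g h k, src g = tgt h -> src h = tgt k ->
    cmul g (cmul h k) = cmul (cmul g h) k;
  cmul_epsl : forall g, cmul (eps (tgt g)) g = g;
  cmul_epsr : forall g, cmul g (eps (src g)) = g;
  src_cinv : forall g, src (cinv g) = tgt g;
  tgt_cinv : forall g, tgt (cinv g) = src g;
  cmulVl : forall g, cmul (cinv g) g = eps (src g);
  cmulVr : forall g, cmul g (cinv g) = eps (tgt g);
  src_smooth : @smooth_map R arr obj src;
  tgt_smooth : @smooth_map R arr obj tgt;
  eps_smooth : @smooth_map R obj arr eps;
  cinv_smooth : @smooth_map R arr arr cinv;
  cmul_smooth : @smooth_map R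
    (@sub_space R (prod_space arr arr) (fun gh => src gh.1 = tgt gh.2)) arr
    (fun gh => cmul (sval gh).1 (sval gh).2);
  src_submersion : forall (g : arr) X, tangent (src g) X ->
    exists2 u, tangent g u & tmap (M := arr) (N := obj) src u = X }.

Definition composable (R : realType) (H : lie_groupoid R) : dspace R :=
  @sub_space R (prod_space (arr H) (arr H)) (fun gh => src gh.1 = tgt gh.2).

(** Fibre at [x] of the Lie algebroid, as a subspace of the tangent space of
    [arr H] at the unit [eps x]. *)
Definition lie_algebroid (R : realType) (H : lie_groupoid R) (x : obj H) :
    set (vect (arr H)) :=
  [set u | tangent (eps x) u /\
           tmap (M := arr H) (N := obj H) (@src R H) u = 0].

Definition anchor (R : realType) (H : lie_groupoid R) (u : vect (arr H)) :
    vect (obj H) :=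
  tmap (M := arr H) (N := obj H) (@tgt R H) u.

(** * Isotropic and lagrangian structures *)

(** The chain map [(f0, f1)] between the two-term complexes [d : C0 -> C1] and
    [e : D0 -> D1] induces isomorphisms on kernels and on cokernels. *)
Definition quasi_isomorphism (R : realType) (U0 U1 V0 V1 : lmodType R)
    (C0 : set U0) (C1 : set U1) (D0 : set V0) (D1 : set V1)
    (d : U0 -> U1) (e : V0 -> V1) (f0 : U0 -> V0) (f1 : U1 -> V1) : Prop :=
  [/\ [/\ set_fun C0 C1 d, set_fun D0 D1 e, set_fun C0 D0 f0 & set_fun C1 D1 f1],
      forall u, C0 u -> e (f0 u) = f1 (d u),
      set_bij (C0 `&` d @^-1` [set 0]) (D0 `&` e @^-1` [set 0]) f0,
      forall y, C1 y -> (exists2 a, D0 a & f1 y = e a) ->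
        (exists2 u, C0 u & y = d u) &
      forall z, D1 z -> exists y a, [/\ C1 y, D0 a & z = f1 y + e a]].

Section Isotropic.
Variables (R : realType) (K : lie_group R).
Variable Om : form2 (K2 K).
Variable Th : form3 K.
Variable H : lie_groupoid R.
Variable Phi : arr H -> K.
Variable sigma : form2 (arr H).
Variable eta : form3 (obj H).

Definition groupoid_morphism : Prop :=
  @smooth_map R (arr H) K Phi /\
  (forall g h, src g = tgt h -> Phi (cmul g h) = gmul (Phi g) (Phi h)).

Definition isotropic_morphism : Prop :=
  [/\ groupoid_morphism,
      is_form2 sigma /\ is_form3 eta,
      eq_form2 (pull2 (M := obj H) (N := arr H) (@eps R H) sigma) 0,
      eq_form2 (M := composable H)
        (pull2 (M := composable H) (N := arr H) (fun gh => (sval gh).1) sigma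
         + pull2 (M := composable H) (N := arr H) (fun gh => (sval gh).2) sigma
         - pull2 (M := composable H) (N := arr H)
             (fun gh => cmul (sval gh).1 (sval gh).2) sigma)
        (pull2 (M := composable H) (N := K2 K)
           (fun gh => (Phi (sval gh).1, Phi (sval gh).2)) Om) &
      exterior_d2 sigma
        (pull3 (M := arr H) (N := obj H) (@src R H) eta
         - pull3 (M := arr H) (N := obj H) (@tgt R H) eta
         - pull3 (M := arr H) (N := K) Phi Th) /\
      closed3 eta].

Definition lie_map (u : vect (arr H)) : vect K :=
  tmap (M := arr H) (N := K) Phi u.

Definition lambda (x : obj H) (u : vect (arr H)) : vect (obj H) -> R :=
  restr (tangent x)
    (fun X => sigma (eps x) u (tmap (M := obj H) (N := arr H) (@eps R H) X)).

(** A morphism of complexes of vector bundles over [obj H] is a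
    quasi-isomorphism when it is one on the fibres over each point. *)
Definition lagrangian_structure : Prop :=
  forall x : obj H,
    quasi_isomorphism
      (lie_algebroid x) (tangent x `*` @lie_alg R K)
      (dual (tangent x)) (dual (lie_algebroid x))
      (fun u => (anchor u, lie_map u))
      (fun al => restr (lie_algebroid x) (fun u => al (anchor u)))
      (lambda x)
      (fun Xw => restr (lie_algebroid x)
         (fun u => - lambda x u Xw.1 - lie_pairing Om Xw.2 (lie_map u))).

End Isotropic.

(** * The Courant algebroid T_eta N x k and its Dirac structures *)

Section Courant.
Variables (R : realType) (N : manifold R) (K : lie_group R).
Variable Om : form2 (K2 K).
Variable eta : form3 N.

(** [(X, al, w)] stands for X + al + w. *)
Definition cvect : Type := (vect N * (vect N -> R) * vect K)%type.

Definition cfibre (x : N) : set cvect :=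
  [set e | [/\ tangent x e.1.1, dual (tangent x) e.1.2 & lie_alg e.2]].

Definition cpairing (e1 e2 : cvect) : R :=
  e1.1.2 e2.1.1 + e2.1.2 e1.1.1 + lie_pairing Om e1.2 e2.2.

(** Derivative along [X] of the function [w] with values in the Lie algebra. *)
Definition lie_deriv (X : N -> vect N) (w : N -> vect K) (p : N) : vect K :=
  fun f => X p (fun q => w q f).

Definition csection (e : N -> cvect) : Prop :=
  [/\ vfield (fun p => (e p).1.1), one_form (fun p => (e p).1.2),
      forall p, lie_alg (e p).2 &
      forall f, @Cinf R K f -> @Cinf R N (fun p => (e p).2 f)].

(** [e3] is the Courant bracket of [e1] and [e2].  The cotangent component is
    determined by its contractions with all vector fields [Y]. *)
Definition cbracket (e1 e2 e3 : N -> cvect) : Prop :=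
  let X1 p := (e1 p).1.1 in let al1 p := (e1 p).1.2 in let w1 p := (e1 p).2 in
  let X2 p := (e2 p).1.1 in let al2 p := (e2 p).1.2 in let w2 p := (e2 p).2 in
  forall p,
  [/\ (e3 p).1.1 = vbracket X1 X2 p,
      forall Y, vfield Y ->
        (e3 p).1.2 (Y p) =
          (X1 p (fun q => al2 q (Y q)) - al2 p (vbracket X1 Y p))
          - (X2 p (fun q => al1 q (Y q)) - Y p (fun q => al1 q (X2 q))
             - al1 p (vbracket X2 Y p))
          + eta p (X1 p) (X2 p) (Y p)
          + lie_pairing Om (lie_deriv Y w1 p) (w2 p) &
      (e3 p).2 = lie_deriv X1 w2 p - lie_deriv X2 w1 p
                 + lie_bracket (w1 p) (w2 p)].

Definition section_of (L : N -> set cvect) (e : N -> cvect) : Prop :=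
  csection e /\ (forall p, L p (e p)).

Definition subbundle (L : N -> set cvect) : Prop :=
  forall p, exists (u : N -> R) (r : nat) (s : 'I_r -> N -> cvect),
    [/\ @Cinf R N u, 0 < u p, forall i, csection (s i) &
        forall q, 0 < u q ->
          L q = [set e | exists c : 'I_r -> R, e = \sum_i c i *: s i q] /\
          (forall c : 'I_r -> R, \sum_i c i *: s i q = 0 -> forall i, c i = 0)].

Definition dirac_structure (L : N -> set cvect) : Prop :=
  [/\ subbundle L,
      forall x, L x = [set e | cfibre x e /\
                               (forall e', L x e' -> cpairing e e' = 0)] &
      forall e1 e2, section_of L e1 -> section_of L e2 ->
        exists2 e3, section_of L e3 & cbracket e1 e2 e3].

End Courant.

(** The map [(anchor, lambda, Lie Phi)] on the fibre over [x]. *)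
Definition rho (R : realType) (K : lie_group R) (H : lie_groupoid R)
    (Phi : arr H -> K) (sigma : form2 (arr H))
    (x : obj H) (u : vect (arr H)) : cvect (obj H) K :=
  (anchor u, lambda sigma x u, lie_map Phi u).

Definition ker_form2 (R : realType) (M : dspace R)
    (om : form2 M) (p : M) : set (vect M) :=
  [set v | tangent p v /\ (forall w, tangent p w -> om p v w = 0)].

Definition ker_tmap (R : realType) (M N : dspace R) (F : M -> N) (p : M) :
    set (vect M) :=
  [set v | tangent p v /\ tmap F v = 0].

(* Main.v *)
Require Import Defs.
From HB Require Import structures.
From mathcomp Require Import all_boot all_order all_algebra.
From mathcomp Require Import all_classical all_reals all_analysis.
From mathcomp Require Import ring lra.
Set Implicit Arguments.
Unset Strict Implicit.
Unset Printing Implicit Defensive.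
Import Order.TTheory GRing.Theory Num.Theory numFieldNormedType.Exports.
Local Open Scope classical_set_scope.
Local Open Scope ring_scope.

(** The map rho = (anchor, lambda_sigma, Lie Phi) determines sigma along the units:
    multiplicativity of sigma, applied to the composable
    tangent vectors (u, 0) and (T eps (T tgt W), W), gives for u in the Lie algebroid
    at x and W tangent to the groupoid at 1_x
      sigma(u, W) = lambda_sigma(u)(T tgt W) - Omega((Lie Phi u, 0), (0, Lie Phi W)).
    Antisymmetry of sigma then says that the image L of rho is isotropic, and the
    kernel in (c) at a unit is the kernel of rho; right translations carry the
    kernel at h to the unit at the target of h.  The chain map being a
    quasi-isomorphism at x means that rho is injective at x and L equals its
    orthogonal, and for an injective rho the latter is a count of dimensions.

    Involutivity of L is automatic once rho is injective: sections of the Lie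
    algebroid extend to right invariant vector fields on the groupoid, and
    evaluating d sigma at the units on two of them and on a third field tangent
    to the units shows that rho is compatible with the Courant bracket.  Right
    translation of a vertical vector v needs an argument here, because smooth
    functions on a source fibre do not come with a global extension: v kills every
    function that vanishes on the source fibre (Newton's method produces points of
    the fibre close to the line spanned by v). *)

(** A manifold is given here by its algebra of functions alone, and a tangent vector is a derivation
    of that algebra. Charts act mainly through one identity, the chain rule for a derivation of
    g(h_1, ..., h_k). It follows from Hadamard's lemma, whose coefficients must be smooth, and hence
    from differentiation under an integral; locality of derivations needs a flat function. The
    splitting of tangent vectors of a product and the smoothness of forms on fields along a map are
    consequences.

    The composable pairs are only such a function space and are never shown to be a manifold. The
    tangent vectors used on it are images of tangent vectors of the groupoid under explicit smooth
    maps, except the vectors (v, 0) with v vertical, which are built by hand.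

    In the computation of d sigma the third field is prescribed at one unit only. The resulting
    error terms have an argument that vanishes at that unit, and the derivative of a form there is
    the form on the derivative of this argument.

    The count of dimensions compares an isotropic image of rank dim H - dim N with a space of
    dimension 2 dim N + dim K. *)

Lemma diff_coordE (R : realType) k (g : 'rV[R]_k -> R) x v :
  'd g x v = \sum_i v 0 i * 'd g x (delta_mx 0 i).
Proof.
rewrite {1}(row_sum_delta v) linear_sum; apply: eq_bigr => i _.
by rewrite linearZ.
Qed.

Lemma coord_le_norm (R : realType) k (v : 'rV[R]_k) i : `|v 0 i| <= `|v|.
Proof.
rewrite [leRHS]/Num.Def.normr /= mx_normrE; apply/bigmax_geP; right => /=.
by exists (ord0, i).
Qed.

Lemma sum_coord_le (R : realType) k (v : 'rV[R]_k) (d : 'I_k -> R) c :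
  (forall i, `|d i| <= c) -> `|\sum_i v 0 i * d i| <= k%:R * c * `|v|.
Proof.
move=> dc; apply: le_trans (ler_norm_sum _ _ _) _.
rewrite -mulrA mulr_natl; have -> : c * `|v| *+ k = \sum_(i < k) c * `|v|.
  by rewrite sumr_const card_ord.
by apply: ler_sum => i _; rewrite normrM mulrC ler_pM// coord_le_norm.
Qed.

Section Linear_form.
Variables (R : realType) (k : nat) (d : 'I_k -> R).
Definition linear_form (v : 'rV[R]_k) : R := \sum_i v 0 i * d i.
Lemma linear_form_is_linear : linear linear_form.
Proof.
move=> a u v; rewrite /linear_form scaler_sumr -big_split; apply: eq_bigr => i _ /=.
by rewrite !mxE mulrDl -mulrA.
Qed.
HB.instance Definition _ := GRing.isLinear.Build R _ _ _ linear_form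
  linear_form_is_linear.
End Linear_form.

Lemma linear_form_continuous (R : realType) k (d : 'I_k -> R) :
  continuous (linear_form d : 'rV[R]_k -> R^o).
Proof.
have [c dc] : exists c, forall i, `|d i| <= c.
  exists (\sum_i `|d i|) => i; rewrite (bigD1 i)//= lerDl.
  by apply: sumr_ge0 => j _.
apply: bounded_linear_continuous.
apply/linear_boundedP; near=> r => v; apply: le_trans (sum_coord_le _ dc) _.
by rewrite ler_wpM2r.
Unshelve. all: by end_near. Qed.

(** Replaces the little-o condition by an epsilon estimate, in which concrete bounds can be
    inserted. *)
Lemma diff_eps (R : realType) (V W : normedModType R) (f : V -> W)
    (df : {linear V -> W}) x : continuous df ->
  (forall e, 0 < e -> \forall w \near 0, `|f (w + x) - f x - df w| <= e * `|w|) ->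
  differentiable f x /\ 'd f x = df :> (V -> W).
Proof.
move=> cdf fe.
have fE : f \o shift x = cst (f x) + df +o_ 0 id.
  apply/eqaddoP => e /fe; apply: filterS => w.
  by rewrite !fctE /= opprD addrA.
have dE := diff_unique cdf fE.
by split=> //; apply/diff_locallyP; rewrite dE; split.
Qed.

(** * Smooth functions on R^k *)

(* [ddir g v] hides the normed-module structures that occur in ['d g x v]. *)
Definition ddir (R : realType) k (g : 'rV[R]_k -> R) (v x : 'rV[R]_k) : R :=
  'd g x v.

Section Smooth.
Variable R : realType.
Implicit Types k l m : nat.

Definition differentiable_at k (g : 'rV[R]_k -> R) (x : 'rV[R]_k) : Prop :=
  differentiable g x.

Lemma differentiable_eps k (g : 'rV[R]_k -> R) (x : 'rV[R]_k) (d : 'I_k -> R) :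
  (forall e, 0 < e -> exists2 r, 0 < r & forall w : 'rV[R]_k, `|w| < r ->
     `|g (x + w) - g x - linear_form d w| <= e * `|w|) ->
  differentiable_at g x /\ forall v, ddir g v x = linear_form d v.
Proof.
move=> gd.
have [|dg dE] := @diff_eps R _ _ (g : 'rV[R]_k -> R^o)
  (linear_form d : {linear 'rV[R]_k -> R^o}) x (@linear_form_continuous _ _ d).
  move=> e /gd[r r0 re]; apply/nbhs_normP; exists r => //= w /=.
  have -> : 0 - w = - w by exact: sub0r.
  by rewrite normrN (addrC w) => /re.
by split=> // v; exact: (congr1 (@^~ v) dE).
Qed.

Lemma ddirE k (g : 'rV[R]_k -> R) v x :
  ddir g v x = linear_form (fun i => ddir g (delta_mx 0 i) x) v.
Proof. exact: diff_coordE. Qed.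

Lemma ddirD k (f g : 'rV[R]_k -> R) v x : differentiable_at f x ->
  differentiable_at g x -> ddir (fun y => f y + g y) v x = ddir f v x + ddir g v x.
Proof. by move=> df dg; exact: (congr1 (@^~ v) (diffD df dg)). Qed.

Lemma ddirM k (f g : 'rV[R]_k -> R) v x : differentiable_at f x ->
  differentiable_at g x ->
  ddir (fun y => f y * g y) v x = f x * ddir g v x + g x * ddir f v x.
Proof. by move=> df dg; exact: (congr1 (@^~ v) (diffM df dg)). Qed.

Lemma ddirV k (g : 'rV[R]_k -> R) v x : differentiable_at g x -> g x != 0 ->
  ddir (fun y => (g y)^-1) v x = - ddir g v x * ((g x)^-1 * (g x)^-1).
Proof.
move=> dg g0; apply: etrans (congr1 (@^~ v) (diffV dg g0)) _.
change (- (g x ^- 2) * ddir g v x = - ddir g v x * ((g x)^-1 * (g x)^-1)).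
by rewrite -invfM -expr2 mulNr mulrC mulNr.
Qed.

Lemma ddir_cst k c v x : ddir (fun _ : 'rV[R]_k => c) v x = 0.
Proof. exact: (congr1 (@^~ v) (diff_cst (c : R^o) x)). Qed.

Lemma differentiable_coordE k i (x : 'rV[R]_k) :
  differentiable_at (fun x => x 0 i) x /\
  forall v, ddir (fun x => x 0 i) v x = v 0 i.
Proof.
have fE (v : 'rV[R]_k) : linear_form (fun j => (j == i)%:R) v = v 0 i.
  rewrite /linear_form (bigD1 i)//= eqxx mulr1 big1 ?addr0// => j /negPf->.
  by rewrite mulr0.
have [|d1 d2] := @differentiable_eps _ (fun x : 'rV[R]_k => x 0 i) x
      (fun j => (j == i)%:R); last by split=> // v; rewrite d2 fE.
move=> e e0; exists 1 => // w _; rewrite fE mxE [_ + w 0 i]addrC addrK subrr normr0.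
by rewrite mulr_ge0// ltW.
Qed.

Lemma ddir_coord k i (v x : 'rV[R]_k) : ddir (fun x => x 0 i) v x = v 0 i.
Proof. by have [_ ->] := differentiable_coordE i x. Qed.

Lemma differentiable_row k l (h : 'rV[R]_l -> 'rV[R]_k) (x : 'rV[R]_l) :
  (forall i, differentiable_at (fun y => h y 0 i) x) -> differentiable h x.
Proof.
move=> dh.
have hE : h = \sum_i (fun y => h y 0 i *: (delta_mx 0 i : 'rV[R]_k)).
  by apply/funext => y; rewrite {1}(row_sum_delta (h y)) fct_sumE.
by rewrite hE; apply: differentiable_sum => i; apply: differentiableZl; exact: dh.
Qed.

Lemma ddir_comp k l (g : 'rV[R]_k -> R) (h : 'rV[R]_l -> 'rV[R]_k) (x : 'rV[R]_l) :
  differentiable_at g (h x) -> (forall i, differentiable_at (fun y => h y 0 i) x) ->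
  differentiable_at (g \o h) x /\ forall v, ddir (g \o h) v x =
    \sum_i ddir (fun y => h y 0 i) v x * ddir g (delta_mx 0 i) (h x).
Proof.
move=> dg dh; have dhx := differentiable_row dh.
split=> [|v]; first exact: differentiable_comp.
have -> : ddir (g \o h) v x = ddir g ('d h x v) (h x).
  exact: (congr1 (@^~ v) (diff_comp dhx dg)).
rewrite ddirE; apply: eq_bigr => i _; congr (_ * _).
have [dc _] := differentiable_coordE i (h x).
transitivity (ddir (fun y : 'rV[R]_k => y 0 i) ('d h x v) (h x)).
  by rewrite ddir_coord.
by apply/esym; exact: (congr1 (@^~ v) (diff_comp dhx dc)).
Qed.

Lemma differentiable_nS k m (g : 'rV[R]_k -> R) : differentiable_n m.+1 g <->
  (forall x, differentiable_at g x) /\ forall v, differentiable_n m (ddir g v).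
Proof. by []. Qed.

Lemma differentiable_nW k m (g : 'rV[R]_k -> R) :
  differentiable_n m.+1 g -> differentiable_n m g.
Proof.
elim: m g => [//|m IH] g /differentiable_nS[dg ddg].
by apply/differentiable_nS; split=> // v; exact: (IH _ (ddg v)).
Qed.

Lemma smoothP k (g : 'rV[R]_k -> R) :
  smooth g <-> (forall x, differentiable_at g x) /\ forall v, smooth (ddir g v).
Proof.
split=> [sg|[dg ddg] [//|m]]; last first.
  by apply/differentiable_nS; split=> // v; exact: ddg.
by split=> [|v m]; [have [] := sg 1%N|have [_ /(_ v)] := sg m.+1].
Qed.

Lemma smooth_differentiable k (g : 'rV[R]_k -> R) x : smooth g -> differentiable_at g x.
Proof. by move=> /smoothP[]. Qed.

Lemma smooth_ddir k (g : 'rV[R]_k -> R) v : smooth g -> smooth (ddir g v).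
Proof. by move=> /smoothP[]. Qed.

Lemma smooth_continuous k (g : 'rV[R]_k -> R) : smooth g -> continuous g.
Proof. by move=> sg x; exact/differentiable_continuous/smooth_differentiable. Qed.

(** Coinduction: the smooth functions are the largest class of differentiable functions closed under
    directional derivatives. It suits explicit families such as the integrals in Hadamard's
    lemma. *)
Lemma smooth_coind k (P : set ('rV[R]_k -> R)) :
  (forall g, P g -> (forall x, differentiable_at g x) /\ forall v, P (ddir g v)) ->
  P `<=` @smooth R k.
Proof.
move=> Pcl g Pg m; elim: m g Pg => [//|m IH] g /Pcl[dg Pdg].
by apply/differentiable_nS; split=> // v; exact: (IH _ (Pdg v)).
Qed.

Lemma smooth_cst k (c : R) : smooth (fun _ : 'rV[R]_k => c).
Proof.
suff : range (fun c (x : 'rV[R]_k) => c) `<=` @smooth R k by apply; exists c.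
apply: smooth_coind => _ [a _ <-]; split=> [x|v].
  exact: (@differentiable_cst R _ R^o).
by exists 0 => //; apply/funext => x; rewrite ddir_cst.
Qed.

Lemma smooth_coord k i : smooth (fun x : 'rV[R]_k => x 0 i).
Proof.
apply/smoothP; split=> [x|v]; first by have [] := differentiable_coordE i x.
rewrite (_ : ddir _ _ = fun=> v 0 i); first exact: smooth_cst.
by apply/funext => x; rewrite ddir_coord.
Qed.

Lemma differentiable_nD k m (f g : 'rV[R]_k -> R) :
  differentiable_n m f -> differentiable_n m g -> differentiable_n m (fun x => f x + g x).
Proof.
elim: m f g => [//|m IH] f g /differentiable_nS[df ddf] /differentiable_nS[dg ddg].
apply/differentiable_nS; split=> [x|v].
  exact: (@differentiableD R _ R^o f g x (df x) (dg x)).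
rewrite (_ : ddir _ v = fun x => ddir f v x + ddir g v x).
  exact: (IH _ _ (ddf v) (ddg v)).
by apply/funext => x; exact: ddirD.
Qed.

Lemma differentiable_nM k m (f g : 'rV[R]_k -> R) :
  differentiable_n m f -> differentiable_n m g -> differentiable_n m (fun x => f x * g x).
Proof.
elim: m f g => [//|m IH] f g fm gm.
(* Leibniz's rule leaves one factor undifferentiated, so the induction hypothesis also needs [f] and
   [g] themselves at order [m]. *)
have fm' := differentiable_nW fm; have gm' := differentiable_nW gm.
move: fm gm => /differentiable_nS[df ddf] /differentiable_nS[dg ddg].
apply/differentiable_nS; split=> [x|v].
  exact: (@differentiableM R _ f g x (df x) (dg x)).
rewrite (_ : ddir _ v = fun x => f x * ddir g v x + g x * ddir f v x).
  exact: differentiable_nD (IH _ _ fm' (ddg v)) (IH _ _ gm' (ddf v)).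
by apply/funext => x; exact: ddirM.
Qed.

Lemma smoothD k (f g : 'rV[R]_k -> R) :
  smooth f -> smooth g -> smooth (fun x => f x + g x).
Proof. by move=> sf sg m; exact: differentiable_nD. Qed.

Lemma smoothM k (f g : 'rV[R]_k -> R) :
  smooth f -> smooth g -> smooth (fun x => f x * g x).
Proof. by move=> sf sg m; exact: differentiable_nM. Qed.

Lemma differentiable_n_sum k m (I : Type) (r : seq I) (F : I -> 'rV[R]_k -> R) :
  (forall i, differentiable_n m (F i)) ->
  differentiable_n m (fun x => \sum_(i <- r) F i x).
Proof.
move=> Fm; elim: r => [|i r IH].
  rewrite (_ : (fun x => _) = fun=> 0); first exact: smooth_cst.
  by apply/funext => x; rewrite big_nil.
rewrite (_ : (fun x => _) = fun x => F i x + \sum_(i <- r) F i x).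
  exact: differentiable_nD (Fm i) IH.
by apply/funext => x; rewrite big_cons.
Qed.

Lemma smooth_comp k l (g : 'rV[R]_k -> R) (h : 'rV[R]_l -> 'rV[R]_k) :
  smooth g -> (forall i, smooth (fun x => h x 0 i)) -> smooth (g \o h).
Proof.
move=> sg sh m; elim: m g sg => [//|m IH] g sg.
have d x := ddir_comp (smooth_differentiable (h x) sg)
  (fun i => smooth_differentiable x (sh i)).
apply/differentiable_nS; split=> [x|v]; first by have [] := d x.
rewrite (_ : ddir _ v = fun x => \sum_i ddir (fun y => h y 0 i) v x
   * (ddir g (delta_mx 0 i) \o h) x).
  apply: differentiable_n_sum => i; apply: differentiable_nM.
    exact: (smooth_ddir v (sh i)).
  exact: (IH _ (smooth_ddir _ sg)).
by apply/funext => x; have [_ ->] := d x.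
Qed.

(** The derivative of 1/g is a smooth function times the square of 1/g, so order [m] for 1/g gives
    order [m.+1]. *)
Lemma smoothV k (g : 'rV[R]_k -> R) : smooth g -> (forall x, g x != 0) ->
  smooth (fun x => (g x)^-1).
Proof.
move=> sg g0; elim=> [//|m IH].
apply/differentiable_nS; split=> [x|v].
  exact: differentiableV (smooth_differentiable _ _) _.
rewrite (_ : ddir _ v = fun x => (-1 * ddir g v x) * ((g x)^-1 * (g x)^-1)).
  apply: differentiable_nM; last exact: differentiable_nM.
  by apply: smoothM; [exact: smooth_cst|exact: smooth_ddir].
apply/funext => x; rewrite mulN1r; apply: ddirV => //.
exact: smooth_differentiable.
Qed.

End Smooth.

(** * Mean value theorem and strict differentiability *)

Section Mean_value.
Variable R : realType.

Lemma is_derive_line k (g : 'rV[R]_k -> R) (z w : 'rV[R]_k) (s : R) : smooth g ->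
  is_derive s 1 (fun t : R => g (z + t *: w)) (ddir g w (z + s *: w)).
Proof.
move=> sg.
have dl : is_diff s (cst z + *:%R^~ w : R -> 'rV[R]_k) (0 + *:%R^~ w) by exact: is_diffD.
have df : differentiable (cst z + *:%R^~ w : R -> 'rV[R]_k) s by case: dl.
have dg : differentiable g ((cst z + *:%R^~ w : R -> 'rV[R]_k) s).
  exact: smooth_differentiable.
have dgf := differentiable_comp df dg.
apply: DeriveDef; first exact/derivable1_diffP.
rewrite deriveE//; apply: etrans (congr1 (@^~ (1 : R)) (diff_comp df dg)) _.
rewrite /= (congr1 (@^~ (1 : R)) (diff_val (is_diff_def := dl))).
by rewrite !fctE add0r scale1r.
Qed.

Lemma mean_value k (g : 'rV[R]_k -> R) (z w : 'rV[R]_k) : smooth g ->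
  exists2 c, 0 <= c <= 1 & g (z + w) - g z = ddir g w (z + c *: w).
Proof.
move=> sg.
have d s := is_derive_line z w s sg.
have [|c c01] := @MVT_segment R (fun t : R => g (z + t *: w))
  (fun s => ddir g w (z + s *: w)) 0 1 ler01 (fun s _ => d s).
  apply: continuous_subspaceT => s; apply: differentiable_continuous.
  by apply/derivable1_diffP; have [] := d s.
by rewrite scale1r scale0r addr0 subr0 mulr1 => ->; exists c.
Qed.

Lemma ddir_near k (g : 'rV[R]_k -> R) (a : 'rV[R]_k) (e : R) : smooth g -> 0 < e ->
  \forall y \near a, forall w, `|ddir g w y - ddir g w a| <= e * `|w|.
Proof.
move=> sg e0.
(* The sum over [k] coordinates costs a factor [k]; dividing by [k.+1] absorbs it and stays positive
   for [k = 0]. *)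
have e1 : 0 < e / k.+1%:R by rewrite divr_gt0.
have : \forall y \near a, forall i : 'I_k,
    `|ddir g (delta_mx 0 i) a - ddir g (delta_mx 0 i) y| < e / k.+1%:R.
  have h (i : 'I_k) : \forall y \near a,
      `|ddir g (delta_mx 0 i) a - ddir g (delta_mx 0 i) y| < e / k.+1%:R.
    have /cvgrPdist_lt := smooth_continuous (smooth_ddir (delta_mx 0 i) sg) (x := a).
    exact.
  exact: filter_forall h.
apply: filterS => y ye w.
rewrite [X in X - _]ddirE [X in _ - X]ddirE /linear_form -sumrB.
under eq_bigr do rewrite -mulrBr.
apply: le_trans (sum_coord_le (c := e / k.+1%:R) _ _) _.
  by move=> i; rewrite distrC ltW.
rewrite ler_wpM2r// mulrCA ler_piMr ?ltW//.
by rewrite ltr_pdivrMr// mul1r ltr_nat.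
Qed.

(** Both points move, which is more than differentiability at [a]: the contraction estimate of
    [level_set_point] compares two arbitrary points near [a]. The mean value theorem reduces it to
    continuity of the derivative. *)
Lemma strict_diff k (g : 'rV[R]_k -> R) (a : 'rV[R]_k) (e : R) : smooth g -> 0 < e ->
  exists2 r, 0 < r & forall y z : 'rV[R]_k, `|y - a| < r -> `|z - a| < r ->
    `|g y - g z - ddir g (y - z) a| <= e * `|y - z|.
Proof.
move=> sg e0.
have /nbhs_normP[r /= r0 rP] := ddir_near a sg e0.
exists r => // y z ya za.
have [c /andP[c0 c1] E] := mean_value z (y - z) sg.
have -> : g y = g (z + (y - z)) by rewrite addrC subrK.
rewrite E; apply: rP => /=.
rewrite distrC.
have -> : z + c *: (y - z) - a = (1 - c) *: (z - a) + c *: (y - a).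
  by apply/rowP => i; rewrite !mxE; ring.
apply: le_lt_trans (ler_normD _ _) _; rewrite !normrZ.
rewrite (ger0_norm c0) ger0_norm ?subr_ge0//.
have [->|c_neq0] := eqVneq c 0; first by rewrite subr0 mul1r mul0r addr0.
have -> : r = (1 - c) * r + c * r by rewrite mulrBl mul1r subrK.
apply: ler_ltD; first by rewrite ler_wpM2l ?subr_ge0// ltW.
by rewrite ltr_pM2l// lt_def c_neq0.
Qed.

(** Compactness of [0, 1] makes continuity of the derivative uniform along the segment, as
    differentiation under the integral requires. *)
Lemma ddir_near_segment k (g : 'rV[R]_k -> R) (a y : 'rV[R]_k) (e : R) :
  smooth g -> 0 < e -> \forall v \near (0 : 'rV[R]_k), forall t, `[0, 1]%classic t ->
    forall w, `|ddir g w (a + t *: y + v) - ddir g w (a + t *: y)| <= e * `|w|.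
Proof.
move=> sg e0.
have /compact_near_coveringP cK := @segment_compact R 0 1.
apply: (cK _ (nbhs (0 : 'rV[R]_k)) (fun v t => forall w,
  `|ddir g w (a + t *: y + v) - ddir g w (a + t *: y)| <= e * `|w|)).
move=> t _.
have e2 : 0 < e / 2 by rewrite divr_gt0.
have N := ddir_near (a + t *: y) sg e2.
have c1 : (fun p : R * 'rV[R]_k => a + p.1 *: y + p.2) @
    filter_prod (nbhs t) (nbhs (0 : 'rV[R]_k)) --> a + t *: y.
  rewrite -[X in _ --> X]addr0; apply: cvgD; last exact: cvg_snd.
  apply: cvgD; first exact: cvg_cst.
  by apply: cvgZr_tmp; exact: cvg_fst.
have c2 : (fun p : R * 'rV[R]_k => a + p.1 *: y) @
    filter_prod (nbhs t) (nbhs (0 : 'rV[R]_k)) --> a + t *: y.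
  apply: cvgD; first exact: cvg_cst.
  by apply: cvgZr_tmp; exact: cvg_fst.
change (filter_prod (nbhs t) (nbhs (0 : 'rV[R]_k)) [set p | forall w,
  `|ddir g w (a + p.1 *: y + p.2) - ddir g w (a + p.1 *: y)| <= e * `|w|]).
pose Q z := forall w, `|ddir g w z - ddir g w (a + t *: y)| <= e / 2 * `|w|.
have N1 : filter_prod (nbhs t) (nbhs (0 : 'rV[R]_k))
  [set p | Q (a + p.1 *: y + p.2)] := c1 _ N.
have N2 : filter_prod (nbhs t) (nbhs (0 : 'rV[R]_k))
  [set p | Q (a + p.1 *: y)] := c2 _ N.
have FF : Filter (filter_prod (nbhs t) (nbhs (0 : 'rV[R]_k))) by exact: filter_prod_filter.
apply: (@filterS _ _ FF _ _ _ (@filterI _ _ FF _ _ N1 N2)) => p [H1 H2] w.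
rewrite -(subrK (ddir g w (a + t *: y)) (ddir g w (a + p.1 *: y + p.2))).
rewrite -addrA; apply: le_trans (ler_normD _ _) _.
have -> : e * `|w| = e / 2 * `|w| + e / 2 * `|w| by rewrite -mulrDl -splitr.
by apply: lerD; [exact: H1|rewrite distrC; exact: H2].
Qed.

End Mean_value.

(** * Integrals over the unit interval *)

Section Integral01.
Variable R : realType.
Implicit Types f g : R -> R.

Lemma continuous_mulr f g : continuous f -> continuous g ->
  continuous (fun t => f t * g t).
Proof. by move=> cf cg t; exact: (@cvgM R R (nbhs t) _ f g _ _ (cf t) (cg t)). Qed.

Lemma continuous_subr f g : continuous f -> continuous g ->
  continuous (fun t => f t - g t).
Proof. by move=> cf cg t; exact: (@cvgB R R^o R (nbhs t) _ f g _ _ (cf t) (cg t)). Qed.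

Definition integral01 f : R := \int[@lebesgue_measure R]_(t in `[0, 1]) f t.

Lemma integrable01 f : continuous f ->
  (@lebesgue_measure R).-integrable `[0, 1] (EFin \o f).
Proof.
move=> cf; apply: continuous_compact_integrable; first exact: segment_compact.
exact: continuous_subspaceT.
Qed.

Lemma integral01D f g : continuous f -> continuous g ->
  integral01 (fun t => f t + g t) = integral01 f + integral01 g.
Proof. by move=> cf cg; rewrite /integral01 RintegralD//; exact: integrable01. Qed.

Lemma integral01B f g : continuous f -> continuous g ->
  integral01 (fun t => f t - g t) = integral01 f - integral01 g.
Proof. by move=> cf cg; rewrite /integral01 RintegralB//; exact: integrable01. Qed.

Lemma integral01Z c f : continuous f ->
  integral01 (fun t => c * f t) = c * integral01 f.
Proof. by move=> cf; rewrite /integral01 RintegralZl//; exact: integrable01. Qed.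

Lemma integral01_cst c : integral01 (fun=> c) = c.
Proof.
rewrite /integral01 Rintegral_cst//= lebesgue_measure_itv/= lte_fin ltr01.
by rewrite oppr0 adde0 mulr1.
Qed.

Lemma le_integral01 f c : continuous f -> (forall t, 0 <= t <= 1 -> `|f t| <= c) ->
  `|integral01 f| <= c.
Proof.
move=> cf fc; apply: le_trans (le_normr_Rintegral _ (integrable01 cf)) _ => //.
rewrite -[leRHS]integral01_cst; apply: le_Rintegral => //.
- by apply: integrable01 => t; apply: continuous_comp; [exact: cf|exact: norm_continuous].
- by apply: integrable01; exact: cst_continuous.
Qed.

Lemma eq_integral01 f g : (forall t, 0 <= t <= 1 -> f t = g t) ->
  integral01 f = integral01 g.
Proof. by move=> fg; apply: eq_Rintegral => t; rewrite inE/= in_itv/= => /fg. Qed.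

Lemma integral01_sum (I : Type) (r : seq I) (F : I -> R -> R) :
  (forall i, continuous (F i)) ->
  integral01 (fun t => \sum_(i <- r) F i t) = \sum_(i <- r) integral01 (F i) /\
  continuous (fun t => \sum_(i <- r) F i t).
Proof.
move=> cF; elim: r => [|i r [IH1 IH2]].
  rewrite big_nil; have -> : (fun t => \sum_(i <- [::]) F i t) = fun=> 0.
    by apply/funext => t; rewrite big_nil.
  by split; [exact: integral01_cst|exact: cst_continuous].
have -> : (fun t => \sum_(i <- i :: r) F i t) = fun t => F i t + \sum_(i <- r) F i t.
  by apply/funext => t; rewrite big_cons.
split; first by rewrite integral01D// IH1 big_cons.
by move=> t; apply: continuousD; [exact: cF|exact: IH2].
Qed.

Lemma integral01_FTC (f df : R -> R) : continuous df ->
  (forall t : R, is_derive t (1 : R) f (df t)) -> integral01 df = f 1 - f 0.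
Proof.
move=> cdf dfdf.
have cf : continuous f.
  move=> t; apply: differentiable_continuous; apply/derivable1_diffP.
  by have [] := dfdf t.
rewrite /integral01 /Rintegral (@continuous_FTC2 R df f 0 1)//.
- exact: continuous_subspaceT.
- split=> [t _||]; first by have [] := dfdf t.
  + by apply: cvg_at_right_filter; exact: cf.
  + by apply: cvg_at_left_filter; exact: cf.
- by move=> t _; rewrite derive1E; exact: derive_val.
Qed.

End Integral01.

(** * Hadamard's lemma *)

Section Hadamard.
Variables (R : realType) (k : nat) (a : 'rV[R]_k).
Implicit Types g : 'rV[R]_k -> R.

(** Each derivative in [y] produces a factor [t]. The weight [t ^+ j] thus closes the family under
    directional derivatives: that of [mean j g] along [v] is [mean j.+1 (ddir g v)]. *)
Let mean j g (y : 'rV[R]_k) : R :=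
  integral01 (fun t => t ^+ j * g (a + t *: (y - a))).

Let line_continuous (y : 'rV[R]_k) : continuous (fun t : R => a + t *: (y - a)).
Proof.
move=> t; apply: cvgD; first exact: cvg_cst.
by apply: cvgZr_tmp; exact: cvg_id.
Qed.

Let mean_continuous j g y : smooth g ->
  continuous (fun t : R => t ^+ j * g (a + t *: (y - a))).
Proof.
move=> sg t; apply: (@cvgM R R (nbhs t) _ (fun t : R => t ^+ j)
    (fun t : R => g (a + t *: (y - a)))); first exact: exprn_continuous.
apply: (@continuous_comp _ _ _ (fun t : R => a + t *: (y - a)) g).
  exact: line_continuous.
exact: smooth_continuous.
Qed.

Let mean_linear j g y w : smooth g ->
  linear_form (fun i => mean j (ddir g (delta_mx 0 i)) y) w = mean j (ddir g w) y.
Proof.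
move=> sg; have c i := @mean_continuous j _ y (smooth_ddir (delta_mx 0 i) sg).
rewrite /linear_form; under eq_bigr do rewrite -integral01Z//.
have cF i : continuous (fun t : R => w 0 i * (t ^+ j * ddir g (delta_mx 0 i) (a + t *: (y - a)))).
  by apply: continuous_mulr => //; exact: cst_continuous.
rewrite -(proj1 (integral01_sum (index_enum _) cF)).
apply: eq_integral01 => t _; rewrite [in RHS]ddirE /linear_form mulr_sumr.
by apply: eq_bigr => i _; rewrite mulrCA.
Qed.

Let mean_diff j g y : smooth g -> differentiable_at (mean j g) y /\
  forall v, ddir (mean j g) v y = mean j.+1 (ddir g v) y.
Proof.
move=> sg.
have [|d1 d2] := @differentiable_eps R k (mean j g) y
    (fun i => mean j.+1 (ddir g (delta_mx 0 i)) y); last first.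
  by split=> // v; rewrite d2 mean_linear.
move=> e e0; have /nbhs_normP[r /= r0 rP] := ddir_near_segment a (y - a) sg e0.
exists r => // w wr; rewrite mean_linear//.
have c1 := @mean_continuous j _ (y + w) sg.
have c2 := @mean_continuous j _ y sg.
have c3 := @mean_continuous j.+1 _ y (smooth_ddir w sg).
have c12 : continuous (fun t : R => t ^+ j * g (a + t *: (y + w - a)) -
    t ^+ j * g (a + t *: (y - a))).
  exact: continuous_subr.
rewrite /mean -integral01B// -integral01B//.
apply: le_integral01 => [t|t /andP[t0 t1]].
  exact: (continuous_subr c12 c3).
(* At parameter [t] the argument of [g] moves by [t *: w], which supplies the extra factor [t]. The
   intermediate point is off the segment by [(c * t) *: w], of norm at most that of [w], so the
   uniform estimate [rP] applies. *)
have [c /andP[c0 c1'] E] := mean_value (a + t *: (y - a)) (t *: w) sg.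
rewrite exprSr -mulrA -!mulrBr normrM.
have -> : a + t *: (y + w - a) = a + t *: (y - a) + t *: w.
  by apply/rowP => i; rewrite !mxE; ring.
rewrite E.
have dZ z : ddir g (t *: w) z = t * ddir g w z.
  rewrite 2!ddirE /linear_form mulr_sumr; apply: eq_bigr => i _.
  by rewrite mxE mulrA.
rewrite dZ -mulrBr normrM mulrA -[leRHS]mul1r.
apply: ler_pM => //.
- by rewrite normrX -exprSr exprn_ile1// ger0_norm.
- apply: rP; last by rewrite /= in_itv/= t0 t1.
  rewrite /= sub0r normrN scalerA normrZ; apply: le_lt_trans wr.
  by rewrite ler_piMl// normrM mulr_ile1// ger0_norm.
Qed.

Let mean_smooth j g : smooth g -> smooth (mean j g).
Proof.
move=> sg.
pose P := [set h | exists j g, smooth g /\ h = mean j g].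
suff : P `<=` @smooth R k by apply; exists j, g.
apply: smooth_coind => _ [i [h [sh ->]]].
split=> [x|v]; first by have [] := mean_diff i x sh.
exists i.+1, (ddir h v); split; first exact: smooth_ddir.
by apply/funext => x; have [_ ->] := mean_diff i x sh.
Qed.

(** The coefficients are the means of the partial derivatives over the segment from [a] to [y]; the
    expansion is the fundamental theorem of calculus on that segment. *)
Lemma Hadamard_lemma g : smooth g -> exists h : 'I_k -> 'rV[R]_k -> R,
  [/\ forall i, smooth (h i),
      forall y, g y = g a + \sum_i (y 0 i - a 0 i) * h i y &
      forall i, h i a = ddir g (delta_mx 0 i) a].
Proof.
move=> sg; exists (fun i => mean 0 (ddir g (delta_mx 0 i))); split.
- by move=> i; exact/mean_smooth/smooth_ddir.
- move=> y.
  have -> : \sum_i (y 0 i - a 0 i) * mean 0 (ddir g (delta_mx 0 i)) y =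
      mean 0 (ddir g (y - a)) y.
    by rewrite -mean_linear//; apply: eq_bigr => i _; rewrite !mxE.
  have c := @mean_continuous 0%N _ y (smooth_ddir (y - a) sg).
  have := @integral01_FTC R (fun t => g (a + t *: (y - a)))
    (fun t => t ^+ 0 * ddir g (y - a) (a + t *: (y - a))) c.
  have h (t : R) : is_derive t (1 : R) (fun t : R => g (a + t *: (y - a)))
      (t ^+ 0 * ddir g (y - a) (a + t *: (y - a))).
    by rewrite expr0 mul1r; exact: is_derive_line.
  rewrite /mean => E; rewrite (E h).
  by rewrite scale1r scale0r addr0 [a + _]addrC subrK addrC subrK.
- move=> i; rewrite /mean -[RHS]integral01_cst; apply: eq_integral01 => t _.
  by rewrite subrr scaler0 addr0 expr0 mul1r.
Qed.

End Hadamard.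

(** * A flat function and cut-offs *)

Section Flat.
Variable R : realType.
Implicit Types (n : nat) (t : R).

Definition smooth1 (f : R -> R) : Prop := smooth (fun x : 'rV[R]_1 => f (x 0 0)).

Lemma smooth1_comp k (f : R -> R) (g : 'rV[R]_k -> R) :
  smooth1 f -> smooth g -> smooth (fun x => f (g x)).
Proof.
move=> sf sg.
have := @smooth_comp R 1 k (fun x : 'rV[R]_1 => f (x 0 0)) (fun x => \row_(_ < 1) g x) sf.
rewrite /comp; under eq_fun do rewrite mxE; apply=> i.
by under eq_fun do rewrite mxE.
Qed.

Lemma is_derive_coord (f : R -> R) (d : R) (x : 'rV[R]_1) : is_derive (x 0 0) (1 : R) f d ->
  differentiable_at (fun x : 'rV[R]_1 => f (x 0 0)) x /\
  forall v, ddir (fun x : 'rV[R]_1 => f (x 0 0)) v x = v 0 0 * d.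
Proof.
move=> fd.
have [dc _] := differentiable_coordE 0 x.
have df : differentiable f (x 0 0) by apply/derivable1_diffP; case: fd.
split; first exact: (differentiable_comp dc df).
move=> v; apply: etrans (congr1 (@^~ v) (diff_comp dc df)) _.
rewrite /= -(ddir_coord 0 v x) -/(ddir (fun x : 'rV[R]_1 => x 0 0) v x).
set s := ddir _ _ _.
have -> : 'd f (x 0 0) s = s * 'd f (x 0 0) 1.
  by rewrite -[in LHS](mulr1 s) linearZ.
by congr (_ * _); rewrite -deriveE//; exact: derive_val.
Qed.

(** The powers of 1/t are there because differentiation of exp(-1/t) creates them: the derivative of
    [flatn n] is a combination of [flatn n.+2] and [flatn n.+1]. *)
Definition flatn n t : R := if 0 < t then t^-1 ^+ n * expR (- t^-1) else 0.

(** Comes from exp(1/t) >= (1/t)^(n+2) / (n+2)!. A quadratic bound is what makes [flatn n]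
    differentiable at 0 with derivative 0. *)
Lemma flatn_le n t : `|flatn n t| <= (n.+2)`!%:R * t ^+ 2.
Proof.
rewrite /flatn; case: ifPn => t0; last by rewrite normr0 mulr_ge0// sqr_ge0.
rewrite ger0_norm; last by rewrite mulr_ge0// ?expR_ge0// exprn_ge0// invr_ge0 ltW.
rewrite expRN ler_pdivrMr ?expR_gt0//.
have := @expR_ge1Dxn R t^-1 n.+1; rewrite invr_ge0 (ltW t0) => /(_ isT) h.
have f0 : 0 < (n.+2)`!%:R :> R by rewrite ltr0n fact_gt0.
have {h}: t^-1 ^+ n.+2 / (n.+2)`!%:R <= expR t^-1.
  by apply: le_trans h; rewrite lerDr.
rewrite ler_pdivrMr// => h.

have -> : t^-1 ^+ n = t ^+ 2 * t^-1 ^+ n.+2.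
  by rewrite exprVn exprVn -[n.+2]addn2 exprD invfM mulrCA divff ?mulr1// expf_neq0// gt_eqF.
have -> : (n.+2)`!%:R * t ^+ 2 * expR t^-1 = t ^+ 2 * (expR t^-1 * (n.+2)`!%:R) by ring.
by rewrite ler_pM2l ?exprn_gt0.
Qed.

Lemma is_derive_flatn n t : is_derive t (1 : R) (flatn n) (flatn n.+2 t - n%:R * flatn n.+1 t).
Proof.
have [t0|t0|t0] := ltrgt0P t.
- rewrite /flatn t0.
  apply: (@near_eq_is_derive R R^o R^o (fun s : R => s^-1 ^+ n * expR (- s^-1))).
    near=> s; have -> : 0 < s by near: s; exact: lt_nbhsr.
    by [].
  have tn0 : t != 0 by rewrite gt_eqF.
  have dV : is_derive t (1 : R) (fun s : R => s^-1) (- t^-1 ^+ 2).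
    have := @is_deriveV R id t 1 1 tn0 (@is_derive_id R R^o t 1).
    by rewrite /GRing.scale /= mulr1 exprVn.
  have dX := @is_deriveX R R^o (fun s : R => s^-1) n t 1 _ dV.
  have dE := @is_derive1_comp R expR _ t _ _ (is_derive_expR _)
    (@is_deriveN R R^o R^o (fun s : R => s^-1) t 1 _ dV).
  have dM := @is_deriveM R R^o _ _ t 1 _ _ dX dE.
  rewrite exprfctE in dM.
  apply: (is_derive_eq dM).
  change (t^-1 ^+ n * (expR (- t^-1) * - - t^-1 ^+ 2) +
    expR (- t^-1) * ((n%:R * t^-1 ^+ n.-1) * - t^-1 ^+ 2) =
    t^-1 ^+ n.+2 * expR (- t^-1) - n%:R * (t^-1 ^+ n.+1 * expR (- t^-1))).
  move: (expR _) => E.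
  by case: (n) => [|m] /=; rewrite !exprS ?expr0; ring.
- rewrite /flatn (lt_gtF t0) mulr0 subr0.
  have h : is_derive t (1 : R) (fun _ : R^o => 0 : R^o) 0 by exact: is_derive_cst.
  apply: (@near_eq_is_derive R R^o R^o (fun=> 0)) h.
  near=> s; have -> : 0 < s = false; last by [].
  by apply: lt_gtF; near: s; exact: lt_nbhsl.
- rewrite t0 /flatn ltxx mulr0 subr0.
  have [|d1 d2] := @diff_eps R R^o R^o (flatn n) \0 0 (@cst_continuous _ _ 0).
    move=> e e0; have f0 : 0 < (n.+2)`!%:R :> R by rewrite ltr0n fact_gt0.
    near=> w; have -> : flatn n (w + 0) - flatn n 0 - \0 w = flatn n w.
      by rewrite /= addr0 subr0 {2}/flatn ltxx subr0.
    apply: le_trans (flatn_le n w) _.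
    have -> : w ^+ 2 = `|w| * `|w| by rewrite -expr2 real_normK ?num_real.
    rewrite mulrA ler_wpM2r//.
    rewrite mulrC -ler_pdivlMr//; near: w.
    apply/nbhs_normP; exists (e / (n.+2)`!%:R) => /=; first by rewrite divr_gt0.
    by move=> w /=; rewrite sub0r normrN => /ltW.
  apply: DeriveDef; first exact/derivable1_diffP.
  by rewrite deriveE// d2.
Unshelve. all: by end_near. Qed.

Lemma smooth1_flatn n : smooth1 (flatn n).
Proof.
move=> m; elim: m n => [//|m IH] n; apply/differentiable_nS; split=> [x|v].
  by have [] := is_derive_coord (is_derive_flatn n (x 0 0)).
rewrite (_ : ddir _ v = fun x => v 0 0 * (flatn n.+2 (x 0 0) + - n%:R * flatn n.+1 (x 0 0))).
  apply: differentiable_nM; first exact: smooth_cst.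
  apply: differentiable_nD; first exact: IH.
  by apply: differentiable_nM; [exact: smooth_cst|exact: IH].
by apply/funext => x; have [_ ->] := is_derive_coord (is_derive_flatn n (x 0 0)); rewrite mulNr.
Qed.

Definition flat t : R := flatn 0 t.

Lemma smooth1_flat : smooth1 flat.
Proof. exact: smooth1_flatn. Qed.

Lemma flat_gt0 t : (0 < flat t) = (0 < t).
Proof.
by rewrite /flat /flatn; case: ifP => // _; rewrite ?ltxx// expr0 mul1r expR_gt0.
Qed.

Lemma flat_ge0 t : 0 <= flat t.
Proof.
by rewrite /flat /flatn; case: ifP => // _; rewrite expr0 mul1r expR_ge0.
Qed.

Lemma flat_eq0 t : t <= 0 -> flat t = 0.
Proof. by rewrite /flat /flatn leNgt => /negbTE ->. Qed.

Lemma smooth1_lin (a b : R) : smooth1 (fun t => a * t + b).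
Proof.
apply: smoothD; last exact: smooth_cst.
by apply: smoothM; [exact: smooth_cst|exact: smooth_coord].
Qed.

(** The quotient of flat(t - c) by flat(t - c) + flat(2c - t). The denominator is positive because
    every t satisfies c < t or t < 2c. *)
Lemma smooth_step (c : R) : 0 < c -> exists f : R -> R, [/\ smooth1 f,
  forall t, t <= c -> f t = 0 & forall t, 2 * c <= t -> f t = 1].
Proof.
move=> c0; pose d t := flat (1 * t + - c) + flat (-1 * t + 2 * c).
have d0 t : 0 < d t.
  rewrite /d; have [tc|tc] := ltrP c t.
    by apply: ltr_wpDr; rewrite ?flat_ge0// flat_gt0 mul1r subr_gt0.
  apply: ltr_wpDl; rewrite ?flat_ge0// flat_gt0 mulN1r addrC subr_gt0.
  by apply: le_lt_trans tc _; rewrite mulr_natl mulr2n ltrDl.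
exists (fun t => flat (1 * t + - c) * (d t)^-1); split.
- apply: smoothM.
    exact: (@smooth1_comp 1 _ _ smooth1_flat (smooth1_lin _ _)).
  apply: smoothV; last by move=> x; rewrite gt_eqF.
  apply: smoothD; exact: (@smooth1_comp 1 _ _ smooth1_flat (smooth1_lin _ _)).
- by move=> t tc; rewrite flat_eq0 ?mul0r// mul1r subr_le0.
- move=> t tc; rewrite /d [X in _ / (_ + X)]flat_eq0.
    rewrite addr0 divff// gt_eqF// flat_gt0 mul1r subr_gt0.
    by apply: lt_le_trans tc; rewrite mulr_natl mulr2n ltrDl.
  by rewrite mulN1r addrC subr_le0.
Qed.

(** The function t / (t^2 + flat(c^2 - t^2)): the flat term keeps the denominator positive at 0 and
    vanishes for t >= c. Composition with functions on a manifold asks for a substitute for 1/t that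
    is smooth on the whole line. *)
Lemma smooth_inv (c : R) : 0 < c -> exists f : R -> R, smooth1 f /\
  forall t, c <= t -> f t = t^-1.
Proof.
move=> c0; pose d t := t * t + flat (-1 * (t * t) + c ^+ 2).
have d0 t : 0 < d t.
  rewrite /d; have [->|t0] := eqVneq t 0.
    by rewrite mulr0 add0r mulr0 add0r flat_gt0 exprn_gt0.
  by apply: ltr_wpDr; rewrite ?flat_ge0// -expr2 exprn_even_gt0.
have sq : smooth (fun x : 'rV[R]_1 => x 0 0 * x 0 0) by apply: smoothM; exact: smooth_coord.
exists (fun t => t * (d t)^-1); split.
  apply: smoothM; first exact: smooth_coord.
  apply: smoothV; last by move=> x; rewrite gt_eqF.
  apply: smoothD => //.
  apply: (@smooth1_comp 1 _ (fun x => -1 * (x 0 0 * x 0 0) + c ^+ 2) smooth1_flat).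
  apply: smoothD; last exact: smooth_cst.
  by apply: smoothM => //; exact: smooth_cst.
move=> t ct; have t0 : t != 0 by rewrite gt_eqF// (lt_le_trans c0).
rewrite /d flat_eq0; first by rewrite addr0 invfM mulrA divff// mul1r.
by rewrite mulN1r addrC subr_le0 -expr2 lerXn2r// nnegrE ltW// (lt_le_trans c0).
Qed.

End Flat.

(** * Points on level sets *)

Lemma finite_common_radius (R : realType) n (P : 'I_n -> R -> Prop) :
  (forall i r r', 0 < r' -> r' <= r -> P i r -> P i r') ->
  (forall i, exists2 r, 0 < r & P i r) -> exists2 r, 0 < r & forall i, P i r.
Proof.
move=> Pmono ex; have /choice[r rP'] i : exists r, 0 < r /\ P i r.
  by have [r r0 rP] := ex i; exists r.
have r0 i := proj1 (rP' i); have rP i := proj2 (rP' i).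
have s0 : 0 <= \sum_i (r i)^-1 by apply: sumr_ge0 => i _; rewrite invr_ge0 ltW.
have s1 : 0 < 1 + \sum_i (r i)^-1 by apply: ltr_wpDr.
(* A positive lower bound for all the radii; the summand 1 covers the empty family. *)
exists (1 + \sum_i (r i)^-1)^-1; first by rewrite invr_gt0.
move=> i; apply: Pmono (rP i); first by rewrite invr_gt0.
rewrite -[leRHS]invrK lef_pV2 ?posrE ?invr_gt0//.
rewrite (bigD1 i)//= addrCA lerDl addr_ge0//.
by apply: sumr_ge0 => j _; rewrite invr_ge0 ltW.
Qed.

Lemma norm_row_le (R : realType) n (w : 'rV[R]_n) c : 0 <= c ->
  (forall i, `|w 0 i| <= c) -> `|w| <= c.
Proof.
move=> c0 wc; rewrite [leLHS]/Num.Def.normr /= mx_normrE.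
by apply/bigmax_leP; split=> // -[i j] _ /=; rewrite ord1.
Qed.

Lemma closed_norm_le (R : realType) n (c : R) : closed [set w : 'rV[R]_n | `|w| <= c].
Proof.
have -> : [set w : 'rV[R]_n | `|w| <= c] =
    (fun w : 'rV[R]_n => `|w|) @^-1` [set x | x <= c] by [].
apply: closed_comp; last exact: closed_le.
by move=> w _; exact: norm_continuous.
Qed.

Lemma ddirZl (R : realType) k (g : 'rV[R]_k -> R) (t : R) w z :
  ddir g (t *: w) z = t * ddir g w z.
Proof. exact: linearZ. Qed.

Lemma ddirDl (R : realType) k (g : 'rV[R]_k -> R) v w z :
  ddir g (v + w) z = ddir g v z + ddir g w z.
Proof. exact: linearD. Qed.

Lemma ddir_suml (R : realType) k (g : 'rV[R]_k -> R) (I : Type) (r : seq I)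
    (F : I -> 'rV[R]_k) z :
  ddir g (\sum_(i <- r) F i) z = \sum_(i <- r) ddir g (F i) z.
Proof. exact: linear_sum. Qed.

(** Lets row vectors serve as the complete normed space in [banach_fixed_point]. *)
HB.instance Definition _ (R : realType) (m n : nat) := Complete.on 'M[R]_(m, n).

Section Level_set.
Variables (R : realType) (m n : nat) (S : 'rV[R]_m -> 'rV[R]_n) (a v : 'rV[R]_m).
Hypothesis S_smooth : forall i, smooth (fun x => S x 0 i).
Hypothesis v_tangent : forall i, ddir (fun x => S x 0 i) v a = 0.
Variable B : 'I_n -> 'rV[R]_m.
Hypothesis S_submersion : forall i j, ddir (fun x => S x 0 i) (B j) a = (i == j)%:R.

(** A linear right inverse of the differential of [S] at [a]. Correcting [a + t *: v] only by
    vectors of its image gives as many unknowns as equations. *)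
Let L (w : 'rV[R]_n) : 'rV[R]_m := \sum_j w 0 j *: B j.

Let LB w w' : L w - L w' = L (w - w').
Proof. by rewrite /L -sumrB; apply: eq_bigr => j _; rewrite -scalerBl !mxE. Qed.

Let L0 : L 0 = 0.
Proof. by rewrite /L big1// => j _; rewrite mxE scale0r. Qed.

Let ddirL i w : ddir (fun x => S x 0 i) (L w) a = w 0 i.
Proof.
rewrite /L ddir_suml (bigD1 i)//= ddirZl S_submersion eqxx mulr1 big1 ?addr0//.
by move=> j /negPf ji; rewrite ddirZl S_submersion eq_sym ji mulr0.
Qed.

Let C : R := 1 + n%:R * \sum_j `|B j|.

Let C_gt0 : 0 < C.
Proof. by apply: ltr_wpDr => //; rewrite mulr_ge0// sumr_ge0. Qed.

Let normL w : `|L w| <= C * `|w|.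
Proof.
apply: le_trans (ler_norm_sum _ _ _) _.
have -> : C * `|w| = `|w| + \sum_(j < n) (\sum_j `|B j|) * `|w|.
  by rewrite /C mulrDl mul1r sumr_const card_ord mulr_natl mulrnAl.
apply: le_trans (_ : \sum_(j < n) (\sum_j `|B j|) * `|w| <= _); last by rewrite lerDr.
apply: ler_sum => j _; rewrite normrZ mulrC ler_pM ?coord_le_norm//.
by rewrite (bigD1 j)//= lerDl sumr_ge0.
Qed.

(** Newton's method with the derivative frozen at [a]: a fixed point [w] of [T] satisfies S(a + t v
    + L w) = S a. Since [v] is in the kernel of the differential, [T 0] is small compared with [t],
    and so is the correction. *)
Lemma level_set_point (e : R) : 0 < e -> exists2 t0, 0 < t0 & forall t, 0 < t < t0 ->
  exists2 y, S y = S a & `|y - (a + t *: v)| <= e * t.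
Proof.
move=> e0.
have v1 : 0 < `|v| + 1 by rewrite ltr_wpDl.
(* [q] is the tolerance in strict differentiability. The bound 2Cq <= 1 makes [T] a contraction of
   ratio 1/2, and 2Cq|v| <= e bounds the final correction by e t. *)
pose q := (2 * C)^-1 * Num.min 1 (e / (`|v| + 1)).
have m0 : 0 < Num.min 1 (e / (`|v| + 1)) by rewrite lt_min ltr01 divr_gt0.
have q0 : 0 < q by rewrite mulr_gt0// invr_gt0 mulr_gt0.
have q1 : 2 * C * q <= 1.
  by rewrite /q mulrA divff ?mul1r ?ge_min ?lexx// gt_eqF// mulr_gt0.
have q2 : 2 * C * q * `|v| <= e.
  apply: le_trans (_ : e / (`|v| + 1) * `|v| <= _).
    rewrite ler_wpM2r// /q mulrA divff ?mul1r ?ge_min ?lexx ?orbT//.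
    by rewrite gt_eqF// mulr_gt0.
  by rewrite mulrAC ler_pdivrMr// ler_pM2l// lerDl.
clearbody q.
have [r r0 rP] : exists2 r, 0 < r & forall i, forall y z : 'rV[R]_m,
    `|y - a| < r -> `|z - a| < r ->
    `|S y 0 i - S z 0 i - ddir (fun x => S x 0 i) (y - z) a| <= q * `|y - z|.
  apply: finite_common_radius => [i r r' r0 rr' h y z yr zr|i].
    by apply: h; exact: lt_le_trans rr'.
  exact: strict_diff.
exists (r / (2 * (`|v| + 1))); first by rewrite divr_gt0// mulr_gt0.
move=> t /andP[t0 tr].
(* The solution of rho = rho/2 + q t |v|, where q t |v| bounds [T 0]; hence [T] maps the ball of
   radius [rho] into itself. *)
pose rho := 2 * q * t * `|v|.
have rho0 : 0 <= rho by rewrite /rho !mulr_ge0 ?(ltW q0) ?(ltW t0).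
pose T (w : 'rV[R]_n) := w - (S (a + t *: v + L w) - S a).
pose U := [set w : 'rV[R]_n | `|w| <= rho].
have near_a w : U w -> `|a + t *: v + L w - a| < r.
  move=> Uw; have -> : a + t *: v + L w - a = t *: v + L w by rewrite addrC addrA addKr.
  apply: le_lt_trans (ler_normD _ _) _.
  apply: le_lt_trans (_ : t * `|v| + C * rho < _).
    by rewrite normrZ gtr0_norm// lerD2l; apply: le_trans (normL w) _; rewrite ler_pM2l.
  have -> : t * `|v| + C * rho = (1 + 2 * C * q) * (t * `|v|) by rewrite /rho; ring.
  apply: le_lt_trans (_ : 2 * (t * `|v|) < _).
    have tv0 : 0 <= t * `|v| by rewrite mulr_ge0// ltW.
    by apply: ler_wpM2r => //; rewrite -[leRHS]/(1 + 1) lerD2l.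
  apply: le_lt_trans (_ : 2 * (t * (`|v| + 1)) < _).
    by rewrite ler_pM2l// ler_pM2l// lerDl.
  by rewrite mulrCA -ltr_pdivlMr// mulr_gt0.
have U0 : U 0 by rewrite /U /= normr0.
have TB w w' : U w -> U w' -> `|T w - T w'| <= 2^-1 * `|w - w'|.
  move=> Uw Uw'; apply: norm_row_le; first by rewrite mulr_ge0// invr_ge0.
  move=> i.
  have := rP i _ _ (near_a _ Uw) (near_a _ Uw').
  have -> : a + t *: v + L w - (a + t *: v + L w') = L (w - w').
    by rewrite -LB opprD addrACA subrr add0r.
  rewrite ddirL distrC => h.
  have -> : (T w - T w') 0 i = (w - w') 0 i -
      (S (a + t *: v + L w) 0 i - S (a + t *: v + L w') 0 i).
    by rewrite /T !mxE; ring.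
  apply: le_trans h _.
  apply: le_trans (_ : q * (C * `|w - w'|) <= _); first by rewrite ler_pM2l.
  rewrite mulrA ler_wpM2r// -(ler_pM2l (ltr0n R 2)) mulfV ?pnatr_eq0//.
  by rewrite [q * C]mulrC mulrA.
have T0 : `|T 0| <= q * t * `|v|.
  apply: norm_row_le; first by rewrite !mulr_ge0 ?(ltW q0) ?(ltW t0).
  move=> i; have := rP i _ _ (near_a _ U0) (_ : `|a - a| < r).
  rewrite subrr normr0 => /(_ r0).
  have -> : a + t *: v + L 0 - a = t *: v by rewrite L0 addr0 addrC addKr.
  rewrite ddirZl v_tangent mulr0 subr0 normrZ gtr0_norm// mulrA.
  by rewrite /T !mxE sub0r normrN.
have TU : {homo T : w / U w >-> U w}.
  move=> w Uw; rewrite /U /= -(subrK (T 0) (T w)).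
  apply: le_trans (ler_normD _ _) _.
  have -> : rho = 2^-1 * rho + q * t * `|v|.
    rewrite /rho !mulrA mulVf ?pnatr_eq0// mul1r; ring.
  apply: lerD => //; apply: le_trans (TB _ _ Uw U0) _.
  by rewrite subr0 ler_pM2l// invr_gt0.
have [] := @banach_fixed_point R 'rV[R]_n U (mkfun TU).
- exists (2^-1)%:nng; split=> /=; first by rewrite invf_lt1 ?ltr1n.
  by move=> [w w'] [/= Uw Uw']; exact: TB.
- exact: closed_norm_le.
- by exists 0.
- move=> w Uw /= wT; exists (a + t *: v + L w).
    apply/esym/eqP; rewrite -subr_eq0 -oppr_eq0 opprB; apply/eqP.
    have := wT; rewrite /T => /(congr1 (fun z => w - z)).
    by rewrite subrr opprB addrC subrK => /esym.
  rewrite addrC addrA addNr add0r; apply: le_trans (normL w) _.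
  apply: le_trans (_ : C * rho <= _); first by rewrite ler_pM2l.
  have -> : C * rho = 2 * C * q * `|v| * t by rewrite /rho; ring.
  by rewrite ler_pM2r.
Qed.

(** On the level set there are points a + t v + o(t) at which [g] vanishes, so t dg(v) = o(t). *)
Lemma level_set_tangent (g : 'rV[R]_m -> R) (r : R) : smooth g -> 0 < r ->
  (forall y, `|y - a| < r -> S y = S a -> g y = 0) -> ddir g v a = 0.
Proof.
move=> sg r0 gr; apply: contrapT => /eqP; rewrite -normr_gt0 => d0.
pose M : R := \sum_i `|ddir g (delta_mx 0 i) a|.
have M0 : 0 <= M by apply: sumr_ge0.
have gM w : `|ddir g w a| <= m%:R * M * `|w|.
  rewrite ddirE; apply: sum_coord_le => i.
  by rewrite /M (bigD1 i)//= lerDl sumr_ge0.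
(* Collects the two errors, each in units of e t: |v| + 1 from the first order expansion of [g], as
   |y - a| <= t (|v| + 1), and m M from dg applied to the deviation of [y] from a + t v. *)
pose c := `|v| + 1 + m%:R * M.
have c0 : 0 < c by rewrite /c ltr_wpDr ?mulr_ge0// ltr_wpDl.
pose e := Num.min 1 (`|ddir g v a| / (2 * c)).
have e0 : 0 < e by rewrite lt_min ltr01 divr_gt0// mulr_gt0.
have e1 : e <= 1 by rewrite ge_min lexx.
have ec : e * c < `|ddir g v a|.
  apply: le_lt_trans (_ : `|ddir g v a| / 2 < _).
    by rewrite -ler_pdivlMr// -mulrA -invfM ge_min lexx orbT.
  by rewrite ltr_pdivrMr// ltr_pMr// ltr1n.
have [r1 r10 r1P] := strict_diff a sg e0.
have [t0 t00 tP] := level_set_point e0.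
have v1 : 0 < `|v| + 1 by rewrite ltr_wpDl.
pose s := Num.min (Num.min r r1 / (`|v| + 1)) t0.
have s0 : 0 < s by rewrite !lt_min !divr_gt0// lt_min r0.
pose t := s / 2.
have t_gt0 : 0 < t by rewrite divr_gt0.
have ts : t < s by rewrite ltr_pdivrMr// ltr_pMr// ltr1n.
have tt0 : t < t0 by apply: lt_le_trans ts _; rewrite ge_min lexx orbT.
have [|y Sy yt] := tP t; first by rewrite t_gt0.
have ya : `|y - a| <= t * (`|v| + 1).
  have -> : y - a = (y - (a + t *: v)) + t *: v by rewrite opprD addrA subrK.
  apply: le_trans (ler_normD _ _) _; rewrite normrZ gtr0_norm// mulrDr mulr1 addrC.
  by rewrite lerD2l (le_trans yt)// ler_piMl// ltW.
have yr : `|y - a| < Num.min r r1.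
  apply: le_lt_trans ya _; rewrite -ltr_pdivlMr//.
  by apply: lt_le_trans ts _; rewrite ge_min lexx.
move: yr; rewrite lt_min => /andP[yr yr1].
have := r1P y a yr1; rewrite subrr normr0 => /(_ r10).
have ga : g a = 0 by apply: gr => //; rewrite subrr normr0.
have gy : g y = 0 by exact: gr.
rewrite ga gy subrr sub0r normrN => h.
have : `|t * ddir g v a| <= t * (e * c).
  have -> : t * ddir g v a = ddir g (y - a) a - ddir g (y - (a + t *: v)) a.
    have -> : y - a = (y - (a + t *: v)) + t *: v by rewrite opprD addrA subrK.
    by rewrite ddirDl ddirZl addrAC subrr add0r.
  apply: le_trans (ler_normB _ _) _.
  have -> : t * (e * c) = e * (t * (`|v| + 1)) + m%:R * M * (e * t) by rewrite /c; ring.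
  apply: lerD; first by apply: le_trans h _; rewrite ler_pM2l.
  by apply: le_trans (gM _) _; rewrite ler_wpM2l// mulr_ge0.
rewrite normrM gtr0_norm// ler_pM2l// => /(lt_le_trans ec); by rewrite ltxx.
Qed.

End Level_set.

(** * Algebras of smooth functions *)

(** Intersects basic open sets {0 < b}. A plain product would also be positive where both factors
    are negative; [flat] vanishes there. *)
Lemma flatM_gt0 (R : realType) (a b : R) : 0 < flat a * flat b -> 0 < a /\ 0 < b.
Proof.
have [a0|/flat_eq0->] := ltrP 0 a; last by rewrite mul0r ltxx.
by have [b0|/flat_eq0->] := ltrP 0 b; last by rewrite mulr0 ltxx.
Qed.

Lemma smooth_lsubmx (R : realType) k l (g : 'rV[R]_k -> R) : smooth g ->
  smooth (fun z : 'rV[R]_(k + l) => g (lsubmx z)).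
Proof.
move=> sg; apply: (smooth_comp (h := fun z : 'rV[R]_(k + l) => lsubmx z) sg) => i.
by under eq_fun do rewrite mxE; exact: smooth_coord.
Qed.

Lemma smooth_rsubmx (R : realType) k l (g : 'rV[R]_l -> R) : smooth g ->
  smooth (fun z : 'rV[R]_(k + l) => g (rsubmx z)).
Proof.
move=> sg; apply: (smooth_comp (h := fun z : 'rV[R]_(k + l) => rsubmx z) sg) => i.
by under eq_fun do rewrite mxE; exact: smooth_coord.
Qed.

Section Smooth_closure.
Variables (R : realType) (T : Type) (G : set (T -> R)).

Definition local_rep (p : T) k (h : T -> 'rV[R]_k) (b : 'rV[R]_k -> R) : Prop :=
  [/\ forall i, G (fun q => h q 0 i), smooth b & 0 < b (h p)].

Definition smooth_near (p : T) (f : T -> R) : Prop :=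
  exists k (h : T -> 'rV[R]_k) b g, [/\ local_rep p h b, smooth g &
    forall q, 0 < b (h q) -> f q = g (h q)].

Lemma smooth_closureP f : smooth_closure G f <-> forall p, smooth_near p f.
Proof.
split=> H p; have := H p.
  by move=> [k [h [b [g [Gh sb sg b0 fg]]]]]; exists k, h, b, g.
by move=> [k [h [b [g [[Gh sb b0] sg fg]]]]]; exists k, h, b, g; split.
Qed.

Lemma sub_smooth_closure : G `<=` smooth_closure G.
Proof.
move=> f Gf p; exists 1%N, (fun q => \row_(_ < 1) f q), (fun=> 1), (fun x => x 0 0).
split=> //; first by move=> i; under eq_fun do rewrite mxE.
- exact: smooth_cst.
- exact: smooth_coord.
- by move=> q _; rewrite mxE.
Qed.

(** Concatenating the maps that represent single functions gives one map and one domain serving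
    finitely many functions at once. *)
Lemma local_rep_family p n (F : nat -> T -> R) :
  (forall i, (i < n)%N -> smooth_near p (F i)) ->
  exists k (h : T -> 'rV[R]_k) b (g : nat -> 'rV[R]_k -> R), [/\ local_rep p h b,
    forall i, (i < n)%N -> smooth (g i) &
    forall q, 0 < b (h q) -> forall i, (i < n)%N -> F i q = g i (h q)].
Proof.
elim: n => [_|n IH Fn].
  exists 0%N, (fun=> 0), (fun=> 1), (fun=> fun=> 0); split=> //.
  by split=> [[]//||//]; exact: smooth_cst.
have [i i_n|k [h [b [g [[Gh sb b0] sg Fg]]]]] := IH _.
  by apply: Fn; rewrite ltnS ltnW.
have [k' [h' [b' [g' [[Gh' sb' b'0] sg' Fg']]]]] := Fn n (ltnSn n).
exists (k + k')%N, (fun q => row_mx (h q) (h' q)),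
  (fun z => flat (b (lsubmx z)) * flat (b' (rsubmx z))),
  (fun i z => if (i < n)%N then g i (lsubmx z) else g' (rsubmx z)); split.
- split.
  + move=> i; case: (split_ordP i) => j ->.
      by under eq_fun do rewrite row_mxEl; exact: Gh.
    by under eq_fun do rewrite row_mxEr; exact: Gh'.
  + apply: smoothM; apply: (smooth1_comp (@smooth1_flat R)).
      exact: smooth_lsubmx.
    exact: smooth_rsubmx.
  + by rewrite row_mxKl row_mxKr mulr_gt0// flat_gt0.
- move=> i; rewrite ltnS leq_eqVlt => /orP[/eqP->|i_n]; rewrite ?ltnn ?i_n.
    exact: smooth_rsubmx.
  by apply: smooth_lsubmx; exact: sg.
- move=> q; rewrite row_mxKl row_mxKr => bq.
  have [bq1 bq2] := flatM_gt0 bq.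
  move=> i; rewrite ltnS leq_eqVlt => /orP[/eqP->|i_n].
    by rewrite ltnn; exact: Fg'.
  by rewrite i_n; exact: Fg.
Qed.

End Smooth_closure.

(** Smoothness of a map need only be tested on generators. Idempotence of the closure and the
    universal properties of products and subspaces are instances. *)
Lemma smooth_closure_pullback (R : realType) (T X : Type) (G : set (T -> R))
    (G' : set (X -> R)) (F : T -> X) :
  (forall f, G' f -> smooth_closure G (f \o F)) ->
  forall f, smooth_closure G' f -> smooth_closure G (f \o F).
Proof.
move=> GG' f /smooth_closureP cf; apply/smooth_closureP => p.
have [k [h [b [g [[Gh sb b0] sg fg]]]]] := cf (F p).
(* [local_rep_family] counts by natural numbers, so the coordinates of [h \o F] are extended by 0
   beyond [k]. *)
pose Fh i q := oapp (fun i : 'I_k => h (F q) 0 i) 0 (insub i).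
have [i ik|k' [h' [b' [g' [[Gh' sb' b'0] sg' Fg']]]]] :=
    @local_rep_family R T G p k Fh.
  rewrite /Fh; case: insubP => [j _ _|]; last by rewrite ik.
  by have /smooth_closureP/(_ p) := GG' _ (Gh j).
pose gg z : 'rV[R]_k := \row_i g' i z.
have sgg i : smooth (fun z => gg z 0 i).
  by rewrite /gg; under eq_fun do rewrite mxE; exact: sg'.
have hE q : 0 < b' (h' q) -> h (F q) = gg (h' q).
  move=> bq; apply/rowP => i; rewrite mxE -(Fg' _ bq)// /Fh.
  by rewrite (_ : insub _ = Some i)// valK.

exists k', h', (fun z => flat (b' z) * flat (b (gg z))), (g \o gg); split.
- split=> //.
    apply: smoothM; apply: (smooth1_comp (@smooth1_flat R)) => //.
    exact: (smooth_comp (h := gg) sb).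
  by rewrite mulr_gt0// flat_gt0// -hE.
- exact: smooth_comp.
- by move=> q /flatM_gt0[b1 b2] /=; rewrite -hE//; apply: fg; rewrite hE.
Qed.

Lemma smooth_closure_idem (R : realType) (T : Type) (G : set (T -> R)) :
  smooth_closure (smooth_closure G) `<=` smooth_closure G.
Proof. by move=> f; exact: (@smooth_closure_pullback _ _ _ G _ id). Qed.

Definition closed_dspace (R : realType) (M : dspace R) : Prop :=
  smooth_closure (@Cinf R M) `<=` @Cinf R M.

Lemma manifold_closed (R : realType) (M : manifold R) : closed_dspace M.
Proof. by case: (manifoldP M). Qed.

Lemma prod_space_closed (R : realType) (M N : dspace R) :
  closed_dspace (prod_space M N).
Proof. exact: smooth_closure_idem. Qed.

Lemma sub_space_closed (R : realType) (M : dspace R) (P : M -> Prop) :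
  closed_dspace (sub_space P).
Proof. exact: smooth_closure_idem. Qed.

#[local] Hint Resolve manifold_closed prod_space_closed sub_space_closed : core.

Definition pair2 (R : realType) (a b : R) : 'rV[R]_2 :=
  \row_(i < 2) if i == 0 then a else b.

Lemma pair2E (R : realType) (a b : R) :
  (pair2 a b 0 0 = a) * (pair2 a b 0 1 = b).
Proof. by rewrite !mxE. Qed.

Section Cinf_algebra.
Variables (R : realType) (M : dspace R) (cM : closed_dspace M).
Implicit Types f g b : M -> R.

Lemma Cinf_comp k (h : M -> 'rV[R]_k) (g : 'rV[R]_k -> R) :
  (forall i, Cinf (fun q => h q 0 i)) -> smooth g -> Cinf (fun q => g (h q)).
Proof.
move=> Ch sg; apply: cM => p; exists k, h, (fun=> 1), g; split=> //.
exact: smooth_cst.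
Qed.

Lemma Cinf_local f :
  (forall p, exists b f', [/\ Cinf b, 0 < b p, Cinf f' &
     forall q, 0 < b q -> f q = f' q]) -> Cinf f.
Proof.
move=> fl; apply: cM => p; have [b [f' [Cb bp Cf' ff']]] := fl p.
exists 2%N, (fun q => pair2 (b q) (f' q)), (fun x => x 0 0), (fun x => x 0 1); split.
- move=> i; rewrite (_ : (fun q => _) = if i == 0 then b else f'); first by case: ifP.
  by apply/funext => q; rewrite mxE; case: ifP.
- exact: smooth_coord.
- exact: smooth_coord.
- by rewrite pair2E.
- by move=> q; rewrite !pair2E => /ff'.
Qed.

Lemma Cinf_cst (c : R) : @Cinf R M (fun=> c).
Proof.
apply: (@Cinf_comp 0 (fun=> 0) (fun=> c)); first by case.
exact: smooth_cst.
Qed.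

Lemma Cinf_comp1 (s : R -> R) f : smooth1 s -> Cinf f -> Cinf (fun q => s (f q)).
Proof.
move=> ss Cf; have := @Cinf_comp 1 (fun q => \row_(_ < 1) f q) (fun x => s (x 0 0)) _ ss.
under eq_fun do rewrite mxE; apply=> i.
by under eq_fun do rewrite mxE.
Qed.

Lemma Cinf_comp2 (s : 'rV[R]_2 -> R) f g : smooth s -> Cinf f -> Cinf g ->
  Cinf (fun q => s (pair2 (f q) (g q))).
Proof.
move=> ss Cf Cg.
apply: (@Cinf_comp 2 (fun q => pair2 (f q) (g q))) => //= i.
rewrite (_ : (fun q => _) = if i == 0 then f else g); first by case: ifP.
by apply/funext => q; rewrite mxE; case: ifP.
Qed.

Lemma CinfD f g : Cinf f -> Cinf g -> Cinf (fun q => f q + g q).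
Proof.
move=> Cf Cg; have := @Cinf_comp2 (fun x => x 0 0 + x 0 1) f g _ Cf Cg.
rewrite (_ : (fun q => _ + _) = fun q => f q + g q).
  by apply; apply: smoothD; exact: smooth_coord.
by apply/funext => q; rewrite !pair2E.
Qed.

Lemma CinfM f g : Cinf f -> Cinf g -> Cinf (fun q => f q * g q).
Proof.
move=> Cf Cg; have := @Cinf_comp2 (fun x => x 0 0 * x 0 1) f g _ Cf Cg.
rewrite (_ : (fun q => _ * _) = fun q => f q * g q).
  by apply; apply: smoothM; exact: smooth_coord.
by apply/funext => q; rewrite !pair2E.
Qed.

Lemma CinfZ (c : R) f : Cinf f -> Cinf (fun q => c * f q).
Proof. by move=> Cf; apply: CinfM => //; exact: Cinf_cst. Qed.

Lemma CinfN f : Cinf f -> Cinf (fun q => - f q).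
Proof. by move=> Cf; under eq_fun do rewrite -mulN1r; exact: CinfZ. Qed.

Lemma CinfB f g : Cinf f -> Cinf g -> Cinf (fun q => f q - g q).
Proof. by move=> Cf Cg; apply: CinfD => //; exact: CinfN. Qed.

Lemma Cinf_sum (I : Type) (r : seq I) (P : pred I) (F : I -> M -> R) :
  (forall i, Cinf (F i)) -> Cinf (fun q => \sum_(i <- r | P i) F i q).
Proof.
move=> CF; elim: r => [|i r IH].
  by under eq_fun do rewrite big_nil; exact: Cinf_cst.
under eq_fun do rewrite big_cons; case: (P i) => //; exact: CinfD.
Qed.

Lemma Cinf_prod (I : Type) (r : seq I) (P : pred I) (F : I -> M -> R) :
  (forall i, Cinf (F i)) -> Cinf (fun q => \prod_(i <- r | P i) F i q).
Proof.
move=> CF; elim: r => [|i r IH].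
  by under eq_fun do rewrite big_nil; exact: Cinf_cst.
under eq_fun do rewrite big_cons; case: (P i) => //; exact: CinfM.
Qed.

Lemma Cinf_inv f : Cinf f -> forall p, 0 < f p -> exists b g, [/\ Cinf b, 0 < b p,
  Cinf g & forall q, 0 < b q -> 0 < f q /\ g q = (f q)^-1].
Proof.
move=> Cf p f0; have f20 : 0 < f p / 2 by rewrite divr_gt0.
have [s [ss sE]] := smooth_inv f20.
exists (fun q => f q - f p / 2), (fun q => s (f q)); split.
- by apply: CinfB => //; exact: Cinf_cst.
- by rewrite subr_gt0 ltr_pdivrMr// ltr_pMr// ltr1n.
- exact: Cinf_comp1.
- by move=> q; rewrite subr_gt0 => h; split; [exact: lt_trans h|rewrite sE// ltW].
Qed.

(* The product of the flat functions is positive exactly where all [b i] are. *)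
Lemma common_nbhd (I : finType) (b : I -> M -> R) p :
  (forall i, Cinf (b i)) -> (forall i, 0 < b i p) ->
  exists c, [/\ Cinf c, 0 < c p & forall q, 0 < c q -> forall i, 0 < b i q].
Proof.
move=> Cb b0; exists (fun q => \prod_i flat (b i q)); split.
- by apply: Cinf_prod => i; apply: Cinf_comp1 => //; exact: smooth1_flat.
- by apply: prodr_gt0 => i _; rewrite flat_gt0.
- move=> q cq i; rewrite -flat_gt0 lt_def flat_ge0 andbT.
  by apply: contraTneq cq => fi; rewrite (bigD1 i)//= fi mul0r ltxx.
Qed.

Lemma common_nbhd2 b b' p : Cinf b -> Cinf b' -> 0 < b p -> 0 < b' p ->
  exists c, [/\ Cinf c, 0 < c p & forall q, 0 < c q -> 0 < b q /\ 0 < b' q].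
Proof.
move=> Cb Cb' bp b'p.
have [||c [Cc cp cP]] := @common_nbhd bool (fun i => if i then b else b') p.
- by case.
- by case.
- by exists c; split=> // q /cP h; split; [exact: (h true)|exact: (h false)].
Qed.

End Cinf_algebra.

Section Smooth_maps.
Variable R : realType.
Implicit Types M N P : dspace R.

Lemma smooth_map_id M : @smooth_map R M M id.
Proof. by []. Qed.

Lemma smooth_map_comp M N P (F : M -> N) (G : N -> P) :
  smooth_map F -> smooth_map G -> @smooth_map R M P (fun p => G (F p)).
Proof. by move=> sF sG f /sG/sF. Qed.

Lemma smooth_map_cst M N (q : N) : closed_dspace M -> @smooth_map R M N (fun=> q).
Proof. by move=> cM f _; exact: Cinf_cst. Qed.

Lemma smooth_map_fst M N : @smooth_map R (prod_space M N) M fst.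
Proof. by move=> f Cf; apply: sub_smooth_closure; left; exists f. Qed.

Lemma smooth_map_snd M N : @smooth_map R (prod_space M N) N snd.
Proof. by move=> f Cf; apply: sub_smooth_closure; right; exists f. Qed.

Lemma smooth_map_pair M N P (F : P -> M) (G : P -> N) : closed_dspace P ->
  smooth_map F -> smooth_map G -> @smooth_map R P (prod_space M N) (fun p => (F p, G p)).
Proof.
move=> cP sF sG f /(smooth_closure_pullback (G := @Cinf R P)) h; apply: cP.
apply: h => _ [[g Cg <-]|[g Cg <-]]; apply: sub_smooth_closure.
  exact: sF.
exact: sG.
Qed.

Lemma smooth_map_sval M (Q : M -> Prop) : @smooth_map R (sub_space Q) M sval.
Proof. by move=> f Cf; apply: sub_smooth_closure; exists f. Qed.

Lemma smooth_map_sub M P (Q : M -> Prop) (F : P -> M) (QF : forall p, Q (F p)) :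
  closed_dspace P -> smooth_map F ->
  @smooth_map R P (sub_space Q) (fun p => exist _ (F p) (QF p)).
Proof.
move=> cP sF f /(smooth_closure_pullback (G := @Cinf R P)) h; apply: cP.
by apply: h => _ [g Cg <-]; apply: sub_smooth_closure; exact: sF.
Qed.

End Smooth_maps.

(** * Tangent vectors *)

Section Tangent.
Variables (R : realType) (M : dspace R).
Implicit Types (p : M) (u v w : vect M) (f g : M -> R).

Lemma vect_eq p v w : tangent p v -> tangent p w ->
  (forall f, Cinf f -> v f = w f) -> v = w.
Proof.
move=> [_ _ v0] [_ _ w0] vw; apply/funext => f.
by have [/vw//|nf] := pselect (Cinf f); rewrite v0// w0.
Qed.

Lemma vect_addE v w f : (v + w) f = v f + w f.
Proof. by []. Qed.

Lemma vect_scaleE a v f : (a *: v) f = a * v f.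
Proof. by []. Qed.

Lemma vect_oppE v f : (- v) f = - v f.
Proof. by []. Qed.

Lemma tangent0 p : tangent p (0 : vect M).
Proof.
have E f : (0 : vect M) f = 0 by [].
by split=> [a f g _ _|f g _ _|//]; rewrite !E; ring.
Qed.

Lemma tangentD p v w : tangent p v -> tangent p w -> tangent p (v + w).
Proof.
move=> [v1 v2 v3] [w1 w2 w3]; split=> [a f g Cf Cg|f g Cf Cg|f nf]; rewrite !fctE.
- by rewrite v1// w1//; ring.
- by rewrite v2// w2//; ring.
- by rewrite v3// w3// addr0.
Qed.

Lemma tangentZ p a v : tangent p v -> tangent p (a *: v).
Proof.
move=> [v1 v2 v3]; split=> [b f g Cf Cg|f g Cf Cg|f nf]; rewrite !fctE /GRing.scale /=.
- by rewrite v1//; ring.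
- by rewrite v2//; ring.
- by rewrite v3// mulr0.
Qed.

Lemma tangentN p v : tangent p v -> tangent p (- v).
Proof. by rewrite -scaleN1r; exact: tangentZ. Qed.

Lemma tangentB p v w : tangent p v -> tangent p w -> tangent p (v - w).
Proof. by move=> tv tw; apply: tangentD => //; exact: tangentN. Qed.

Lemma tangent_sum p (I : Type) (r : seq I) (P : pred I) (F : I -> vect M) :
  (forall i, tangent p (F i)) -> tangent p (\sum_(i <- r | P i) F i).
Proof.
by move=> tF; elim/big_ind: _ => //; [exact: tangent0|exact: tangentD].
Qed.

Lemma vect_sumE (I : Type) (r : seq I) (P : pred I) (F : I -> vect M) f :
  (\sum_(i <- r | P i) F i) f = \sum_(i <- r | P i) F i f.
Proof. by rewrite fct_sumE. Qed.

Hypothesis cM : closed_dspace M.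
Variables (p : M) (v : vect M) (tv : tangent p v).

Lemma tangent_fD f g : Cinf f -> Cinf g -> v (fun q => f q + g q) = v f + v g.
Proof.
move=> Cf Cg; have [vD _ _] := tv.
by have := vD 1 f g Cf Cg; under eq_fun do rewrite mul1r; rewrite mul1r.
Qed.

Lemma tangent_fM f g : Cinf f -> Cinf g ->
  v (fun q => f q * g q) = f p * v g + g p * v f.
Proof. by move=> Cf Cg; have [_ vM _] := tv; exact: vM. Qed.

Lemma tangent_f1 : v (fun=> 1) = 0.
Proof.
have C1 := Cinf_cst cM 1; have := tangent_fM C1 C1.
under eq_fun do rewrite mulr1; rewrite !mul1r => h; apply/eqP.
by rewrite -(addrI (v (fun=> 1)) (_ : v (fun=> 1) + 0 = v (fun=> 1) + v (fun=> 1)))// addr0.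
Qed.

Lemma tangent_fcst c : v (fun=> c) = 0.
Proof.
have [vD _ _] := tv; have C1 := Cinf_cst cM 1; have C0 := Cinf_cst cM 0.
have v0 : v (fun=> 0) = 0.
  have := tangent_fD C0 C0; under eq_fun do rewrite addr0.
  by move/eqP; rewrite -subr_eq0 opprD addrA subrr add0r oppr_eq0 => /eqP.
have := vD c _ _ C1 C0; under eq_fun do rewrite mulr1 addr0.
by rewrite tangent_f1 mulr0 v0 addr0.
Qed.

Lemma tangent_fZ c f : Cinf f -> v (fun q => c * f q) = c * v f.
Proof.
move=> Cf; rewrite tangent_fM//; last exact: Cinf_cst.
by rewrite tangent_fcst mulr0 addr0.
Qed.

Lemma tangent_fN f : Cinf f -> v (fun q => - f q) = - v f.
Proof. by move=> Cf; under eq_fun do rewrite -mulN1r; rewrite tangent_fZ// mulN1r. Qed.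

Lemma tangent_fB f g : Cinf f -> Cinf g -> v (fun q => f q - g q) = v f - v g.
Proof. by move=> Cf Cg; rewrite tangent_fD ?tangent_fN//; exact: CinfN. Qed.

Lemma tangent_fsum (I : Type) (r : seq I) (P : pred I) (F : I -> M -> R) :
  (forall i, Cinf (F i)) ->
  v (fun q => \sum_(i <- r | P i) F i q) = \sum_(i <- r | P i) v (F i).
Proof.
move=> CF; elim: r => [|i r IH].
  by under eq_fun do rewrite big_nil; rewrite big_nil tangent_fcst.
under eq_fun do rewrite big_cons; rewrite big_cons; case: (P i) => //.
by rewrite tangent_fD ?IH//; exact: Cinf_sum.
Qed.

(** The product of f - g with flat(b) is identically zero while flat(b) is positive at [p], so
    Leibniz's rule kills v(f - g). *)
Lemma tangent_local f g b : Cinf f -> Cinf g -> Cinf b -> 0 < b p ->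
  (forall q, 0 < b q -> f q = g q) -> v f = v g.
Proof.
move=> Cf Cg Cb bp fg; apply/eqP; rewrite -subr_eq0 -tangent_fB//; apply/eqP.
have Cfb : Cinf (fun q => flat (b q)) by apply: Cinf_comp1 => //; exact: smooth1_flat.
have CfB := CinfB cM Cf Cg.
have := tangent_fM CfB Cfb.
have -> : (fun q => (f q - g q) * flat (b q)) = fun=> 0.
  apply/funext => q; have [bq|bq] := ltrP 0 (b q); last by rewrite flat_eq0 ?mulr0.
  by rewrite fg// subrr mul0r.
rewrite tangent_fcst fg// subrr mul0r add0r => /esym/eqP.
by rewrite mulf_eq0 gt_eqF ?flat_gt0//= => /eqP.
Qed.

(** A derivation sees only sums and products. Hadamard's lemma writes g(h) - g(h p) as a sum of
    products whose first factors h_i - h_i(p) vanish at [p], so only the coefficients at [h p]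
    remain. *)
Lemma tangent_chain k (h : M -> 'rV[R]_k) (g : 'rV[R]_k -> R) :
  (forall i, Cinf (fun q => h q 0 i)) -> smooth g ->
  v (fun q => g (h q)) = \sum_i ddir g (delta_mx 0 i) (h p) * v (fun q => h q 0 i).
Proof.
move=> Ch sg; have [e [se ge ea]] := Hadamard_lemma (h p) sg.
have Ce i : Cinf (fun q => e i (h q)) by exact: Cinf_comp.
have Cd i : Cinf (fun q => h q 0 i - h p 0 i).
  by apply: CinfB => //; exact: Cinf_cst.
rewrite (_ : (fun q => g (h q)) =
  fun q => g (h p) + \sum_i (h q 0 i - h p 0 i) * e i (h q)); last first.
  by apply/funext => q; rewrite [LHS]ge.
rewrite tangent_fD ?tangent_fcst ?add0r; first last.
- by apply: Cinf_sum => // i; exact: CinfM.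
- exact: Cinf_cst.
rewrite tangent_fsum; last by move=> i; exact: CinfM.
apply: eq_bigr => i _; rewrite tangent_fM// subrr mul0r add0r ea; congr (_ * _).
rewrite tangent_fB//; last exact: Cinf_cst.
by rewrite tangent_fcst subr0.
Qed.

End Tangent.

Section Tangent_map.
Variable R : realType.
Implicit Types M N P : dspace R.

Lemma tmapE M N (F : M -> N) v f : Cinf f -> tmap F v f = v (f \o F).
Proof. by move=> Cf; rewrite /tmap /patch mem_set. Qed.

Lemma tmap_out M N (F : M -> N) v f : ~ Cinf f -> tmap F v f = 0.
Proof. by move=> Cf; rewrite /tmap /patch memNset. Qed.

Lemma tangent_tmap M N (F : M -> N) p v : closed_dspace N -> smooth_map F ->
  tangent p v -> tangent (F p) (tmap F v).
Proof.
move=> cN sF [v1 v2 v3]; split=> [a f g Cf Cg|f g Cf Cg|]; last exact: tmap_out.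
- rewrite !tmapE//; last by apply: CinfD => //; exact: CinfZ.
  by apply: v1; exact: sF.
- rewrite !tmapE//; last exact: CinfM.
  by apply: v2; exact: sF.
Qed.

Lemma tmap_comp M N P (F : M -> N) (G : N -> P) v : smooth_map G ->
  tmap (fun p => G (F p)) v = tmap G (tmap F v).
Proof.
move=> sG; apply/funext => f; have [Cf|nf] := pselect (Cinf f).
  by rewrite !tmapE//; exact: sG.
by rewrite !tmap_out.
Qed.

Lemma tmap_id M p v : tangent p v -> tmap (M := M) id v = v.
Proof.
move=> [_ _ v0]; apply/funext => f; have [Cf|nf] := pselect (Cinf f).
  by rewrite tmapE.
by rewrite tmap_out// v0.
Qed.

Lemma tmapD M N (F : M -> N) v w : tmap F (v + w) = tmap F v + tmap F w.
Proof.
apply/funext => f; rewrite vect_addE; have [Cf|nf] := pselect (Cinf f).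
  by rewrite !tmapE.
by rewrite !tmap_out// addr0.
Qed.

Lemma tmapZ M N (F : M -> N) a v : tmap F (a *: v) = a *: tmap F v.
Proof.
apply/funext => f; rewrite vect_scaleE; have [Cf|nf] := pselect (Cinf f).
  by rewrite !tmapE.
by rewrite !tmap_out// mulr0.
Qed.

Lemma tmap0 M N (F : M -> N) : tmap F 0 = 0.
Proof. by rewrite -(scale0r (0 : vect M)) tmapZ scale0r. Qed.

Lemma tmapN M N (F : M -> N) v : tmap F (- v) = - tmap F v.
Proof. by rewrite -scaleN1r tmapZ scaleN1r. Qed.

Lemma tmapB M N (F : M -> N) v w : tmap F (v - w) = tmap F v - tmap F w.
Proof. by rewrite tmapD tmapN. Qed.

Lemma tmap_sum M N (F : M -> N) (I : Type) (r : seq I) (P : pred I) (v : I -> vect M) :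
  tmap F (\sum_(i <- r | P i) v i) = \sum_(i <- r | P i) tmap F (v i).
Proof. by apply: (big_morph (tmap F)) => [? ?|]; [exact: tmapD|exact: tmap0]. Qed.

Lemma tmap_cst M N (q : N) p v : closed_dspace M -> tangent p v ->
  tmap (M := M) (fun=> q) v = 0.
Proof.
move=> cM tv; apply/funext => f; have [Cf|nf] := pselect (Cinf f).
  by rewrite tmapE// (tangent_fcst cM tv).
by rewrite tmap_out.
Qed.

Lemma smooth_map_pairl M N (q : N) : closed_dspace M ->
  @smooth_map R M (prod_space M N) (fun p => (p, q)).
Proof.
move=> cM; apply: (@smooth_map_pair R M N M id (fun=> q)) => //.
exact: smooth_map_cst.
Qed.

Lemma smooth_map_pairr M N (p : M) : closed_dspace N ->
  @smooth_map R N (prod_space M N) (fun q => (p, q)).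
Proof.
move=> cN; apply: (@smooth_map_pair R M N N (fun=> p) id) => //.
exact: smooth_map_cst.
Qed.

(** Each generator of the product structure depends on one factor, so for it one of the two terms is
    the derivative of a constant. The chain rule extends this to functions of generators. *)
Lemma prod_tangentE M N (p : M) (q : N) (v : vect (prod_space M N)) F :
  closed_dspace M -> closed_dspace N ->
  @tangent R (prod_space M N) (p, q) v -> @Cinf R (prod_space M N) F ->
  v F = v (fun z => F (z.1, q)) + v (fun z => F (p, z.2)).
Proof.
move=> cM cN tv CF; have cP := @prod_space_closed R M N.
have /smooth_closureP/(_ (p, q)) [k [h [b [g [[Gh sb b0] sg Fg]]]]] := CF.
have Ch i : @Cinf R (prod_space M N) (fun z => h z 0 i) by exact: sub_smooth_closure.
have C1 f : @Cinf R (prod_space M N) f -> @Cinf R (prod_space M N) (fun z => f (z.1, q)).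
  move=> Cf; apply: (@smooth_map_fst R M N (fun m => f (m, q))).
  exact: (@smooth_map_pairl M N q cM).
have C2 f : @Cinf R (prod_space M N) f -> @Cinf R (prod_space M N) (fun z => f (p, z.2)).
  move=> Cf; apply: (@smooth_map_snd R M N (fun n => f (p, n))).
  exact: (@smooth_map_pairr M N p cN).
have Cb : @Cinf R (prod_space M N) (fun z => b (h z)) by exact: Cinf_comp.
rewrite (tangent_local cP tv CF (Cinf_comp cP Ch sg) Cb)//.
rewrite (tangent_local cP tv (C1 _ CF) (C1 _ (Cinf_comp cP Ch sg)) (C1 _ Cb))//; last first.
  by move=> z; exact: Fg.
rewrite (tangent_local cP tv (C2 _ CF) (C2 _ (Cinf_comp cP Ch sg)) (C2 _ Cb))//; last first.
  by move=> z; exact: Fg.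
rewrite (tangent_chain cP tv Ch sg).
rewrite (tangent_chain cP tv (h := fun z => h (z.1, q)) (fun i => C1 _ (Ch i)) sg).
rewrite (tangent_chain cP tv (h := fun z => h (p, z.2)) (fun i => C2 _ (Ch i)) sg).
rewrite -big_split; apply: eq_bigr => i _ /=; rewrite -mulrDr; congr (_ * _).
case: (Gh i) => -[f Cf fE].
  have -> : (fun z : M * N => h (p, z.2) 0 i) = fun=> f p.
    by apply/funext => z; have := congr1 (fun f => f (p, z.2)) fE.
  rewrite (tangent_fcst cP tv) addr0; congr (v _); apply/funext => z.
  by rewrite -(congr1 (fun f => f z) fE) -(congr1 (fun f => f (z.1, q)) fE).
have -> : (fun z : M * N => h (z.1, q) 0 i) = fun=> f q.
  by apply/funext => z; have := congr1 (fun f => f (z.1, q)) fE.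
rewrite (tangent_fcst cP tv) add0r; congr (v _); apply/funext => z.
by rewrite -(congr1 (fun f => f z) fE) -(congr1 (fun f => f (p, z.2)) fE).
Qed.

Lemma prod_tangent_split M N (p : M) (q : N) (v : vect (prod_space M N)) :
  closed_dspace M -> closed_dspace N ->
  @tangent R (prod_space M N) (p, q) v ->
  v = tmap (N := prod_space M N) (fun m : M => (m, q)) (tmap (M := prod_space M N) fst v)
    + tmap (N := prod_space M N) (fun n : N => (p, n)) (tmap (M := prod_space M N) snd v).
Proof.
move=> cM cN tv; apply/funext => F; rewrite fctE.
have [CF|nF] := pselect (@Cinf R (prod_space M N) F); last first.
  by rewrite !tmap_out// addr0; case: tv => _ _; exact.
rewrite (prod_tangentE cM cN tv CF) !tmapE//.
- exact: (@smooth_map_pairr M N p cN).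
- exact: (@smooth_map_pairl M N q cM).
Qed.

End Tangent_map.

(** * Vector fields along maps and local frames *)

Section Along.
Variable R : realType.
Implicit Types T M N P Q : dspace R.

(** Sections of the pullback of the tangent bundle by [F]. For the identity they are vector fields,
    for the unit map they contain the sections of the Lie algebroid, and for a constant map to the
    unit of [K] they are functions with values in its Lie algebra. *)
Definition vfield_along T M (F : T -> M) (X : T -> vect M) : Prop :=
  (forall t, tangent (F t) (X t)) /\
  (forall f, Cinf f -> Cinf (fun t => X t f)).

Lemma vfield_alongD T M (F : T -> M) X Y : closed_dspace T ->
  vfield_along F X -> vfield_along F Y -> vfield_along F (fun t => X t + Y t).
Proof.
move=> cT [X1 X2] [Y1 Y2]; split=> [t|f Cf]; first exact: tangentD.
by apply: CinfD => //; [exact: X2|exact: Y2].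
Qed.

Lemma vfield_alongM T M (F : T -> M) (c : T -> R) X : closed_dspace T -> Cinf c ->
  vfield_along F X -> vfield_along F (fun t => c t *: X t).
Proof.
move=> cT Cc [X1 X2]; split=> [t|f Cf]; first exact: tangentZ.
by apply: CinfM => //; exact: X2.
Qed.

Lemma vfield_along0 T M (F : T -> M) : closed_dspace T -> vfield_along F (fun=> 0).
Proof. by move=> cT; split=> [t|f Cf]; [exact: tangent0|exact: Cinf_cst]. Qed.

Lemma vfield_along_sum T M (F : T -> M) (I : Type) (r : seq I) (X : I -> T -> vect M) :
  closed_dspace T -> (forall i, vfield_along F (X i)) ->
  vfield_along F (fun t => \sum_(i <- r) X i t).
Proof.
move=> cT vX; elim: r => [|i r IH].
  by under eq_fun do rewrite big_nil; exact: vfield_along0.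
by under eq_fun do rewrite big_cons; exact: vfield_alongD.
Qed.

Lemma vfield_alongB T M (F : T -> M) X Y : closed_dspace T ->
  vfield_along F X -> vfield_along F Y -> vfield_along F (fun t => X t - Y t).
Proof.
move=> cT vX vY; under eq_fun do rewrite -scaleN1r.
by apply: vfield_alongD => //; apply: vfield_alongM => //; exact: Cinf_cst.
Qed.

Lemma vfield_along_tmap T M N (F : T -> M) (G : M -> N) X :
  closed_dspace N -> smooth_map G ->
  vfield_along F X -> vfield_along (fun t => G (F t)) (fun t => tmap G (X t)).
Proof.
move=> cN sG [X1 X2]; split=> [t|f Cf]; first exact: tangent_tmap.
by under eq_fun do rewrite tmapE//; exact/X2/sG.
Qed.

Lemma vfield_along_comp T T' M (F : T -> M) (G : T' -> T) X : smooth_map G ->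
  vfield_along F X -> vfield_along (fun t => F (G t)) (fun t => X (G t)).
Proof. by move=> sG [X1 X2]; split=> [t|f Cf]; [exact: X1|exact: (sG _ (X2 f Cf))]. Qed.

(** Locally [F] is a smooth function of generators, and the chain rule for [W t] gives coefficients
    smooth at (pi t, ka t) times [W t] of the generators; these are smooth, as a generator depends
    either on [p] only or on [ka t] only. *)
Lemma Cinf_partial T P Q (pi : T -> P) (ka : T -> Q) (W : T -> vect P) (F : P * Q -> R) :
  closed_dspace T -> closed_dspace P -> closed_dspace Q ->
  smooth_map pi -> smooth_map ka -> vfield_along pi W -> @Cinf R (prod_space P Q) F ->
  Cinf (fun t => W t (fun p => F (p, ka t))).
Proof.
move=> cT cP cQ spi ska [W1 W2] CF; apply: Cinf_local => // t0.
have /smooth_closureP/(_ (pi t0, ka t0)) [k [h [b [g [[Gh sb b0] sg Fg]]]]] := CF.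
have sp : @smooth_map R T (prod_space P Q) (fun t => (pi t, ka t)) by exact: smooth_map_pair.
have Ch i : @Cinf R (prod_space P Q) (fun z => h z 0 i) by exact: sub_smooth_closure.
have Cb : @Cinf R (prod_space P Q) (fun z => b (h z)) by exact: Cinf_comp.
have sl q := @smooth_map_pairl R P Q q cP.
exists (fun t => b (h (pi t, ka t))), (fun t => \sum_i
  ddir g (delta_mx 0 i) (h (pi t, ka t)) * W t (fun p => h (p, ka t) 0 i)); split=> //.
- exact: (sp (fun z => b (h z))).
- apply: Cinf_sum => // i; apply: CinfM => //.
    apply: (sp (fun z => ddir g (delta_mx 0 i) (h z))).
    by apply: Cinf_comp => //; exact: smooth_ddir.
  case: (Gh i) => -[f Cf fE].
    have -> : (fun t => W t (fun p => h (p, ka t) 0 i)) = fun t => W t f.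
      apply/funext => t; congr (W t _); apply/funext => p.
      by rewrite -(congr1 (fun f => f (p, ka t)) fE).
    exact: W2.
  have -> : (fun t => W t (fun p => h (p, ka t) 0 i)) = fun=> 0.
    apply/funext => t; rewrite (_ : (fun p => _) = fun=> f (ka t)).
      exact: (tangent_fcst cP (W1 t)).
    by apply/funext => p; rewrite -(congr1 (fun f => f (p, ka t)) fE).
  exact: Cinf_cst.
- move=> t bt.
  have := tangent_chain cP (W1 t) (h := fun p => h (p, ka t)) (fun i => sl (ka t) _ (Ch i)) sg.
  move=> <-; apply: (tangent_local cP (W1 t) (sl (ka t) _ CF) _ (sl (ka t) _ Cb)) => //.
    exact: (sl (ka t) _ (Cinf_comp (@prod_space_closed R P Q) Ch sg)).
  by move=> p; exact: Fg.
Qed.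

Lemma vfield_along_pairl T P Q (pi : T -> P) (ka : T -> Q) (W : T -> vect P) :
  closed_dspace T -> closed_dspace P -> closed_dspace Q ->
  smooth_map pi -> smooth_map ka -> vfield_along pi W ->
  @vfield_along T (prod_space P Q) (fun t => (pi t, ka t))
    (fun t => tmap (N := prod_space P Q) (fun p => (p, ka t)) (W t)).
Proof.
move=> cT cP cQ spi ska vW; split=> [t|f Cf].
  apply: (@tangent_tmap R P (prod_space P Q) (fun p => (p, ka t)) (pi t)) => //.
    exact: smooth_map_pairl.
  by case: vW.
by under eq_fun do rewrite tmapE//; apply: (@Cinf_partial T P Q pi ka W f).
Qed.

Lemma vfield_along_pairr T P Q (pi : T -> P) (ka : T -> Q) (W : T -> vect Q) :
  closed_dspace T -> closed_dspace P -> closed_dspace Q ->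
  smooth_map pi -> smooth_map ka -> vfield_along ka W ->
  @vfield_along T (prod_space P Q) (fun t => (pi t, ka t))
    (fun t => tmap (N := prod_space P Q) (fun q => (pi t, q)) (W t)).
Proof.
move=> cT cP cQ spi ska vW; split=> [t|f Cf].
  apply: (@tangent_tmap R Q (prod_space P Q) (fun q => (pi t, q)) (ka t)) => //.
    exact: smooth_map_pairr.
  by case: vW.
under eq_fun do rewrite tmapE//.
apply: (@Cinf_partial T Q P ka pi W (fun z => f (z.2, z.1))) => //.
have : @smooth_map R (prod_space Q P) (prod_space P Q) (fun z => (z.2, z.1)).
  apply: smooth_map_pair => //; [exact: smooth_map_snd|exact: smooth_map_fst].
exact.
Qed.

(** Product rule for the two occurrences of [t], by splitting the pushforward of [u] to the
    product. *)
Lemma tangent_diag T P Q (pi : T -> P) (ka : T -> Q) (F : P * Q -> R) t0 (u : vect T) :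
  closed_dspace T -> closed_dspace P -> closed_dspace Q ->
  smooth_map pi -> smooth_map ka -> @Cinf R (prod_space P Q) F -> tangent t0 u ->
  u (fun t => F (pi t, ka t)) = u (fun t => F (pi t, ka t0)) + u (fun t => F (pi t0, ka t)).
Proof.
move=> cT cP cQ spi ska CF tu.
have sp : @smooth_map R T (prod_space P Q) (fun t => (pi t, ka t)) by exact: smooth_map_pair.
have tv := @tangent_tmap R T (prod_space P Q) _ t0 u (@prod_space_closed R P Q) sp tu.
have := prod_tangentE cP cQ tv CF; rewrite !tmapE//.
- apply: (@smooth_map_snd R P Q (fun q => F (pi t0, q))).
  exact: (@smooth_map_pairr R P Q (pi t0) cQ).
- apply: (@smooth_map_fst R P Q (fun p => F (p, ka t0))).
  exact: (@smooth_map_pairl R P Q (ka t0) cP).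
Qed.

End Along.

Section Frame.
Variable R : realType.
Implicit Types T M N P Q : dspace R.

(** The functions and fields are global but are dual to each other only where [b] is positive. An
    arbitrary finite index type lets a product use the disjoint sum of two index types. *)
Definition frame M (p : M) (I : finType) (b : M -> R) (x : I -> M -> R)
    (E : I -> M -> vect M) : Prop :=
  [/\ Cinf b, 0 < b p, forall i, Cinf (x i), forall i, vfield (E i) &
    forall q, 0 < b q -> (forall i j, E j q (x i) = (i == j)%:R) /\
      forall v, tangent q v -> v = \sum_i v (x i) *: E i q].

Definition framed M : Prop := forall p : M, exists I b x E, @frame M p I b x E.

Lemma ddir_near_eq k (g g' : 'rV[R]_k -> R) v y : smooth g -> smooth g' ->
  (\forall z \near y, g z = g' z) -> ddir g v y = ddir g' v y.
Proof.
move=> sg sg' gg'.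
have dg : differentiable g y by exact: smooth_differentiable.
have dg' : differentiable g' y by exact: smooth_differentiable.
have := @near_eq_derive R 'rV[R]_k R^o g g' y v gg'.
by rewrite (deriveE v dg) (deriveE v dg').
Qed.

Lemma manifold_frame (M : manifold R) (p : M) :
  exists b (x : M -> 'rV[R]_(mdim M)) E, @frame M p 'I_(mdim M) b (fun i q => x q 0 i) E /\
    forall q q', 0 < b q -> 0 < b q' -> x q = x q' -> q = q'.
Proof.
have cM : closed_dspace M by [].
case: (manifoldP M) => _ _ sep _ /(_ p)[u [x [Cu up Cx ox rep]]].
(* Fixes a coordinate representative for each smooth function. Its derivatives on the chart do not
   depend on the choice, by [uniq], because the chart has open image. *)
have [g gP] : exists g : (M -> R) -> 'rV[R]_(mdim M) -> R, forall f, Cinf f ->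
    smooth (g f) /\ forall q, 0 < u q -> f q = g f (x q).
  have /choice[g gP] f : exists g, Cinf f -> smooth g /\ forall q, 0 < u q -> f q = g (x q).
    have [Cf|nf] := pselect (Cinf f); last by exists (fun=> 0).
    by have [g gP] := rep f Cf; exists g.
  by exists g.
have uniq g1 g2 q v : 0 < u q -> smooth g1 -> smooth g2 ->
    (forall q, 0 < u q -> g1 (x q) = g2 (x q)) -> ddir g1 v (x q) = ddir g2 v (x q).
  move=> uq s1 s2 g12; apply: ddir_near_eq => //.
  have : nbhs (x q) (x @` [set q | 0 < u q]).
    by apply: open_nbhs_nbhs; split => //; exists q.
  by apply: filterS => _ [z uz <-]; exact: g12.
(* The cut-off s(u) is 0 for u <= u(p)/4 and 1 for u >= u(p)/2. The coordinate fields times s(u)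
   extend by zero and are unchanged where u > u(p)/2. *)
have c0 : 0 < u p / 4 by rewrite divr_gt0.
have [s [ss s0 s1]] := smooth_step c0.
have s0' q : 0 < u q \/ s (u q) = 0.
  by have [uq|uq] := ltrP 0 (u q); [left|right; apply: s0; rewrite (le_trans uq)// ltW].
pose E i q : vect M := patch (fun=> 0) (@Cinf R M)
  (fun f => s (u q) * ddir (g f) (delta_mx 0 i) (x q)).
have EE i q f : Cinf f -> E i q f = s (u q) * ddir (g f) (delta_mx 0 i) (x q).
  by move=> Cf; rewrite /E /patch mem_set.
have alg1 (a c d e : R) : 0 * c = a * (0 * d) + 0 * e by ring.
have alg2 (a a' c d e : R) : 0 * c = a * (0 * d) + a' * (0 * e) by ring.
have alg3 (a c d t : R) : t * (a * c + 0 + d) = a * (t * c) + t * d by ring.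
have alg4 (a b c d t : R) : t * (a * c + b * d) = a * (t * c) + b * (t * d) by ring.
have tE i q : tangent q (E i q).
  split=> [a f1 f2 C1 C2|f1 f2 C1 C2|f nf]; last by rewrite /E /patch memNset.
  - have C12 : Cinf (fun q => a * f1 q + f2 q) by apply: CinfD => //; exact: CinfZ.
    rewrite (EE _ _ _ C1) (EE _ _ _ C2) (EE _ _ _ C12).
    have [uq|->] := s0' q; last exact: alg1.
    have [[g1 g1E] [g2 g2E] [g3 g3E]] := And3 (gP _ C1) (gP _ C2) (gP _ C12).
    have sa : smooth (fun y => a * g f1 y) by apply: smoothM => //; exact: smooth_cst.
    rewrite (@uniq _ (fun y => a * g f1 y + g f2 y) _ _ uq)//.
    + have -> : ddir (fun y => a * g f1 y + g f2 y) (delta_mx 0 i) (x q) =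
        a * ddir (g f1) (delta_mx 0 i) (x q) + 0 + ddir (g f2) (delta_mx 0 i) (x q).
        have d1 := smooth_differentiable (x q) g1; have d2 := smooth_differentiable (x q) g2.
        have d0 := smooth_differentiable (x q) (smooth_cst _ a).
        rewrite (ddirD _ (smooth_differentiable (x q) sa) d2) (ddirM _ d0 d1).
        by rewrite ddir_cst mulr0.
      exact: alg3.
    + exact: smoothD.
    + by move=> q' uq'; rewrite -g3E// -g1E// -g2E.
  - have C12 : Cinf (fun q => f1 q * f2 q) by exact: CinfM.
    rewrite (EE _ _ _ C1) (EE _ _ _ C2) (EE _ _ _ C12).
    have [uq|->] := s0' q; last exact: alg2.
    have [[g1 g1E] [g2 g2E] [g3 g3E]] := And3 (gP _ C1) (gP _ C2) (gP _ C12).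
    rewrite (@uniq _ (fun y => g f1 y * g f2 y) _ _ uq)//.
    + have d1 := smooth_differentiable (x q) g1; have d2 := smooth_differentiable (x q) g2.
      by rewrite (ddirM _ d1 d2) -g1E// -g2E//; exact: alg4.
    + exact: smoothM.
    + by move=> q' uq'; rewrite -g3E// -g1E// -g2E.
exists (fun q => u q - 2 * (u p / 4)), x, E; split; last first.
  have u0 q : 0 < u q - 2 * (u p / 4) -> 0 < u q.
    by rewrite subr_gt0; apply: lt_trans; rewrite mulr_gt0.
  move=> q q' /u0 uq /u0 uq' xqq'; apply: sep => f Cf.
  by have [_ fE] := gP f Cf; rewrite !fE// xqq'.
split=> //.
- by apply: CinfB => //; exact: Cinf_cst.
- rewrite subr_gt0; have -> : 2 * (u p / 4) = u p / 2 by field.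
  by rewrite ltr_pdivrMr// ltr_pMr// ltr1n.
- move=> i; split=> // f Cf; under eq_fun do rewrite EE//.
  apply: CinfM => //; first exact: Cinf_comp1.
  by apply: Cinf_comp => //; apply: smooth_ddir; case: (gP f Cf).
- move=> q; rewrite subr_gt0 => uq.
  have uq0 : 0 < u q by apply: lt_trans uq; rewrite mulr_gt0.
  split=> [i j|v tv].
    have [gi giE] := gP _ (Cx i).
    rewrite EE// s1 ?mul1r; last exact: ltW.
    rewrite (@uniq _ (fun y => y 0 i) _ _ uq0)//; last by move=> q' /giE.
      by rewrite ddir_coord mxE eqxx.
    exact: smooth_coord.
  apply: (vect_eq tv); first by apply: tangent_sum => i; exact: tangentZ.
  move=> f Cf; rewrite vect_sumE; have [gf gfE] := gP _ Cf.
  rewrite (tangent_local cM tv Cf (Cinf_comp cM Cx gf) Cu uq0 gfE).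
  rewrite (tangent_chain cM tv Cx gf); apply: eq_bigr => i _.
  by rewrite vect_scaleE EE// s1 ?mul1r ?ltW// mulrC.
Qed.

Lemma manifold_framed (M : manifold R) : framed M.
Proof.
move=> p; have [b [x [E [fE _]]]] := manifold_frame p.
by exists 'I_(mdim M), b, (fun i q => x q 0 i), E.
Qed.

Lemma prod_framed M N : closed_dspace M -> closed_dspace N ->
  framed M -> framed N -> framed (prod_space M N).
Proof.
move=> cM cN fM fN [p q]; have cP := @prod_space_closed R M N.
have [I [b [x [E [Cb b0 Cx vE bE]]]]] := fM p.
have [J [c [y [D [Cc c0 Cy vD cD]]]]] := fN q.
have sf := @smooth_map_fst R M N; have ss := @smooth_map_snd R M N.
have [d [Cd d0 dP]] := @common_nbhd2 R (prod_space M N) cP (fun z => b z.1)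
  (fun z => c z.2) (p, q) (sf _ Cb) (ss _ Cc) b0 c0.
pose w (k : I + J) (z : prod_space M N) := match k with inl i => x i z.1 | inr j => y j z.2 end.
pose W (k : I + J) (z : prod_space M N) : vect (prod_space M N) := match k with
  | inl i => tmap (N := prod_space M N) (fun m => (m, z.2)) (E i z.1)
  | inr j => tmap (N := prod_space M N) (fun n => (z.1, n)) (D j z.2) end.
have Cw k : @Cinf R (prod_space M N) (w k).
  by case: k => [i|j]; [exact: (sf _ (Cx i))|exact: (ss _ (Cy j))].
exists (I + J)%type, d, w, W; split=> //.
- case=> [i|j].
    have := @vfield_along_pairl R (prod_space M N) M N fst snd (fun z => E i z.1) cP cM cN sf ss.
    move=> /(_ (vfield_along_comp sf (vE i)))[H1 H2]; split=> // -[m n]; exact: H1.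
  have := @vfield_along_pairr R (prod_space M N) M N fst snd (fun z => D j z.2) cP cM cN sf ss.
  move=> /(_ (vfield_along_comp ss (vD j)))[H1 H2]; split=> // -[m n]; exact: H1.
- move=> z /dP[bz cz]; have [E1 E2] := bE _ bz; have [D1 D2] := cD _ cz.
  have tE i : tangent z.1 (E i z.1) by case: (vE i).
  have tD j : tangent z.2 (D j z.2) by case: (vD j).
  split=> [[i|j] [i'|j']|v tv].
  + by rewrite /W (tmapE _ _ (Cw (inl i))); exact: E1.
  + by rewrite /W (tmapE _ _ (Cw (inl i))); apply: (etrans (tangent_fcst cN (tD j') (x i z.1))).
  + by rewrite /W (tmapE _ _ (Cw (inr j))); apply: (etrans (tangent_fcst cM (tE i') (y j z.2))).
  + by rewrite /W (tmapE _ _ (Cw (inr j))); exact: D1.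
  + rewrite [LHS](@prod_tangent_split R M N z.1 z.2 v cM cN); last by case: (z) tv.
    have t1 : tangent z.1 (tmap (M := prod_space M N) fst v).
      by apply: (@tangent_tmap R (prod_space M N) M fst z).
    have t2 : tangent z.2 (tmap (M := prod_space M N) snd v).
      by apply: (@tangent_tmap R (prod_space M N) N snd z).
    rewrite {1}(E2 _ t1) {1}(D2 _ t2) !tmap_sum big_sumType /=; congr (_ + _).
      by apply: eq_bigr => i _; rewrite tmapZ tmapE.
    by apply: eq_bigr => j _; rewrite tmapZ tmapE.
Qed.

Lemma vfield_extension M (p : M) v : closed_dspace M -> framed M -> tangent p v ->
  exists2 X, vfield X & X p = v.
Proof.
move=> cM fM tv; have [I [b [x [E [Cb b0 Cx vE bE]]]]] := fM p.
exists (fun q => \sum_i v (x i) *: E i q); last by have [_ /(_ v tv)] := bE _ b0.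
apply: (@vfield_along_sum R M M id) => // i.
exact: (@vfield_alongM R M M id (fun=> v (x i)) (E i) cM (Cinf_cst cM _) (vE i)).
Qed.

(** * Differential forms evaluated on fields along a map *)

Section Forms_along.
Variables (M : dspace R) (om : form2 M) (fom : is_form2 om).

Lemma form2_0l p v : tangent p v -> om p 0 v = 0.
Proof.
move=> tv; have [L _ _] := fom; have t0 := @tangent0 R M p.
by have := L p (-1) 0 0 v t0 t0 tv; rewrite scaler0 addr0 mulN1r addNr.
Qed.

Lemma form2_linl p a u u' v : tangent p u -> tangent p u' -> tangent p v ->
  om p (a *: u + u') v = a * om p u v + om p u' v.
Proof. by have [L _ _] := fom; exact: L. Qed.

Lemma form2_Zl p a u v : tangent p u -> tangent p v -> om p (a *: u) v = a * om p u v.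
Proof.
move=> tu tv; have := form2_linl a tu (@tangent0 R M p) tv.
by rewrite !addr0 form2_0l// addr0.
Qed.

Lemma form2_Dl p u u' v : tangent p u -> tangent p u' -> tangent p v ->
  om p (u + u') v = om p u v + om p u' v.
Proof. by move=> tu tu' tv; have := form2_linl 1 tu tu' tv; rewrite scale1r mul1r. Qed.

Lemma form2_anti p u v : tangent p u -> tangent p v -> om p v u = - om p u v.
Proof. by have [_ A _] := fom; exact: A. Qed.

Lemma form2_Zr p a u v : tangent p u -> tangent p v -> om p u (a *: v) = a * om p u v.
Proof.
move=> tu tv; have tav := tangentZ a tv.
by rewrite (form2_anti tav tu) form2_Zl// (form2_anti tu tv) mulrN opprK.
Qed.

Lemma form2_Dr p u v v' : tangent p u -> tangent p v -> tangent p v' ->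
  om p u (v + v') = om p u v + om p u v'.
Proof.
move=> tu tv tv'; have tvv := tangentD tv tv'.
rewrite (form2_anti tvv tu) form2_Dl// (form2_anti tu tv) (form2_anti tu tv').
by rewrite opprD !opprK.
Qed.

Lemma form2_Br p u v v' : tangent p u -> tangent p v -> tangent p v' ->
  om p u (v - v') = om p u v - om p u v'.
Proof.
move=> tu tv tv'; rewrite form2_Dr//; last exact: tangentN.
by rewrite -scaleN1r form2_Zr// mulN1r.
Qed.

Lemma form2_suml p (I : Type) (r : seq I) (a : I -> R) (E : I -> vect M) v :
  (forall i, tangent p (E i)) -> tangent p v ->
  om p (\sum_(i <- r) a i *: E i) v = \sum_(i <- r) a i * om p (E i) v.
Proof.
move=> tE tv; elim: r => [|i r IH]; first by rewrite !big_nil form2_0l.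
rewrite !big_cons form2_linl ?IH//; apply: tangent_sum => j; exact: tangentZ.
Qed.

Lemma form2_sumr p (I : Type) (r : seq I) (a : I -> R) (E : I -> vect M) v :
  (forall i, tangent p (E i)) -> tangent p v ->
  om p v (\sum_(i <- r) a i *: E i) = \sum_(i <- r) a i * om p v (E i).
Proof.
move=> tE tv; rewrite form2_anti ?form2_suml//; last first.
  by apply: tangent_sum => j; exact: tangentZ.
by rewrite -sumrN; apply: eq_bigr => i _; rewrite (form2_anti (tE i) tv) mulrN.
Qed.

Variables (cM : closed_dspace M) (fM : framed M).
Variables (T : dspace R) (cT : closed_dspace T) (F : T -> M) (sF : smooth_map F).
Variables (X Y : T -> vect M) (vX : vfield_along F X) (vY : vfield_along F Y).

(** Puts the form into a shape where [Y] enters only through the functions Y t (y i), from which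
    smoothness and the derivative at a zero of [Y] can be read off. *)
Lemma form2_along_local t0 : exists (I : finType) (b : T -> R) (y : I -> M -> R)
    (D : I -> T -> vect M) (w : I -> T -> R),
  [/\ Cinf b, 0 < b t0, forall i, Cinf (y i) /\ Cinf (w i),
      (forall t, 0 < b t -> om (F t) (X t) (Y t) = \sum_i Y t (y i) * w i t) &
      (forall v, tangent (F t0) v -> om (F t0) (X t0) v = \sum_i v (y i) * w i t0)].
Proof.
have [I [b [x [E [Cb b0 Cx vE bE]]]]] := fM (F t0).
have tE i q : tangent q (E i q) by case: (vE i).
pose w j t := \sum_i X t (x i) * om (F t) (E i (F t)) (E j (F t)).
exists I, (b \o F), x, (fun i t => E i (F t)), w; split=> //.
- exact: sF.
- move=> i; split=> //; apply: Cinf_sum => // j; apply: CinfM => //.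
    by case: vX => _; exact.
  by case: fom => _ _ /(_ _ _ (vE j) (vE i)); exact: sF.
- move=> t bt; have [_ EP] := bE _ bt.
  have tX : tangent (F t) (X t) by case: vX.
  have tY : tangent (F t) (Y t) by case: vY.
  rewrite {1}(EP _ tY) form2_sumr//; apply: eq_bigr => j _; congr (_ * _).
  by rewrite {1}(EP _ tX) form2_suml.
- move=> v tv; have [_ EP] := bE _ b0.
  have tX : tangent (F t0) (X t0) by case: vX.
  rewrite {1}(EP _ tv) form2_sumr//; apply: eq_bigr => j _; congr (_ * _).
  by rewrite {1}(EP _ tX) form2_suml.
Qed.

Lemma Cinf_form2_along : Cinf (fun t => om (F t) (X t) (Y t)).
Proof.
apply: Cinf_local => // t0.
have [I [b [y [D [w [Cb b0 Cyw H _]]]]]] := form2_along_local t0.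
exists b, (fun t => \sum_i Y t (y i) * w i t); split=> //.
apply: Cinf_sum => // i; have [Cy Cw] := Cyw i; apply: CinfM => //.
by case: vY => _; exact.
Qed.

(** The componentwise derivative of a field along [F]. Where [Z] vanishes it is a tangent vector
    without any choice of connection, since the Leibniz terms containing the value of [Z] drop
    out. *)
Definition nabla (u : vect T) (Z : T -> vect M) : vect M :=
  patch (fun=> 0) (@Cinf R M) (fun f => u (fun t => Z t f)).

Lemma nablaE u Z f : Cinf f -> nabla u Z f = u (fun t => Z t f).
Proof. by move=> Cf; rewrite /nabla /patch mem_set. Qed.

Lemma tangent_nabla t0 u Z : tangent t0 u -> vfield_along F Z -> Z t0 = 0 ->
  tangent (F t0) (nabla u Z).
Proof.
move=> tu [Z1 Z2] Z0; split=> [a f g Cf Cg|f g Cf Cg|f nf]; last first.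
- by rewrite /nabla /patch memNset.
- rewrite !nablaE//; last exact: CinfM.
  have ZM t : Z t (fun q => f q * g q) = f (F t) * Z t g + g (F t) * Z t f.
    exact: (tangent_fM (Z1 t)).
  under eq_fun do rewrite ZM.
  have CfF := sF Cf; have CgF := sF Cg; have CZf := Z2 f Cf; have CZg := Z2 g Cg.
  rewrite (tangent_fD tu); try exact: CinfM.
  rewrite (tangent_fM tu CfF CZg) (tangent_fM tu CgF CZf) Z0.
  have E0 h : (0 : vect M) h = 0 by [].
  by rewrite !E0 !mul0r !addr0.
- rewrite !nablaE//; last by apply: CinfD => //; exact: CinfZ.
  have CZf := Z2 f Cf; have CZg := Z2 g Cg.
  have ZL t : Z t (fun q => a * f q + g q) = a * Z t f + Z t g.
    by case: (Z1 t) => L _ _; exact: L.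
  under eq_fun do rewrite ZL.
  by case: tu => L _ _; exact: L.
Qed.

(** In the product rule, the terms that differentiate the form or [X] carry the value [Y t0], which
    is zero. *)
Lemma form2_along_deriv t0 u : tangent t0 u -> Y t0 = 0 ->
  u (fun t => om (F t) (X t) (Y t)) = om (F t0) (X t0) (nabla u Y).
Proof.
move=> tu Y0; have [I [b [y [D [w [Cb b0 Cyw H H0]]]]]] := form2_along_local t0.
have CY i : Cinf (fun t => Y t (y i)) by case: vY => _; apply; case: (Cyw i).
have Cw i : Cinf (w i) by case: (Cyw i).
rewrite (tangent_local cT tu Cinf_form2_along _ Cb b0 H); last first.
  by apply: Cinf_sum => // i; exact: CinfM.
rewrite (tangent_fsum cT tu); last by move=> i; exact: CinfM.
rewrite H0; last exact: tangent_nabla.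
apply: eq_bigr => i _; rewrite (tangent_fM tu)// nablaE; last by case: (Cyw i).
have E0 h : (0 : vect M) h = 0 by [].
by rewrite Y0 E0 mul0r add0r mulrC.
Qed.

End Forms_along.

Lemma vbracketE M (X Y : M -> vect M) p f : Cinf f ->
  vbracket X Y p f = X p (fun q => Y q f) - Y p (fun q => X q f).
Proof. by move=> Cf; rewrite /vbracket /patch mem_set. Qed.

Lemma vfield_vbracket M (X Y : M -> vect M) : closed_dspace M ->
  vfield X -> vfield Y -> vfield (vbracket X Y).
Proof.
move=> cM [X1 X2] [Y1 Y2]; split=> [p|f Cf]; last first.
  under eq_fun do rewrite vbracketE//.
  by apply: CinfB => //; [exact: (X2 _ (Y2 _ Cf))|exact: (Y2 _ (X2 _ Cf))].
split=> [a f g Cf Cg|f g Cf Cg|f nf]; last by rewrite /vbracket /patch memNset.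
- rewrite !vbracketE//; last by apply: CinfD => //; exact: CinfZ.
  have XL q : X q (fun q => a * f q + g q) = a * X q f + X q g by case: (X1 q) => L _ _; exact: L.
  have YL q : Y q (fun q => a * f q + g q) = a * Y q f + Y q g by case: (Y1 q) => L _ _; exact: L.
  under eq_fun do rewrite YL; under [in X in _ - X]eq_fun do rewrite XL.
  have [LX _ _] := X1 p; have [LY _ _] := Y1 p.
  by rewrite LX ?LY; try exact: X2; try exact: Y2; ring.
- rewrite !vbracketE//; last exact: CinfM.
  have XM q : X q (fun q => f q * g q) = f q * X q g + g q * X q f by exact: (tangent_fM (X1 q)).
  have YM q : Y q (fun q => f q * g q) = f q * Y q g + g q * Y q f by exact: (tangent_fM (Y1 q)).
  under eq_fun do rewrite YM; under [in X in _ - X]eq_fun do rewrite XM.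
  have [CXf CXg CYf CYg] := And4 (X2 f Cf) (X2 g Cg) (Y2 f Cf) (Y2 g Cg).
  rewrite !(tangent_fD (X1 p)) ?(tangent_fD (Y1 p)); try exact: CinfM.
  rewrite (tangent_fM (X1 p) Cf CYg) (tangent_fM (X1 p) Cg CYf).
  rewrite (tangent_fM (Y1 p) Cf CXg) (tangent_fM (Y1 p) Cg CXf).
  ring.
Qed.

End Frame.

(** * Right translations on a Lie groupoid *)

(* The kernel of the differential of a submersion is tangent to its level sets:
   coordinates turn this into [level_set_tangent]. *)
Lemma tangent_level_set (R : realType) (M N : manifold R) (F : M -> N) (k : M)
    (v : vect M) (f b : M -> R) : smooth_map F ->
  (forall X, tangent (F k) X -> exists2 u, tangent k u & tmap F u = X) ->
  tangent k v -> tmap F v = 0 -> Cinf f -> Cinf b -> 0 < b k ->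
  (forall k', F k' = F k -> 0 < b k' -> f k' = 0) -> v f = 0.
Proof.
move=> sF subF tv Fv Cf Cb bk fb.
have cM : closed_dspace M by []; have cN : closed_dspace N by [].
case: (manifoldP M) => _ _ _ _ /(_ k)[u [x [Cu uk Cx ox rep]]].
have [w [y [E [[Cw wk Cy vE wE] inj]]]] := manifold_frame (F k).
have [E1 _] := wE _ wk.
have CyF i : Cinf (fun q => y (F q) 0 i) by exact: (sF _ (Cy i)).
have /choice[S SP] i := rep _ (CyF i).
have [g [sg fg]] := rep f Cf.
have [bb [sbb bE]] := rep b Cb.
have [ww [sww wwE]] := rep _ (sF _ Cw).
(* Lifts of the frame at [F k] are the vectors [B] on which [level_set_tangent] relies. *)
have uE i : exists t, tangent k t /\ tmap F t = E i (F k).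
  by have [|t tt Ft] := subF (E i (F k)); [case: (vE i)|exists t].
have {uE} /choice[e eP] := uE.
pose SS z : 'rV[R]_(mdim N) := \row_i S i z.
have sSS i : smooth (fun z => SS z 0 i).
  by under eq_fun do rewrite mxE; case: (SP i).
pose V (t : vect M) : 'rV[R]_(mdim M) := \row_i t (fun q => x q 0 i).
have ddirV h (g' : 'rV[R]_(mdim M) -> R) t : Cinf h -> smooth g' -> tangent k t ->
    (forall q, 0 < u q -> h q = g' (x q)) -> ddir g' (V t) (x k) = t h.
  move=> Ch sg' tt hg.
  rewrite (tangent_local cM tt Ch (Cinf_comp cM Cx sg') Cu uk hg) (tangent_chain cM tt Cx sg').
  by rewrite ddirE; apply: eq_bigr => i _; rewrite mxE mulrC.
have dS i t : tangent k t -> ddir (fun z => SS z 0 i) (V t) (x k) = tmap F t (fun q => y q 0 i).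
  move=> tt; rewrite (tmapE F t (Cy i)); apply: ddirV => [|||q uq] //; first exact: CyF.
  by rewrite mxE; case: (SP i) => _; exact.
have St i : ddir (fun z => SS z 0 i) (V v) (x k) = 0 by rewrite dS// Fv.
have SB i j : ddir (fun z => SS z 0 i) (V (e j)) (x k) = (i == j)%:R.
  by have [te Fe] := eP j; rewrite dS// Fe E1.
rewrite -(ddirV f g v)//.
have N1 : nbhs (x k) (x @` [set q | 0 < u q]).
  by apply: open_nbhs_nbhs; split => //; exists k.
have pos (h : 'rV[R]_(mdim M) -> R) : smooth h -> 0 < h (x k) -> \forall z \near x k, 0 < h z.
  move=> sh h0; have /cvgrPdist_lt/(_ _ h0) := smooth_continuous sh (x := x k).
  apply: filterS => z; rewrite ltr_norml => /andP[_].
  by rewrite ltrBlDr ltrDl.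
have N2 := pos bb sbb; rewrite -bE// in N2; have {}N2 := N2 bk.
have N3 := pos ww sww; rewrite -wwE// in N3; have {}N3 := N3 wk.
have N4 : \forall z \near x k, [/\ (x @` [set q | 0 < u q]) z, 0 < bb z & 0 < ww z].
  by apply: filterS3 N1 N2 N3.
have /nbhs_normP[r /= r0 rP] := N4.
apply: (level_set_tangent sSS St SB sg r0) => z zk Sz.
have zk' : `|x k - z| < r by rewrite distrC.
have [[q uq xq] bz wz] := rP z zk'.
rewrite -xq in zk Sz bz wz *.
(* The coordinates [y] separate points only where [w] is positive; this is why positivity of [ww]
   was secured near [x k]. *)
have Fq : F q = F k.
  apply: inj; rewrite ?wk//; first by have := wwE q uq => /= ->.
  apply/rowP => i; have [_ SE] := SP i.
  by rewrite !SE//; have := congr1 (fun z : 'rV[R]_(mdim N) => z 0 i) Sz; rewrite !mxE.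
by rewrite -fg// fb// bE.
Qed.

Section Groupoid.
Variables (R : realType) (H : lie_groupoid R).
Local Notation A := (arr H).
Local Notation N := (obj H).
Local Notation s := (@src R H).
Local Notation t := (@tgt R H).
Local Notation e := (@eps R H).
Local Notation AA := (prod_space (arr H) (arr H)).
Local Notation C2 := (composable H).

Let cA : closed_dspace A. Proof. by []. Qed.
Let cAA : closed_dspace AA. Proof. by []. Qed.
Let cN : closed_dspace N. Proof. by []. Qed.
Let cC : closed_dspace C2. Proof. by rewrite /composable. Qed.

Definition cpair (k l : A) (kl : s k = t l) : C2 := exist _ (k, l) kl.
Definition cfst (z : C2) : A := (sval z).1.
Definition csnd (z : C2) : A := (sval z).2.
Definition cmulc (z : C2) : A := cmul (sval z).1 (sval z).2.

Lemma smooth_cmulc : @smooth_map R C2 A cmulc.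
Proof. exact: cmul_smooth. Qed.

Lemma smooth_sval : @smooth_map R C2 AA sval.
Proof. exact: smooth_map_sval. Qed.

Lemma smooth_cfst : @smooth_map R C2 A cfst.
Proof. exact: (smooth_map_comp smooth_sval (@smooth_map_fst R A A)). Qed.

Lemma smooth_csnd : @smooth_map R C2 A csnd.
Proof. exact: (smooth_map_comp smooth_sval (@smooth_map_snd R A A)). Qed.

Definition vertical (k : A) (v : vect A) : Prop := tangent k v /\ tmap (N := N) s v = 0.

Definition fibre_rep (k : A) (f g : A -> R) : Prop :=
  Cinf g /\ exists b, [/\ Cinf b, 0 < b k &
    forall k', s k' = s k -> 0 < b k' -> f k' = g k'].

(* The derivative of [f] along a vertical vector, when [f] is only known to be
   smooth along the source fibre. *)
Definition fibre_deriv (k : A) (v : vect A) (f : A -> R) : R :=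
  v (xget (fun=> 0) (fibre_rep k f)).

(** Two representatives differ by a function that vanishes on the source fibre near [k], and a
    vertical vector kills it by [tangent_level_set]. The choice made by [xget] is therefore
    immaterial. *)
Lemma fibre_derivE k v f g : vertical k v -> fibre_rep k f g -> fibre_deriv k v f = v g.
Proof.
move=> [tv sv] fg; rewrite /fibre_deriv.
have [Cg [b [Cb bk bE]]] := fg.
have [Cg' [b' [Cb' bk' bE']]] := xgetPex (fun=> 0) (ex_intro _ g fg).
set g' := xget _ _ in Cg' bE' *; apply/eqP; rewrite -subr_eq0 -(tangent_fB cA tv)//.
have [c [Cc ck cP]] := common_nbhd2 cA Cb Cb' bk bk'.
apply/eqP; apply: (@tangent_level_set R A N s k v _ c (@src_smooth R H)) => //.
- exact: src_submersion.
- exact: CinfB.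
- by move=> k' sk' /cP[b1 b2]; rewrite -bE// -bE'// subrr.
Qed.

Definition comp_rep (z0 : A * A) (f : C2 -> R) (F b : A * A -> R) : Prop :=
  [/\ @Cinf R AA F, @Cinf R AA b, 0 < b z0 & forall z : C2, 0 < b (sval z) -> f z = F (sval z)].

Lemma comp_rep_exists (z : C2) (f : C2 -> R) : @Cinf R C2 f ->
  exists F b, comp_rep (sval z) f F b.
Proof.
move=> /smooth_closureP/(_ z)[n [h [b [g [[Gh sb b0] sg fE]]]]].
have /choice[h' h'P] i : exists h', @Cinf R AA h' /\ (fun q : C2 => h' (sval q)) = fun q => h q 0 i.
  by case: (Gh i) => h' Ch' hE; exists h'.
pose hh z : 'rV[R]_n := \row_i h' i z.
have Chh i : @Cinf R AA (fun z => hh z 0 i).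
  by under eq_fun do rewrite mxE; case: (h'P i).
have hhE (q : C2) : hh (sval q) = h q.
  by apply/rowP => i; rewrite mxE; case: (h'P i) => _ /(congr1 (@^~ q)).
exists (fun z => g (hh z)), (fun z => b (hh z)); split.
- exact: Cinf_comp.
- exact: Cinf_comp.
- by rewrite hhE.
- by move=> q; rewrite hhE => /fE.
Qed.

(** The default 0 is harmless: when s k = t l, every pair (k', l) with k' in the source fibre of [k]
    is composable. *)
Let extend (f : C2 -> R) (z : A * A) : R :=
  if pselect (s z.1 = t z.2) is left zz then f (exist _ z zz) else 0.

(* The tangent vector [(v, 0)] at the composable pair [(k, l)]. *)
Definition vert_comp (k l : A) (v : vect A) : vect C2 :=
  patch (fun=> 0) (@Cinf R C2) (fun f => fibre_deriv k v (fun k' => extend f (k', l))).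

Lemma smooth_pairl (l : A) : @smooth_map R A AA (fun k => (k, l)).
Proof. exact: smooth_map_pairl. Qed.

Lemma vert_compE k l v f F b : s k = t l -> vertical k v -> @Cinf R C2 f ->
  comp_rep (k, l) f F b -> vert_comp k l v f = v (fun k' => F (k', l)).
Proof.
move=> kl vv Cf [CF Cb b0 fF]; rewrite /vert_comp /patch mem_set//.
apply: (fibre_derivE vv); split; first exact: (@smooth_pairl l _ CF).
exists (fun k' => b (k', l)); split=> //; first exact: (@smooth_pairl l _ Cb).
move=> k' sk' bk'; rewrite /extend; case: pselect => [kl'|]; first exact: fF.
by rewrite /= sk'.
Qed.

Lemma tangent_vert_comp k l (kl : s k = t l) v : vertical k v ->
  tangent (cpair kl) (vert_comp k l v).
Proof.
move=> vv; have [tv _] := vv.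
split=> [a f g Cf Cg|f g Cf Cg|f nf]; last by rewrite /vert_comp /patch memNset.
- have [F [b FP]] := comp_rep_exists (cpair kl) Cf.
  have [G [c GP]] := comp_rep_exists (cpair kl) Cg.
  rewrite (vert_compE kl vv Cf FP) (vert_compE kl vv Cg GP).
  have [[CF Cb b0 fF] [CG Cc c0 gG]] := (FP, GP).
  have [d [Cd d0 dP]] := common_nbhd2 cAA Cb Cc b0 c0.
  have CFG : @Cinf R AA (fun z => a * F z + G z) by apply: CinfD => //; exact: CinfZ.
  rewrite (@vert_compE k l v _ (fun z => a * F z + G z) d)//.
  + by case: tv => L _ _; apply: L; exact: (@smooth_pairl l).
  + by apply: CinfD => //; exact: CinfZ.
  + by split=> // z /dP[b1 b2]; rewrite fF// gG.
- have [F [b FP]] := comp_rep_exists (cpair kl) Cf.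
  have [G [c GP]] := comp_rep_exists (cpair kl) Cg.
  rewrite (vert_compE kl vv Cf FP) (vert_compE kl vv Cg GP).
  have [[CF Cb b0 fF] [CG Cc c0 gG]] := (FP, GP).
  have [d [Cd d0 dP]] := common_nbhd2 cAA Cb Cc b0 c0.
  rewrite (@vert_compE k l v _ (fun z => F z * G z) d)//.
  + rewrite (tangent_fM tv); [|exact: (@smooth_pairl l)..].
    by rewrite fF// gG.
  + exact: CinfM.
  + by split; [exact: CinfM|..] => // z /dP[b1 b2]; rewrite fF// gG.
Qed.

Lemma tmap_vert_comp (P : dspace R) (G : A * A -> P) k l v : s k = t l -> vertical k v ->
  @smooth_map R AA P G ->
  tmap (M := C2) (fun z => G (sval z)) (vert_comp k l v) = tmap (M := A) (fun k' => G (k', l)) v.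
Proof.
move=> kl vv sG; apply/funext => f; have [Cf|nf] := pselect (Cinf f); last by rewrite !tmap_out.
rewrite !tmapE//; apply: (@vert_compE k l v _ (f \o G) (fun=> 1)) => //.
- exact: (smooth_sval (sG _ Cf)).
- by split=> //; [exact: sG|exact: (Cinf_cst cAA)].
Qed.

Lemma tmap_cfst_vert k l v : s k = t l -> vertical k v ->
  tmap (M := C2) cfst (vert_comp k l v) = v.
Proof.
move=> kl vv; rewrite (tmap_vert_comp (G := fst) kl vv) ?(tmap_id vv.1)//.
exact: smooth_map_fst.
Qed.

Lemma tmap_csnd_vert k l v : s k = t l -> vertical k v ->
  tmap (M := C2) csnd (vert_comp k l v) = 0.
Proof.
move=> kl vv; rewrite (tmap_vert_comp (G := snd) kl vv).
  exact: (tmap_cst _ cA vv.1).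
exact: smooth_map_snd.
Qed.

(** The differential at [k] of right multiplication by [l]. That multiplication lives on a source
    fibre only, so the vector is routed through the composable pairs. *)
Definition rtrans (k l : A) (v : vect A) : vect A := tmap (M := C2) cmulc (vert_comp k l v).

Definition mul_rep (k l : A) (f : A -> R) (F b : A * A -> R) : Prop :=
  [/\ @Cinf R AA F, @Cinf R AA b, 0 < b (k, l) & forall k' l', s k' = t l' ->
      0 < b (k', l') -> f (cmul k' l') = F (k', l')].

Lemma mul_rep_exists k l f : s k = t l -> Cinf f -> exists F b, mul_rep k l f F b.
Proof.
move=> kl Cf; have [F [b [CF Cb b0 fF]]] := comp_rep_exists (cpair kl) (smooth_cmulc Cf).
by exists F, b; split=> // k' l' kl'; exact: (fF (cpair kl')).
Qed.

Lemma rtransE k l v f F b : s k = t l -> vertical k v -> Cinf f -> mul_rep k l f F b ->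
  rtrans k l v f = v (fun k' => F (k', l)).
Proof.
move=> kl vv Cf [CF Cb b0 fF]; rewrite /rtrans tmapE//.
apply: (@vert_compE k l v _ F b) => //; first exact: smooth_cmulc.
by split=> // -[[k' l'] kl'] /=; exact: fF.
Qed.

Lemma tangent_rtrans k l v : s k = t l -> vertical k v -> tangent (cmul k l) (rtrans k l v).
Proof.
move=> kl vv; apply: (@tangent_tmap R C2 A cmulc (cpair kl)) => //.
  exact: smooth_cmulc.
exact: tangent_vert_comp.
Qed.

Lemma tmap_src_rtrans k l v : s k = t l -> vertical k v -> tmap (N := N) s (rtrans k l v) = 0.
Proof.
move=> kl vv; have ss : @smooth_map R A N s by exact: src_smooth.
rewrite -(@tmap_comp R C2 A N cmulc s)//.
have -> : (fun z : C2 => s (cmulc z)) = fun z => s (csnd z).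
  by apply/funext => -[[k' l'] kl']; exact: src_cmul.
by rewrite (@tmap_comp R C2 A N csnd s)// tmap_csnd_vert// tmap0.
Qed.

Lemma tmap_tgt_rtrans k l v : s k = t l -> vertical k v ->
  tmap (N := N) t (rtrans k l v) = tmap (N := N) t v.
Proof.
move=> kl vv; have st : @smooth_map R A N t by exact: tgt_smooth.
rewrite -(@tmap_comp R C2 A N cmulc t)//.
have -> : (fun z : C2 => t (cmulc z)) = fun z => t (cfst z).
  by apply/funext => -[[k' l'] kl']; exact: tgt_cmul.
by rewrite (@tmap_comp R C2 A N cfst t)// tmap_cfst_vert.
Qed.

Lemma vertical_rtrans k l v : s k = t l -> vertical k v ->
  vertical (cmul k l) (rtrans k l v).
Proof. by move=> kl vv; split; [exact: tangent_rtrans|exact: tmap_src_rtrans]. Qed.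

Lemma rtrans_unit k v : vertical k v -> rtrans k (e (s k)) v = v.
Proof.
move=> vv; have ke : s k = t (e (s k)) by rewrite tgt_eps.
have tr := tangent_rtrans ke vv; rewrite cmul_epsr in tr.
apply: (vect_eq (M := A) tr vv.1) => f Cf.
have [F [b FP]] := mul_rep_exists ke Cf; rewrite (rtransE ke vv Cf FP).
have [CF Cb b0 fF] := FP.
rewrite -(@fibre_derivE k v f (fun k' => F (k', e (s k))) vv).
  apply: (fibre_derivE vv); split=> //.
  by exists (fun=> 1); split=> //; exact: (Cinf_cst cA).
split; first exact: (@smooth_pairl _ _ CF).
exists (fun k' => b (k', e (s k))); split=> //; first exact: (@smooth_pairl _ _ Cb).
move=> k' sk' bk'; rewrite -fF//; last by rewrite tgt_eps.
by rewrite -sk' cmul_epsr.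
Qed.

(** By associativity both sides differentiate f(k' l l') along [v] in the source fibre of [k]. The
    work lies in finding a common domain for the local representatives. *)
Lemma rtrans_comp k l l' v : s k = t l -> s l = t l' -> vertical k v ->
  rtrans (cmul k l) l' (rtrans k l v) = rtrans k (cmul l l') v.
Proof.
move=> kl ll vv.
have kll : s (cmul k l) = t l' by rewrite src_cmul.
have kll' : s k = t (cmul l l') by rewrite tgt_cmul.
have vr := vertical_rtrans kl vv.
have t1 := tangent_rtrans kll vr; rewrite -cmulA// in t1.
apply: (vect_eq (M := A) t1 (tangent_rtrans kll' vv)) => f Cf.
have [F [b FP]] := mul_rep_exists kll Cf; rewrite (rtransE kll vr Cf FP).
have [CF Cb b0 fF] := FP.
have CFl := @smooth_pairl l' _ CF; have Cbl := @smooth_pairl l' _ Cb.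
have [G [c GP]] := mul_rep_exists kl CFl; rewrite (rtransE kl vv CFl GP).
have [CG Cc c0 gG] := GP.
(* The domain condition of [F] concerns the composite (k' l, l'), so the bound [b] needs a
   representative near (k, l) of its own. *)
have [B [d [CB Cd d0 bB]]] := mul_rep_exists kl Cbl.
have [F' [b' F'P]] := mul_rep_exists kll' Cf; rewrite (rtransE kll' vv Cf F'P).
have [CF' Cb' b'0 fF'] := F'P.
have B0 : 0 < B (k, l) by rewrite -bB.
have [j [Cj j0 jP]] := common_nbhd2 cAA Cc Cd c0 d0.
have [j' [Cj' j'0 j'P]] := common_nbhd2 cAA Cj CB j0 B0.
rewrite -(@fibre_derivE k v (fun k' => f (cmul k' (cmul l l'))) (fun k' => G (k', l)) vv).
  apply: (fibre_derivE vv); split; first exact: (@smooth_pairl _ _ CF').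
  exists (fun k' => b' (k', cmul l l')); split=> //; first exact: (@smooth_pairl _ _ Cb').
  by move=> k' sk' b'k'; rewrite fF'// sk'.
split; first exact: (@smooth_pairl _ _ CG).
exists (fun k' => j' (k', l)); split=> //; first exact: (@smooth_pairl _ _ Cj').
move=> k' sk' /j'P[/jP[cc dd] BB].
have skl : s k' = t l by rewrite sk'.
rewrite cmulA// -gG//; apply: fF; first by rewrite src_cmul.
by move: BB; rewrite -bB.
Qed.

Lemma cinvK (g : A) : cinv (cinv g) = g.
Proof.
have gg : s g = t (cinv g) by rewrite tgt_cinv.
have hh : s (cinv g) = t (cinv (cinv g)) by rewrite tgt_cinv.
have := cmulA gg hh; rewrite !cmulVr -gg cmul_epsr => E; rewrite [RHS]E.
by rewrite -(src_cinv g) hh cmul_epsl.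
Qed.

Lemma tgt_submersion (g : A) X : tangent (t g) X ->
  exists2 u, tangent g u & tmap (M := A) (N := N) t u = X.
Proof.
rewrite -(src_cinv g) => /src_submersion[u tu uX].
have sinv : @smooth_map R A A (@cinv R H) by exact: cinv_smooth.
exists (tmap (M := A) (N := A) (@cinv R H) u).
  by have := @tangent_tmap R A A _ (cinv g) u cA sinv tu; rewrite cinvK.
have st : @smooth_map R A N t by exact: tgt_smooth.
rewrite -(@tmap_comp R A A N (@cinv R H) t)//.
have -> : (fun k : A => t (cinv k)) = s by apply/funext => k; exact: tgt_cinv.
exact: uX.
Qed.

(** * Sections of the Lie algebroid *)

Definition asection (a : N -> vect A) : Prop :=
  vfield_along e a /\ forall x, tmap (N := N) s (a x) = 0.

Lemma asection_algebroid a x : asection a -> lie_algebroid x (a x).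
Proof. by move=> [[ta _] sa]; split. Qed.

Lemma algebroid_vertical x v : lie_algebroid x v -> vertical (e x) v.
Proof. by []. Qed.

Lemma asection_extension x u : lie_algebroid x u -> exists2 a, asection a & a x = u.
Proof.
move=> [tu su]; have [V vV Vx] := vfield_extension cA (@manifold_framed R A) tu.
have se : @smooth_map R N A e by exact: eps_smooth.
have ss : @smooth_map R A N s by exact: src_smooth.
have ses : @smooth_map R A A (fun g => e (s g)) by exact: (smooth_map_comp ss se).
have vV' := @vfield_along_comp R A N A id e V se vV.
(* The identity minus T(e s) projects the tangent space at a unit onto the kernel of T s. *)
exists (fun y => V (e y) - tmap (M := A) (N := A) (fun g => e (s g)) (V (e y))).
  split.
    apply: vfield_alongB => //.
    have := vfield_along_tmap cA ses vV'.
    by under eq_fun do rewrite src_eps.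
  move=> y; rewrite tmapB -(@tmap_comp R A A N (fun g : A => e (s g)) s)//.
  have -> : (fun g : A => s (e (s g))) = s by apply/funext => g; rewrite src_eps.
  by rewrite subrr.
by rewrite Vx (@tmap_comp R A N A s e)// su tmap0 subr0.
Qed.

Definition rinv (a : N -> vect A) (g : A) : vect A := rtrans (e (t g)) g (a (t g)).

Lemma vertical_rinv a g : asection a -> vertical g (rinv a g).
Proof.
move=> sa; have := @vertical_rtrans (e (t g)) g (a (t g)).
rewrite src_eps cmul_epsl; apply=> //; exact: asection_algebroid.
Qed.

Lemma rinv_eps a x : asection a -> rinv a (e x) = a x.
Proof.
move=> sa; rewrite /rinv tgt_eps -[X in rtrans _ (e X)](src_eps x).
exact/rtrans_unit/asection_algebroid.
Qed.

Lemma rinvE a g f F b : asection a -> Cinf f -> mul_rep (e (t g)) g f F b ->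
  rinv a g f = a (t g) (fun k => F (k, g)).
Proof.
move=> sa Cf FP; apply: (rtransE _ _ Cf FP); first by rewrite src_eps.
exact: asection_algebroid.
Qed.

(** A single representative of the multiplication near (e (t g0), g0) serves all nearby [g], so the
    field acts as a partial derivative with smooth parameter. *)
Lemma vfield_rinv a : asection a -> vfield (rinv a).
Proof.
move=> sa; split=> [g|f Cf]; first by have [] := vertical_rinv g sa.
have se : @smooth_map R N A e by exact: eps_smooth.
have st : @smooth_map R A N t by exact: tgt_smooth.
have set' : @smooth_map R A A (fun g => e (t g)) by exact: (smooth_map_comp st se).
have sid : @smooth_map R A A id by [].
apply: Cinf_local => // g0.
have ee g : s (e (t g)) = t g by rewrite src_eps.
have [F [b [CF Cb b0 fF]]] := mul_rep_exists (ee g0) Cf.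
exists (fun g => b (e (t g), g)), (fun g => a (t g) (fun k => F (k, g))); split=> //.
- exact: (smooth_map_pair cA set' sid Cb).
- apply: (@Cinf_partial R A A A (fun g => e (t g)) id (fun g => a (t g)) F) => //.
  by apply: (vfield_along_comp st); case: sa.
- by move=> g bg; apply: (@rinvE a g f F b) => //; split.
Qed.

End Groupoid.

(** * The multiplicative form along the units *)

Section Form3.
Variables (R : realType) (M : dspace R) (th : form3 M) (fth : is_form3 th).

Lemma form3_0l p v w : tangent p v -> tangent p w -> th p 0 v w = 0.
Proof.
move=> tv tw; have [L _ _ _] := fth; have t0 := @tangent0 R M p.
by have := L p (-1) 0 0 v w t0 t0 tv tw; rewrite scaler0 addr0 mulN1r addNr.
Qed.

Lemma form3_0r p u v : tangent p u -> tangent p v -> th p u v 0 = 0.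
Proof.
move=> tu tv; have [_ A B _] := fth; have t0 := @tangent0 R M p.
by rewrite B// A// form3_0l// !oppr0.
Qed.

End Form3.

Section Lie_deriv.
Variables (R : realType) (N : manifold R) (K : lie_group R).
Implicit Types (X : N -> vect N) (w : N -> vect K).

Let cN : closed_dspace N. Proof. by []. Qed.

Definition lie_alg_valued w : Prop := vfield_along (fun _ : N => gone K) w.

(** Subtracting the constant [w p] creates a zero at [p] without changing the derivative, so the
    componentwise derivative is a [nabla] and stays in the Lie algebra. *)
Lemma lie_derivE X w p : tangent p (X p) -> lie_alg_valued w ->
  lie_deriv X w p = nabla (X p) (fun q => w q - w p).
Proof.
move=> tX vw; have [tw sw] := vw; apply/funext => f; rewrite /lie_deriv.
have [Cf|nf] := pselect (Cinf f); last first.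
  rewrite /nabla /patch memNset//.
  have -> : (fun q => w q f) = fun=> 0.
    by apply/funext => q; have [_ _] := tw q; exact.
  exact: (tangent_fcst cN tX).
rewrite nablaE//.
have -> : (fun q => (w q - w p) f) = fun q => w q f - w p f by [].
have Cw := sw _ Cf.
rewrite (tangent_fB cN tX Cw); last exact: (Cinf_cst cN (w p f)).
by rewrite (tangent_fcst cN tX) subr0.
Qed.

Lemma tangent_lie_deriv X w p : tangent p (X p) -> lie_alg_valued w ->
  lie_alg (lie_deriv X w p).
Proof.
move=> tX vw; rewrite lie_derivE//; have [tw sw] := vw.
apply: (@tangent_nabla R K _ N cN (fun=> gone K) _ p (X p) (fun q => w q - w p) tX) => //.
- exact: smooth_map_cst.
- apply: vfield_alongB => //; split=> [t|f Cf]; first exact: tw.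
  exact: (Cinf_cst cN).
- by rewrite subrr.
Qed.

End Lie_deriv.

Section Isotropic_morphism.
Variables (R : realType) (K : lie_group R).
Variables (Om : form2 (K2 K)) (Th : form3 K).
Variable H : lie_groupoid R.
Variable Phi : arr H -> K.
Variables (sigma : form2 (arr H)) (eta : form3 (obj H)).
Hypothesis fOm : is_form2 Om.
Hypothesis fTh : is_form3 Th.
Hypothesis H_isot : isotropic_morphism Om Th Phi sigma eta.

Local Notation A := (arr H).
Local Notation N := (obj H).
Local Notation s := (@src R H).
Local Notation t := (@tgt R H).
Local Notation e := (@eps R H).
Local Notation C2 := (composable H).
Local Notation one := (gone K).

Let cA : closed_dspace A. Proof. by []. Qed.
Let cN : closed_dspace N. Proof. by []. Qed.
Let cK : closed_dspace K. Proof. by []. Qed.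
Let cKK : closed_dspace (K2 K). Proof. exact: prod_space_closed. Qed.
Let fKK : framed (K2 K).
Proof. by apply: prod_framed => //; exact: manifold_framed. Qed.
Let fA : framed A. Proof. exact: manifold_framed. Qed.

Let se : @smooth_map R N A e. Proof. exact: eps_smooth. Qed.
Let ss : @smooth_map R A N s. Proof. exact: src_smooth. Qed.
Let st : @smooth_map R A N t. Proof. exact: tgt_smooth. Qed.
Let set' : @smooth_map R A A (fun g => e (t g)). Proof. exact: (smooth_map_comp st se). Qed.
Let sPhi : @smooth_map R A K Phi. Proof. by case: H_isot => -[]. Qed.
Let fs : is_form2 sigma. Proof. by case: H_isot => _ []. Qed.
Let feta : is_form3 eta. Proof. by case: H_isot => _ []. Qed.

Let PhiM g h : s g = t h -> Phi (cmul g h) = gmul (Phi g) (Phi h).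
Proof. by case: H_isot => -[_ P] _ _ _ _; exact: P. Qed.

Lemma Phi_eps x : Phi (e x) = one.
Proof.
have h : s (e x) = t (e x) by rewrite src_eps tgt_eps.
have ee : cmul (e x) (e x) = e x by rewrite -{2}(src_eps x) cmul_epsr.
have := PhiM h; rewrite ee => E.
by have := congr1 (gmul (ginv (Phi (e x)))) E; rewrite [RHS]gmulA gmulVl gmul1l => <-.
Qed.

Lemma tmap_tgt_eps v x : tangent x v -> tmap (M := A) (N := N) t (tmap (M := N) (N := A) e v) = v.
Proof.
move=> tv; rewrite -(@tmap_comp R N A N e t)//.
have -> : (fun y : N => t (e y)) = id by apply/funext => y; exact: tgt_eps.
exact: tmap_id tv.
Qed.

Lemma tmap_Phi_eps v x : tangent x v -> lie_map Phi (tmap (M := N) (N := A) e v) = 0.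
Proof.
move=> tv; rewrite /lie_map -(@tmap_comp R N A K e Phi)//.
have -> : (fun y : N => Phi (e y)) = fun=> one by apply/funext => y; exact: Phi_eps.
exact: (tmap_cst _ cN tv).
Qed.

Lemma tangent_lie_map g v : tangent g v -> tangent (Phi g) (lie_map Phi v).
Proof. by move=> tv; exact: tangent_tmap. Qed.

Lemma tangent_anchor g v : tangent g v -> tangent (t g) (anchor v).
Proof. by move=> tv; exact: tangent_tmap. Qed.

Lemma lie_alg_lie_map x v : tangent (e x) v -> lie_alg (lie_map Phi v).
Proof. by move=> tv; rewrite /lie_alg -(Phi_eps x); exact: tangent_lie_map. Qed.

Lemma anchor_tangent x v : tangent (e x) v -> tangent x (anchor v).
Proof. by move=> tv; rewrite -(tgt_eps x); exact: tangent_anchor. Qed.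

Lemma lie_map_rtrans k l v : s k = t l -> vertical k v ->
  lie_map Phi (rtrans k l v) = tmap (M := K) (N := K) (fun q => gmul q (Phi l)) (lie_map Phi v).
Proof.
move=> kl vv; rewrite /lie_map /rtrans -(@tmap_comp R C2 A K (@cmulc R H) Phi)//.
have -> : (fun z : C2 => Phi (cmulc z)) = fun z => gmul (Phi (sval z).1) (Phi (sval z).2).
  by apply/funext => -[[k' l'] kl'] /=; exact: PhiM.
have smul := @gmul_smooth R K.
have sPP : @smooth_map R (prod_space A A) (prod_space K K) (fun z => (Phi z.1, Phi z.2)).
  apply: smooth_map_pair => //.
    exact: (smooth_map_comp (@smooth_map_fst R A A) sPhi).
  exact: (smooth_map_comp (@smooth_map_snd R A A) sPhi).
rewrite (@tmap_vert_comp R H K (fun z => gmul (Phi z.1) (Phi z.2)) k l v kl vv); last first.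
  exact: (smooth_map_comp sPP smul).
rewrite -(@tmap_comp R A K K Phi (fun q => gmul q (Phi l)))//.
exact: (smooth_map_comp (@smooth_map_pairl R K K (Phi l) cK) smul).
Qed.

(** Multiplicativity of sigma on the pair (v, 0) and [ze]: the term of the second projection
    disappears. *)
Lemma sigma_mult k l (kl : s k = t l) v ze : vertical k v -> tangent (cpair kl) ze ->
  sigma (cmul k l) (rtrans k l v) (tmap (M := C2) (N := A) (@cmulc R H) ze) =
  sigma k v (tmap (M := C2) (N := A) (@cfst R H) ze) -
  Om (Phi k, Phi l) (tmap (M := K) (N := K2 K) (fun q => (q, Phi l)) (lie_map Phi v))
    (tmap (M := C2) (N := K2 K) (fun z => (Phi (cfst z), Phi (csnd z))) ze).
Proof.
move=> vv tz; have tx := tangent_vert_comp kl vv.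
case: H_isot => _ _ _ /(_ (cpair kl) _ _ tx tz) E _.
have {}E : sigma k (tmap (M := C2) (N := A) (@cfst R H) (vert_comp k l v))
      (tmap (M := C2) (N := A) (@cfst R H) ze)
    + sigma l (tmap (M := C2) (N := A) (@csnd R H) (vert_comp k l v))
      (tmap (M := C2) (N := A) (@csnd R H) ze)
    - sigma (cmul k l) (rtrans k l v) (tmap (M := C2) (N := A) (@cmulc R H) ze)
    = Om (Phi k, Phi l) (tmap (M := C2) (N := K2 K)
        (fun z => (Phi (cfst z), Phi (csnd z))) (vert_comp k l v))
      (tmap (M := C2) (N := K2 K) (fun z => (Phi (cfst z), Phi (csnd z))) ze) := E.
move: E; rewrite tmap_cfst_vert// tmap_csnd_vert// form2_0l//; last first.
  by apply: (@tangent_tmap R C2 A (@csnd R H) (cpair kl)) => //; exact: smooth_csnd.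
have sPP : @smooth_map R (prod_space A A) (prod_space K K) (fun z => (Phi z.1, Phi z.2)).
  apply: smooth_map_pair => //.
    exact: (smooth_map_comp (@smooth_map_fst R A A) sPhi).
  exact: (smooth_map_comp (@smooth_map_snd R A A) sPhi).
rewrite (@tmap_vert_comp R H (K2 K) (fun z => (Phi z.1, Phi z.2)) k l v kl vv sPP).
rewrite (@tmap_comp R A K (K2 K) Phi (fun q => (q, Phi l))); last exact: smooth_map_pairl.
rewrite addr0 => <-; by rewrite opprB addrC subrK.
Qed.

(** The map [j] is a section of the multiplication, so every [W] is a product of composable tangent
    vectors. The formula is needed at all arrows, because it is later differentiated in the
    direction of Lie algebroid elements, which leave the units. *)
Lemma sigma_rtrans g v W : lie_algebroid (t g) v -> tangent g W ->
  sigma g (rtrans (e (t g)) g v) W =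
  sigma (e (t g)) v (tmap (M := N) (N := A) e (anchor W)) -
  Om (one, Phi g) (tmap (M := K) (N := K2 K) (fun q => (q, Phi g)) (lie_map Phi v))
    (tmap (M := K) (N := K2 K) (fun q => (one, q)) (lie_map Phi W)).
Proof.
move=> vv tW; have kl h : s (e (t h)) = t h by rewrite src_eps.
pose j : A -> C2 := fun h => cpair (kl h).
have sj : @smooth_map R A C2 j.
  apply: (@smooth_map_sub R (prod_space A A) A (fun z => s z.1 = t z.2)
    (fun h => (e (t h), h)) kl) => //.
  exact: (smooth_map_pair cA set' (@smooth_map_id R A)).
have tz : tangent (cpair (kl g)) (tmap (M := A) (N := C2) j W).
  apply: (@tangent_tmap R A C2 j g) => //; exact: sub_space_closed.
have := sigma_mult vv tz; rewrite cmul_epsl.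
rewrite -(@tmap_comp R A C2 A j (@cmulc R H)); last exact: smooth_cmulc.
rewrite -(@tmap_comp R A C2 A j (@cfst R H)); last exact: smooth_cfst.
rewrite -(@tmap_comp R A C2 (K2 K) j (fun z => (Phi (cfst z), Phi (csnd z)))); last first.
  apply: smooth_map_pair; first exact: sub_space_closed.
    exact: (smooth_map_comp (@smooth_cfst R H) sPhi).
  exact: (smooth_map_comp (@smooth_csnd R H) sPhi).
have -> : (fun p : A => cmulc (j p)) = id by apply/funext => p; exact: cmul_epsl.
rewrite (tmap_id tW).
have -> : (fun p : A => cfst (j p)) = fun p => e (t p) by [].
have -> : (fun p : A => (Phi (cfst (j p)), Phi (csnd (j p)))) = fun p => (one, Phi p).
  by apply/funext => p; rewrite /j /= Phi_eps.
rewrite (@tmap_comp R A N A t e)// (@tmap_comp R A K (K2 K) Phi (fun q => (one, q))).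
  by rewrite Phi_eps.
exact: smooth_map_pairr.
Qed.

Lemma lambdaE x u X : tangent x X ->
  lambda sigma x u X = sigma (e x) u (tmap (M := N) (N := A) e X).
Proof. by move=> tX; rewrite /lambda /restr /patch mem_set. Qed.

Lemma lambda_out x u X : ~ tangent x X -> lambda sigma x u X = 0.
Proof. by move=> tX; rewrite /lambda /restr /patch memNset. Qed.

Definition Om12 (a b : vect K) : R :=
  Om (one, one) (tmap (@inK1 R K) a) (tmap (@inK2 R K) b).

Lemma tangent_inK1 a : lie_alg a -> @tangent R (K2 K) (one, one) (tmap (@inK1 R K) a).
Proof.
move=> ta; apply: (@tangent_tmap R K (K2 K) (@inK1 R K) one) => //.
exact: smooth_map_pairl.
Qed.

Lemma tangent_inK2 a : lie_alg a -> @tangent R (K2 K) (one, one) (tmap (@inK2 R K) a).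
Proof.
move=> ta; apply: (@tangent_tmap R K (K2 K) (@inK2 R K) one) => //.
exact: smooth_map_pairr.
Qed.

Lemma lie_pairingE a b : lie_alg a -> lie_alg b ->
  lie_pairing Om a b = - Om12 a b - Om12 b a.
Proof.
move=> ta tb; rewrite /lie_pairing /Om12; congr (_ + _).
by rewrite (form2_anti fOm (tangent_inK1 tb) (tangent_inK2 ta)).
Qed.

Lemma sigma_unit x u W : lie_algebroid x u -> tangent (e x) W ->
  sigma (e x) u W = lambda sigma x u (anchor W) - Om12 (lie_map Phi u) (lie_map Phi W).
Proof.
move=> au tW; have := @sigma_rtrans (e x) u W; rewrite tgt_eps => /(_ au tW).
rewrite Phi_eps lambdaE; last exact: anchor_tangent.
have := rtrans_unit (algebroid_vertical au); rewrite src_eps => ->.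
by [].
Qed.

Lemma rho_isotropic x u v : lie_algebroid x u -> lie_algebroid x v ->
  lambda sigma x u (anchor v) + lambda sigma x v (anchor u) +
  lie_pairing Om (lie_map Phi u) (lie_map Phi v) = 0.
Proof.
move=> au av; have [[tu _] [tv _]] := (au, av).
have := form2_anti fs tu tv; rewrite sigma_unit// sigma_unit//.
rewrite lie_pairingE; try exact: (@lie_alg_lie_map x).
by move=> /eqP; rewrite -subr_eq0 opprK => /eqP <-; ring.
Qed.

(** * Bracket of sections of the Lie algebroid *)

Section Bracket.
Variables (a b : N -> vect A) (sa : asection a) (sb : asection b).

Definition abracket (x : N) : vect A := vbracket (rinv a) (rinv b) (e x).

Let va : vfield (rinv a). Proof. exact: vfield_rinv. Qed.
Let vb : vfield (rinv b). Proof. exact: vfield_rinv. Qed.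

Lemma asection_abracket : asection abracket.
Proof.
split.
  have vab := @vfield_vbracket R A _ _ cA va vb.
  exact: (@vfield_along_comp R A N A id e _ se vab).
move=> x; apply/funext => f; have [Cf|nf] := pselect (Cinf f); last by rewrite tmap_out.
have z (c : N -> vect A) (sc : asection c) : (fun q => rinv c q (f \o s)) = fun=> 0.
  apply/funext => q; rewrite -tmapE//.
  by have [_ ->] := vertical_rinv q sc.
rewrite tmapE// /abracket vbracketE; last exact: ss.
rewrite !z// (tangent_fcst cA (va.1 _)) (tangent_fcst cA (vb.1 _)).
by rewrite subrr.
Qed.

End Bracket.

Section Anchor.
Variables (a : N -> vect A) (sa : asection a).

Definition asection_anchor (x : N) : vect N := anchor (a x).
Definition asection_Phi (x : N) : vect K := lie_map Phi (a x).

Lemma vfield_anchor : vfield asection_anchor.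
Proof.
have := vfield_along_tmap cN st sa.1.
by rewrite (_ : (fun x : N => t (e x)) = id)//; apply/funext => x; exact: tgt_eps.
Qed.

Lemma lie_alg_valued_Phi : lie_alg_valued asection_Phi.
Proof.
have := vfield_along_tmap cK sPhi sa.1; rewrite /lie_alg_valued.
by rewrite (_ : (fun x : N => Phi (e x)) = fun=> one)//; apply/funext => x; exact: Phi_eps.
Qed.

Lemma rinv_tgt g f : Cinf f -> rinv a g (f \o t) = asection_anchor (t g) f.
Proof.
move=> Cf; rewrite -tmapE// tmap_tgt_rtrans//; first by rewrite src_eps.
exact: asection_algebroid.
Qed.

Lemma rinv_Phi g f : Cinf f ->
  rinv a g (f \o Phi) = asection_Phi (t g) (fun k => f (gmul k (Phi g))).
Proof.
move=> Cf; rewrite -[LHS](@tmapE R A K Phi)// -/(lie_map Phi _) lie_map_rtrans//.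
- by rewrite tmapE.
- by rewrite src_eps.
- exact: asection_algebroid.
Qed.

Lemma Cinf_Phi_translate f : Cinf f ->
  @Cinf R (prod_space N K) (fun z => asection_Phi z.1 (fun k => f (gmul k z.2))).
Proof.
move=> Cf; have vw := lie_alg_valued_Phi.
apply: (@Cinf_partial R (prod_space N K) K K (fun=> one) snd
  (fun z => asection_Phi z.1) (fun z => f (gmul z.1 z.2))) => //.
- exact: smooth_map_cst.
- exact: smooth_map_snd.
- exact: (vfield_along_comp (@smooth_map_fst R N K) vw).
- exact: (@gmul_smooth R K _ Cf).
Qed.

End Anchor.

Section Bracket_components.
Variables (a b : N -> vect A) (sa : asection a) (sb : asection b).

Lemma anchor_abracket x :
  anchor (abracket a b x) = vbracket (asection_anchor a) (asection_anchor b) x.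
Proof.
apply/funext => f; have [Cf|nf] := pselect (Cinf f); last first.
  by rewrite /anchor tmap_out// /vbracket /patch memNset.
rewrite /anchor tmapE// /abracket [LHS]vbracketE; last exact: (st Cf).
rewrite vbracketE// !rinv_eps//.
have h (c d : N -> vect A) (sc : asection c) (sd : asection d) :
    c x (fun q => rinv d q (f \o t)) = asection_anchor c x (fun q => asection_anchor d q f).
  have Cd : Cinf (fun q => asection_anchor d q f) by have [_] := vfield_anchor sd; exact.
  rewrite /asection_anchor [RHS]tmapE//; congr (c x _).
  by apply/funext => g; rewrite rinv_tgt.
by rewrite !h.
Qed.

(** By right invariance the arrow [q] occurs twice, through [t q] and through [Phi q]. The first
    occurrence gives a Lie derivative along the anchor, the second one half of the Lie bracket. *)
Lemma asection_Phi_deriv (c d : N -> vect A) x f : asection c -> asection d -> Cinf f ->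
  c x (fun q => rinv d q (f \o Phi)) =
  asection_anchor c x (fun y => asection_Phi d y f) +
  asection_Phi c x (fun q => asection_Phi d x (fun k => f (gmul k q))).
Proof.
move=> sc sd Cf; have CP := Cinf_Phi_translate sd Cf.
have -> : (fun q => rinv d q (f \o Phi)) =
    fun q => asection_Phi d (t q) (fun k => f (gmul k (Phi q))).
  by apply/funext => q; exact: rinv_Phi.
have tc : tangent (e x) (c x) by case: sc => -[].
rewrite (@tangent_diag R A N K t Phi
  (fun z => asection_Phi d z.1 (fun k => f (gmul k z.2))) (e x) (c x))//.
rewrite tgt_eps Phi_eps; congr (_ + _).
  rewrite /asection_anchor [RHS]tmapE; last by have [_] := lie_alg_valued_Phi sd; exact.
  congr (c x _); apply/funext => q /=; congr (asection_Phi d _ _).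
  by apply/funext => k; rewrite gmul1r.
rewrite [in RHS]/asection_Phi /lie_map [RHS]tmapE//.
exact: (@smooth_map_pairr R N K x cK _ CP).
Qed.

Lemma lie_map_abracket x : lie_map Phi (abracket a b x) =
  lie_deriv (asection_anchor a) (asection_Phi b) x
  - lie_deriv (asection_anchor b) (asection_Phi a) x
  + lie_bracket (asection_Phi a x) (asection_Phi b x).
Proof.
have ea : tangent x (asection_anchor a x) by case: (vfield_anchor sa).
have eb : tangent x (asection_anchor b x) by case: (vfield_anchor sb).
have [ta _] := lie_alg_valued_Phi sa; have [tb _] := lie_alg_valued_Phi sb.
apply/funext => f; have [Cf|nf] := pselect (Cinf f); last first.
  rewrite /lie_map tmap_out//.
  have la := tangent_lie_deriv ea (lie_alg_valued_Phi sb).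
  have lb := tangent_lie_deriv eb (lie_alg_valued_Phi sa).
  rewrite vect_addE vect_addE vect_oppE.
  have [_ _ ->] := la; last by [].
  have [_ _ ->] := lb; last by [].
  by rewrite /lie_bracket /vbracket /patch memNset// subrr addr0.
rewrite /lie_map tmapE// /abracket [LHS]vbracketE; last exact: (sPhi Cf).
rewrite !rinv_eps// !asection_Phi_deriv//.
rewrite vect_addE vect_addE vect_oppE /lie_deriv /lie_bracket vbracketE//.
have r1 v : lie_alg v -> right_inv v one = v.
  move=> tv; rewrite /right_inv (_ : (fun k => gmul k one) = id) ?(tmap_id tv)//.
  by apply/funext => k; exact: gmul1r.
have r2 v : (fun q => right_inv v q f) = fun q => v (fun k => f (gmul k q)).
  by apply/funext => q; rewrite /right_inv tmapE.
rewrite !r1; [|exact: tb|exact: ta].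
rewrite !r2; ring.
Qed.

Section Cotangent_component.
Variables (Y : N -> vect N) (vY : vfield Y) (x : N).
Variables (Z : A -> vect A) (vZ : vfield Z).
Hypothesis ZY : Z (e x) = tmap (M := N) (N := A) e (Y x).

Let tY : tangent x (Y x). Proof. by case: vY. Qed.

(** Both terms on the left depend on how [Z] extends its value at [e x], whereas their sum does not.
    This is why two terms of the exterior derivative are computed together. *)
Lemma sigma_along_rinv (c d : N -> vect A) : asection c -> asection d ->
  c x (fun q => sigma q (rinv d q) (Z q)) + sigma (e x) (vbracket (rinv c) Z (e x)) (d x) =
  asection_anchor c x (fun y => lambda sigma y (d y) (Y y))
  - lambda sigma x (d x) (vbracket (asection_anchor c) Y x)
  - Om12 (asection_Phi d x) (lie_deriv Y (asection_Phi c) x).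
Proof.
move=> sc sd; have tc : tangent (e x) (c x) by case: sc => -[].
have td y : tangent (e y) (d y) by case: sd => -[].
have vc := vfield_rinv sc; have vd := vfield_rinv sd.
have vwc := lie_alg_valued_Phi sc; have vwd := lie_alg_valued_Phi sd.
have vXc := vfield_anchor sc.
pose cZ := vbracket (rinv c) Z (e x).
have tcZ : tangent (e x) cZ by case: (vfield_vbracket cA vc vZ).
have tcY : tangent x (vbracket (asection_anchor c) Y x) by case: (vfield_vbracket cN vXc vY).
have tL := tangent_lie_deriv tY vwc.
(* [sigma (rinv d) Z = S0 + S1 - S2] by [sigma_rtrans]; [D] and [Q] vanish at [e x]. *)
pose D q := tmap (M := N) (N := A) e (anchor (Z q)) - tmap (M := N) (N := A) e (Y (t q)).
pose P q := tmap (M := K) (N := K2 K) (fun k => (k, Phi q)) (asection_Phi d (t q)).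
pose Q q := tmap (M := K) (N := K2 K) (fun k => (one, k)) (lie_map Phi (Z q)).
pose S0 q := sigma (e (t q)) (d (t q)) (tmap (M := N) (N := A) e (Y (t q))).
pose S1 q := sigma (e (t q)) (d (t q)) (D q).
pose S2 q := Om (one, Phi q) (P q) (Q q).
have vdt : vfield_along (fun q : A => e (t q)) (fun q => d (t q)).
  exact: (vfield_along_comp st sd.1).
have vYe : vfield_along e (fun y => tmap (M := N) (N := A) e (Y y)).
  exact: (@vfield_along_tmap R N N A id e Y cA se vY).
have vYt : vfield_along (fun q : A => e (t q)) (fun q => tmap (M := N) (N := A) e (Y (t q))).
  exact: (vfield_along_comp st vYe).
have vZt : vfield_along (fun q : A => e (t q))
    (fun q => tmap (M := N) (N := A) e (anchor (Z q))).
  apply: (@vfield_along_tmap R A N A t e) => //.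
  exact: (@vfield_along_tmap R A A N id t Z cN st vZ).
have vD : vfield_along (fun q : A => e (t q)) D by exact: vfield_alongB.
have sone : @smooth_map R A K (fun=> one) by exact: smooth_map_cst.
have sF2 : @smooth_map R A (K2 K) (fun q => (one, Phi q)) by exact: smooth_map_pair.
have vP : @vfield_along R A (K2 K) (fun q => (one, Phi q)) P.
  apply: (@vfield_along_pairl R A K K (fun=> one) Phi (fun q => asection_Phi d (t q))) => //.
  exact: (vfield_along_comp st vwd).
have vQ : @vfield_along R A (K2 K) (fun q => (one, Phi q)) Q.
  apply: (@vfield_along_pairr R A K K (fun=> one) Phi (fun q => lie_map Phi (Z q))) => //.
  exact: (@vfield_along_tmap R A A K id Phi Z cK sPhi vZ).
have SE : (fun q => sigma q (rinv d q) (Z q)) = fun q => S0 q + S1 q - S2 q.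
  apply/funext => q; have tZ : tangent q (Z q) by case: vZ.
  rewrite /rinv sigma_rtrans//; last exact: asection_algebroid.
  congr (_ - _); rewrite /S0 /S1 /D.
  have tdq := td (t q); have tYq : tangent (e (t q)) (tmap (M := N) (N := A) e (Y (t q))).
    by case: vYt.
  rewrite -form2_Dr//; last by case: vD.
  by rewrite addrC subrK.
have CS0 : Cinf S0 by exact: (@Cinf_form2_along R A sigma fs fA A cA _ set' _ _ vdt vYt).
have CS1 : Cinf S1 by exact: (@Cinf_form2_along R A sigma fs fA A cA _ set' _ _ vdt vD).
have CS2 : Cinf S2 by exact: (@Cinf_form2_along R (K2 K) Om fOm fKK A cA _ sF2 _ _ vP vQ).
have aZ : anchor (Z (e x)) = Y x by rewrite ZY; exact: (tmap_tgt_eps tY).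
have PZ : lie_map Phi (Z (e x)) = 0 by rewrite ZY; exact: (tmap_Phi_eps tY).
have D0 : D (e x) = 0 by rewrite /D aZ tgt_eps subrr.
have Q0 : Q (e x) = 0 by rewrite /Q PZ tmap0.
rewrite SE (tangent_fB cA tc (CinfD cA CS0 CS1) CS2) (tangent_fD tc CS0 CS1).
have -> : c x S0 = asection_anchor c x (fun y => lambda sigma y (d y) (Y y)).
  have E : (fun y => lambda sigma y (d y) (Y y)) =
      fun y => sigma (e y) (d y) (tmap (M := N) (N := A) e (Y y)).
    by apply/funext => y; rewrite lambdaE//; case: vY.
  rewrite E /asection_anchor [RHS]tmapE//.
  exact: (@Cinf_form2_along R A sigma fs fA N cN _ se _ _ sd.1 vYe).
(* The derivative of [D] along [c x] contains only the halves of two brackets in which [c] acts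
   last. The other halves agree, since [Z] at [e x] is the image of [Y x], and may be inserted. *)
have -> : c x S1 = sigma (e x) (d x)
    (tmap (M := N) (N := A) e (anchor cZ - vbracket (asection_anchor c) Y x)).
  rewrite /S1 (form2_along_deriv fs cA fA cA set' vdt vD tc D0).
  rewrite tgt_eps; congr (sigma _ _ _).
  have tn := @tangent_nabla R A cA A cA (fun q : A => e (t q)) set' (e x) (c x) D tc vD D0.
  rewrite tgt_eps in tn; apply: (vect_eq tn).
    apply: (@tangent_tmap R N A e x) => //; apply: tangentB => //.
    exact: anchor_tangent.
  move=> f Cf; have Cfe := se Cf.
  rewrite nablaE// tmapE// vect_addE vect_oppE /anchor tmapE// /cZ vbracketE; last exact: st.
  rewrite vbracketE// rinv_eps//.
  have CZ : Cinf (fun q => Z q (f \o e \o t)) by case: vZ => _; apply; exact: (st Cfe).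
  have CY : Cinf (fun y => Y y (f \o e)) by case: vY => _; exact.
  have CX : Cinf (fun y => asection_anchor c y (f \o e)) by case: vXc => _; exact.
  have -> : (fun q => D q f) = fun q => Z q (f \o e \o t) - Y (t q) (f \o e).
    by apply/funext => q; rewrite /D vect_addE vect_oppE tmapE// [X in _ - X]tmapE// /anchor tmapE.
  rewrite (tangent_fB cA tc CZ (st CY)).
  have -> : Z (e x) (fun q => rinv c q ((f \o e) \o t)) =
      Y x (fun y => asection_anchor c y (f \o e)).
    rewrite -aZ /anchor [RHS]tmapE//; congr (Z _ _).
    by apply/funext => q; exact: rinv_tgt.
  have -> : asection_anchor c x (fun q => Y q (f \o e)) = c x ((fun q => Y q (f \o e)) \o t).
    by rewrite /asection_anchor /anchor tmapE.
  move: (c x _) (c x _) (Y x _) => r1 r2 r3; ring.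
(* Here nothing compensates the half of the bracket in which [Z] acts last; along the units it is
   the derivative of [asection_Phi c] in the direction of [Y]. *)
have -> : c x S2 = Om12 (asection_Phi d x) (lie_map Phi cZ + lie_deriv Y (asection_Phi c) x).
  rewrite /S2 (form2_along_deriv fOm cKK fKK cA sF2 vP vQ tc Q0).
  rewrite /P tgt_eps Phi_eps /Om12; congr (Om _ _ _).
  have tn := @tangent_nabla R (K2 K) cKK A cA _ sF2 (e x) (c x) Q tc vQ Q0.
  rewrite Phi_eps in tn; apply: (vect_eq tn).
    by apply: tangent_inK2; apply: tangentD => //; exact: (@lie_alg_lie_map x).
  move=> f Cf; have Cf1 : Cinf (f \o @inK2 R K) by exact: (@smooth_map_pairr R K K one cK _ Cf).
  rewrite nablaE// tmapE// vect_addE /lie_map tmapE// /cZ vbracketE; last exact: sPhi.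
  rewrite rinv_eps//.
  have CP := Cinf_Phi_translate sc Cf1.
  have -> : (fun q => Q q f) = fun q => Z q ((f \o @inK2 R K) \o Phi).
    by apply/funext => q; rewrite /Q tmapE// /lie_map tmapE.
  have -> : Z (e x) (fun q => rinv c q ((f \o @inK2 R K) \o Phi)) =
      lie_deriv Y (asection_Phi c) x (f \o @inK2 R K).
    have -> : (fun q => rinv c q ((f \o @inK2 R K) \o Phi)) =
        fun q => asection_Phi c (t q) (fun k => (f \o @inK2 R K) (gmul k (Phi q))).
      by apply/funext => q; exact: rinv_Phi.
    rewrite ZY [LHS]tmapE; last first.
      exact: (smooth_map_pair cA st sPhi CP).
    rewrite /lie_deriv; congr (Y x _); apply/funext => y /=.
    rewrite tgt_eps Phi_eps; congr (asection_Phi c y _).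
    by apply/funext => k; rewrite /= gmul1r.
  by rewrite subrK.
have tXc : tangent (e x) (c x) := tc.
have LcZ : lie_alg (lie_map Phi cZ) by exact: (@lie_alg_lie_map x).
have Ld : lie_alg (asection_Phi d x) by case: vwd => tv _; exact: tv.
have tau : tangent x (anchor cZ) by exact: anchor_tangent.
(* The unit formula expresses the bracket term by [lambda] and [Om12] of [cZ]; both parts cancel
   against the contributions of [S1] and [S2]. *)
rewrite -/cZ (form2_anti fs (td x) tcZ) (sigma_unit (asection_algebroid x sd) tcZ).
rewrite tmapB (form2_Br fs (td x)); try by apply: (@tangent_tmap R N A e x).
rewrite -!lambdaE// /Om12 tmapD.
rewrite (form2_Dr fOm (tangent_inK1 Ld) (tangent_inK2 LcZ) (tangent_inK2 tL)).
rewrite -/(Om12 _ _) -/(Om12 _ _) -/(asection_Phi d x); ring.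
Qed.

Lemma Om12_deriv (w w' : N -> vect K) : lie_alg_valued w -> lie_alg_valued w' ->
  Y x (fun y => Om12 (w y) (w' y)) = Om12 (lie_deriv Y w x) (w' x) + Om12 (w x) (lie_deriv Y w' x).
Proof.
move=> vw vw'.
have s1 : @smooth_map R K (K2 K) (@inK1 R K) by exact: smooth_map_pairl.
have s2 : @smooth_map R K (K2 K) (@inK2 R K) by exact: smooth_map_pairr.
have sF : @smooth_map R N (K2 K) (fun=> (one, one)) by exact: smooth_map_cst.
have lift (i : K -> K2 K) (v : N -> vect K) : @smooth_map R K (K2 K) i -> i one = (one, one) ->
    lie_alg_valued v -> @vfield_along R N (K2 K) (fun=> (one, one)) (fun y => tmap i (v y)).
  by move=> si i1 vv; have := vfield_along_tmap cKK si vv; rewrite i1.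
have vcst (v : vect K) : lie_alg v -> @lie_alg_valued R N K (fun=> v).
  by move=> tv; split=> // f Cf; exact: (Cinf_cst cN).
have tw y : lie_alg (w y) by case: vw => tv _; exact: tv.
have tw' y : lie_alg (w' y) by case: vw' => tv _; exact: tv.
pose d (v : N -> vect K) y : vect K := v y - v x.
have vd v : lie_alg_valued v -> lie_alg_valued (d v).
  by move=> vv; apply: vfield_alongB => //; apply: vcst; case: vv => tv _; exact: tv.
have d0 v : d v x = 0 by rewrite /d subrr.
have nb (i : K -> K2 K) v : @smooth_map R K (K2 K) i -> i one = (one, one) -> lie_alg_valued v ->
    nabla (Y x) (fun y => tmap i (d v y)) = tmap i (lie_deriv Y v x).
  move=> si i1 vv; rewrite lie_derivE//; apply/funext => f.
  have [Cf|nf] := pselect (@Cinf R (K2 K) f); last first.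
    by rewrite /nabla /patch memNset// tmap_out.
  rewrite nablaE// tmapE// nablaE; last exact: si.
  by congr (Y x _); apply/funext => y; rewrite tmapE.
(* Bilinear expansion around [x], arranged so that each varying term has a second argument vanishing
   at [x], as [form2_along_deriv] requires. *)
have E : (fun y => Om12 (w y) (w' y)) = fun y =>
    Om (one, one) (tmap (@inK1 R K) (w y)) (tmap (@inK2 R K) (d w' y))
    - Om (one, one) (tmap (@inK2 R K) (w' x)) (tmap (@inK1 R K) (d w y))
    + Om12 (w x) (w' x).
  apply/funext => y; have [t1 t2] := (tangent_inK1 (tw y), tangent_inK2 (tw' y)).
  have [t3 t4] := (tangent_inK1 (tw x), tangent_inK2 (tw' x)).
  rewrite /d !tmapB !form2_Br// (form2_anti fOm t1 t4) (form2_anti fOm t3 t4) /Om12; ring.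
have v1 := lift _ _ s1 erefl vw; have v2 := lift _ _ s2 erefl (vd _ vw').
have v3 := lift _ _ s2 erefl (vcst _ (tw' x)); have v4 := lift _ _ s1 erefl (vd _ vw).
have C1 := Cinf_form2_along fOm fKK cN sF v1 v2.
have C2' := Cinf_form2_along fOm fKK cN sF v3 v4.
rewrite E (tangent_fD tY (CinfB cN C1 C2') (Cinf_cst cN _)) (tangent_fB cN tY C1 C2').
rewrite (tangent_fcst cN tY) addr0.
rewrite (form2_along_deriv fOm cKK fKK cN sF v1 v2 tY); last by rewrite d0 tmap0.
rewrite (form2_along_deriv fOm cKK fKK cN sF v3 v4 tY); last by rewrite d0 tmap0.
rewrite !nb// -/(Om12 _ _).
have tL := tangent_lie_deriv tY vw.
by rewrite (form2_anti fOm (tangent_inK1 tL) (tangent_inK2 (tw' x))) opprK addrC.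
Qed.

Lemma lambda_abracket_ext : lambda sigma x (abracket a b x) (Y x) =
  (asection_anchor a x (fun y => lambda sigma y (b y) (Y y))
   - lambda sigma x (b x) (vbracket (asection_anchor a) Y x))
  - (asection_anchor b x (fun y => lambda sigma y (a y) (Y y))
     - Y x (fun y => lambda sigma y (a y) (asection_anchor b y))
     - lambda sigma x (a x) (vbracket (asection_anchor b) Y x))
  + eta x (asection_anchor a x) (asection_anchor b x) (Y x)
  + lie_pairing Om (lie_deriv Y (asection_Phi a) x) (asection_Phi b x).
Proof.
have va := vfield_rinv sa; have vb := vfield_rinv sb.
have ta y : tangent (e y) (a y) by case: sa => -[].
have tb y : tangent (e y) (b y) by case: sb => -[].
have vwa := lie_alg_valued_Phi sa; have vwb := lie_alg_valued_Phi sb.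
have tL := tangent_lie_deriv tY vwa.
have tZ : tangent (e x) (Z (e x)) by case: vZ.
have [_ _ _ _ [dsig _]] := H_isot.
have E := dsig _ _ _ va vb vZ (e x).
(* The source term vanishes because right invariant fields are vertical, and the [Th] term because
   [Phi] is constant on the units, to which [Z] is tangent at [e x]. Only the target term is
   left. *)
have E1 : (pull3 (M := A) (N := N) s eta - pull3 (M := A) (N := N) t eta
    - pull3 (M := A) (N := K) Phi Th) (e x) (rinv a (e x)) (rinv b (e x)) (Z (e x)) =
    - eta x (asection_anchor a x) (asection_anchor b x) (Y x).
  change (eta (s (e x)) (tmap (N := N) s (rinv a (e x))) (tmap (N := N) s (rinv b (e x)))
      (tmap (N := N) s (Z (e x)))
    - eta (t (e x)) (tmap (N := N) t (rinv a (e x))) (tmap (N := N) t (rinv b (e x)))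
      (tmap (N := N) t (Z (e x)))
    - Th (Phi (e x)) (tmap Phi (rinv a (e x))) (tmap Phi (rinv b (e x)))
      (tmap Phi (Z (e x))) = - eta x (asection_anchor a x) (asection_anchor b x) (Y x)).
  rewrite !rinv_eps// ZY (tmap_tgt_eps tY) -/(lie_map Phi (tmap e (Y x))) (tmap_Phi_eps tY).
  rewrite form3_0r//; try by apply: (@tangent_tmap R A K Phi (e x)).
  rewrite sa.2 form3_0l//; first by rewrite tgt_eps sub0r subr0.
    by rewrite sb.2; exact: tangent0.
  by apply: (@tangent_tmap R A N s (e x)) => //; rewrite -ZY.
rewrite E1 !rinv_eps// in E.
(* At [e x] the field [Z] is tangent to the units, so only the restriction of sigma(rinv a, rinv b)
   to the units matters, and [sigma_unit] gives it. *)
have E2 : Z (e x) (fun q => sigma q (rinv a q) (rinv b q)) =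
    Y x (fun y => lambda sigma y (a y) (asection_anchor b y))
    - Om12 (lie_deriv Y (asection_Phi a) x) (asection_Phi b x)
    - Om12 (asection_Phi a x) (lie_deriv Y (asection_Phi b) x).
  rewrite ZY [LHS]tmapE; last first.
    exact: (@Cinf_form2_along R A sigma fs fA A cA id (@smooth_map_id R A) _ _ va vb).
  have -> : (fun q => sigma q (rinv a q) (rinv b q)) \o e =
      fun y => lambda sigma y (a y) (asection_anchor b y)
        - Om12 (asection_Phi a y) (asection_Phi b y).
    apply/funext => y /=; rewrite !rinv_eps// sigma_unit//; exact: asection_algebroid.
  rewrite (tangent_fB cN tY); first by rewrite Om12_deriv// opprD addrA.
    have -> : (fun y => lambda sigma y (a y) (asection_anchor b y)) =
        fun y => sigma (e y) (a y) (tmap (M := N) (N := A) e (asection_anchor b y)).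
      by apply/funext => y; rewrite lambdaE//; exact: anchor_tangent.
    apply: (@Cinf_form2_along R A sigma fs fA N cN e se _ _ sa.1).
    exact: (@vfield_along_tmap R N N A id e _ cA se (vfield_anchor sb)).
  have s1 : @smooth_map R K (K2 K) (@inK1 R K) by exact: smooth_map_pairl.
  have s2 : @smooth_map R K (K2 K) (@inK2 R K) by exact: smooth_map_pairr.
  have sF : @smooth_map R N (K2 K) (fun=> (one, one)) by exact: smooth_map_cst.
  exact: (@Cinf_form2_along R (K2 K) Om fOm fKK N cN (fun=> (one, one)) sF _ _
    (vfield_along_tmap cKK s1 vwa) (vfield_along_tmap cKK s2 vwb)).
have Fa := sigma_along_rinv sa sb.
have Fb := sigma_along_rinv sb sa.
rewrite lie_pairingE//; last by case: vwb => tv _; exact: tv.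
rewrite E2 -/(abracket a b x) in E.
have tab : sigma (e x) (abracket a b x) (Z (e x)) = lambda sigma x (abracket a b x) (Y x).
  by rewrite lambdaE// ZY.
rewrite tab in E.
move: E Fa Fb.
set u1 := a x _; set u2 := b x _; set u3 := Y x _; set u4 := lambda _ _ (abracket _ _ _) _.
set u5 := sigma _ _ (b x); set u6 := sigma _ _ (a x).
set e0 := eta _ _ _ _; set o1 := Om12 _ _; set o2 := Om12 _ _; set o3 := Om12 _ _.
move=> E Fa Fb.
have -> : u4 = u1 + u5 - (u2 + u6) + e0 + u3 - o1 - o2.
  by rewrite -[e0]opprK E; ring.
rewrite Fa Fb; ring.
Qed.

End Cotangent_component.

Lemma lambda_abracket Y x : vfield Y -> lambda sigma x (abracket a b x) (Y x) =
  (asection_anchor a x (fun y => lambda sigma y (b y) (Y y))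
   - lambda sigma x (b x) (vbracket (asection_anchor a) Y x))
  - (asection_anchor b x (fun y => lambda sigma y (a y) (Y y))
     - Y x (fun y => lambda sigma y (a y) (asection_anchor b y))
     - lambda sigma x (a x) (vbracket (asection_anchor b) Y x))
  + eta x (asection_anchor a x) (asection_anchor b x) (Y x)
  + lie_pairing Om (lie_deriv Y (asection_Phi a) x) (asection_Phi b x).
Proof.
move=> vY; have tY : tangent x (Y x) by case: vY.
have tZ : tangent (e x) (tmap (M := N) (N := A) e (Y x)) by exact: tangent_tmap.
have [Z vZ Zx] := vfield_extension cA fA tZ.
exact: (lambda_abracket_ext vY vZ Zx).
Qed.

Lemma cbracket_abracket : cbracket Om eta (fun x => rho Phi sigma x (a x))
  (fun x => rho Phi sigma x (b x)) (fun x => rho Phi sigma x (abracket a b x)).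
Proof.
move=> x; split; first exact: anchor_abracket.
  by move=> Y vY; exact: lambda_abracket.
exact: lie_map_abracket.
Qed.

End Bracket_components.

End Isotropic_morphism.

(** * Bases of subspaces and lagrangian subspaces *)

Section Subspace_bases.
Variable R : realType.
Implicit Types U W : lmodType R.

Definition lincomb U n (b : 'I_n -> U) (c : 'rV[R]_n) : U := \sum_i c 0 i *: b i.

Lemma lincombP U n (b : 'I_n -> U) a c d : lincomb b (a *: c + d) = a *: lincomb b c + lincomb b d.
Proof.
rewrite /lincomb scaler_sumr -big_split; apply: eq_bigr => i _ /=.
by rewrite !mxE scalerDl scalerA.
Qed.

Lemma lincomb0 U n (b : 'I_n -> U) : lincomb b 0 = 0.
Proof. by rewrite /lincomb big1// => i _; rewrite mxE scale0r. Qed.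

Lemma lincomb_delta U n (b : 'I_n -> U) i : lincomb b (delta_mx 0 i) = b i.
Proof.
rewrite /lincomb (bigD1 i)//= mxE !eqxx scale1r big1 ?addr0// => j /negPf ji.
by rewrite mxE ji andbF scale0r.
Qed.

Lemma lincomb_mulmx U m n (b : 'I_n -> U) (c : 'rV[R]_m) (M : 'M[R]_(m, n)) :
  lincomb b (c *m M) = lincomb (fun i => lincomb b (row i M)) c.
Proof.
rewrite /lincomb; under [RHS]eq_bigr do rewrite scaler_sumr.
rewrite exchange_big; apply: eq_bigr => j _ /=; rewrite mxE scaler_suml.
by apply: eq_bigr => i _; rewrite mxE scalerA.
Qed.

Lemma eq_lincomb U n (b d : 'I_n -> U) c : (forall i, b i = d i) -> lincomb b c = lincomb d c.
Proof. by move=> bd; apply: eq_bigr => i _; rewrite bd. Qed.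

(** The fibres are subsets of function spaces that are in general infinite-dimensional. An explicit
    basis carries their linear algebra over to matrices, and its length plays the role of the
    dimension. *)
Definition set_basis U (V : set U) n (b : 'I_n -> U) : Prop :=
  [/\ forall c, V (lincomb b c), forall v, V v -> exists c, v = lincomb b c &
      forall c, lincomb b c = 0 -> c = 0].

Section Basis.
Variables (U : lmodType R) (V : set U) (n : nat) (b : 'I_n -> U) (bV : set_basis V b).

Lemma set_basis_in i : V (b i).
Proof. by case: bV => V1 _ _; rewrite -(lincomb_delta b). Qed.

Lemma set_basis0 : V 0.
Proof. by case: bV => V1 _ _; rewrite -(lincomb0 b). Qed.

Lemma set_basis_closed a u v : V u -> V v -> V (a *: u + v).
Proof.
case: bV => V1 V2 _ /V2[c ->] /V2[d ->]; by rewrite -lincombP.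
Qed.

Lemma set_basis_lin m (d : 'I_m -> U) c : (forall i, V (d i)) -> V (lincomb d c).
Proof.
move=> Vd; rewrite /lincomb; elim/big_rec: _ => [|i u _ Vu]; first exact: set_basis0.
exact: set_basis_closed.
Qed.

Lemma lincomb_inj c d : lincomb b c = lincomb b d -> c = d.
Proof.
move=> cd; apply/eqP; rewrite -subr_eq0; apply/eqP; case: bV => _ _; apply.
by rewrite addrC -scaleN1r lincombP cd scaleN1r addNr.
Qed.

Lemma lincomb_morph W (f : U -> W) m (d : 'I_m -> U) c :
  (forall a u v, V u -> V v -> f (a *: u + v) = a *: f u + f v) ->
  (forall i, V (d i)) -> f (lincomb d c) = lincomb (fun i => f (d i)) c.
Proof.
move=> fL Vd.
have f0 : f 0 = 0.
  have := fL (-1) 0 0 set_basis0 set_basis0.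
  by rewrite scaler0 addr0 scaleN1r addNr.
rewrite /lincomb; suff : forall r : seq 'I_m, V (\sum_(i <- r) c 0 i *: d i) /\
    f (\sum_(i <- r) c 0 i *: d i) = \sum_(i <- r) c 0 i *: f (d i).
  by move=> /(_ (index_enum _))[].
elim=> [|i r [IH1 IH2]]; first by rewrite !big_nil; split=> //; exact: set_basis0.
by rewrite !big_cons; split; [exact: set_basis_closed|rewrite fL// IH2].
Qed.

Lemma set_basis_matrix W (V' : set W) m (d : 'I_m -> W) (f : U -> W) :
  (forall c, f (lincomb b c) = lincomb (fun i => f (b i)) c) -> (forall v, V v -> V' (f v)) ->
  set_basis V' d -> exists M : 'M[R]_(n, m), forall c, f (lincomb b c) = lincomb d (c *m M).
Proof.
move=> fL fV [_ V'2 _].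
have /choice[M MP] i := V'2 _ (fV _ (set_basis_in i)).
exists (\matrix_i M i) => c; rewrite lincomb_mulmx fL; apply: eq_lincomb => i.
by rewrite rowK.
Qed.

Lemma free_set_basis (d : 'I_n -> U) : (forall i, V (d i)) ->
  (forall c, lincomb d c = 0 -> c = 0) -> set_basis V d.
Proof.
move=> Vd fd; have [_ V2 _] := bV.
have /choice[M MP] i := V2 _ (Vd i).
have ME c : lincomb d c = lincomb b (c *m \matrix_i M i).
  by rewrite lincomb_mulmx; apply: eq_lincomb => i; rewrite rowK.
have uM : \matrix_i M i \in unitmx.
  rewrite -row_free_unit; apply: inj_row_free => c cM; apply: fd.
  by rewrite ME cM lincomb0.
split=> // [c|v /V2[c ->]]; first exact: set_basis_lin.
by exists (c *m invmx (\matrix_i M i)); rewrite ME -mulmxA mulVmx// mulmx1.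
Qed.

(** Rank-nullity for the matrix of [f]. The inequality in the conclusion makes the truncated
    difference [n - m] a true one. *)
Lemma set_basis_kernel W (V' : set W) m (d : 'I_m -> W) (f : U -> W) :
  (forall a u v, V u -> V v -> f (a *: u + v) = a *: f u + f v) ->
  (forall v, V v -> V' (f v)) -> (forall w, V' w -> exists2 v, V v & f v = w) ->
  set_basis V' d ->
  (m <= n)%N /\ exists b' : 'I_(n - m) -> U, set_basis [set v | V v /\ f v = 0] b'.
Proof.
move=> fL fV fS dV; have [V1 V2 V3] := bV; have [V'1 V'2 V'3] := dV.
have fL' c : f (lincomb b c) = lincomb (fun i => f (b i)) c.
  by apply: lincomb_morph => // i; exact: set_basis_in.
have [M ME] := set_basis_matrix fL' fV dV.
have rM : \rank M = m.
  apply/eqP; rewrite -/(row_full M) -sub1mx; apply/row_subP => i; rewrite row1.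
  have V'd : V' (d i) by rewrite -(lincomb_delta d).
  have [v /V2[c ->]] := fS _ V'd; rewrite ME -[in RHS](lincomb_delta d) => E.
  apply/submxP; exists c; apply/eqP; rewrite -subr_eq0; apply/eqP/V'3.
  by rewrite addrC -scaleN1r lincombP E scaleN1r addNr.
have mn : (m <= n)%N by rewrite -rM rank_leq_row.
split=> //.
have rk : \rank (kermx M) = (n - m)%N by rewrite mxrank_ker rM.
pose B := castmx (rk, erefl n) (row_base (kermx M)).
have fB : row_free B by rewrite row_free_castmx row_base_free.
have eB : (B :=: kermx M)%MS.
  exact: eqmx_trans (eqmx_cast _ _) (eq_row_base _).
exists (fun i => lincomb b (row i B)); split=> [c|v [/V2[c ->]]|c].
- rewrite -lincomb_mulmx; split=> //; rewrite ME -mulmxA.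
  have /sub_kermxP -> : (B <= kermx M)%MS by rewrite eB.
  by rewrite mulmx0 lincomb0.
- rewrite ME => /V'3 /sub_kermxP; rewrite -eB => /submxP[D ->].
  by exists D; rewrite lincomb_mulmx.
- rewrite -lincomb_mulmx => /V3 /eqP; rewrite mulmx_free_eq0// => /eqP; exact.
Qed.

Lemma set_basis_dual : exists d, @set_basis (U -> R) (dual V) n d.
Proof.
have [V1 V2 V3] := bV.
have /choice[co coP] v : exists c, V v -> v = lincomb b c.
  by have [/V2[c ->]|nv] := pselect (V v); [exists c|exists 0].
have coE c : co (lincomb b c) = c by apply: lincomb_inj; rewrite -coP.
pose d i := restr V (fun u => co u 0 i).
have dE i c : d i (lincomb b c) = c 0 i by rewrite /d /restr /patch mem_set// coE.
have dout i u : ~ V u -> d i u = 0 by move=> nu; rewrite /d /restr /patch memNset.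
have linE c u : lincomb d c u = \sum_i c 0 i * d i u by rewrite /lincomb fct_sumE.
exists d; split=> [c|xi [xiL xi0]|c c0].
- split=> [a u v /V2[x ->] /V2[y ->]|u nu]; last first.
    by rewrite linE big1// => i _; rewrite dout// mulr0.
  rewrite -lincombP !linE mulr_sumr -big_split; apply: eq_bigr => i _ /=.
  by rewrite !dE !mxE; ring.
- exists (\row_i xi (b i)); apply/funext => u; rewrite linE.
  have [/V2[c ->]|nu] := pselect (V u); last first.
    by rewrite xi0// big1// => i _; rewrite dout// mulr0.
  rewrite (@lincomb_morph R^o xi)//; last exact: set_basis_in.
  by apply: eq_bigr => i _; rewrite mxE dE mulrC.
- apply/rowP => i; rewrite mxE; have := congr1 (fun f => f (b i)) c0.
  rewrite linE (bigD1 i)//= big1 ?addr0.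
    by rewrite -{1}(lincomb_delta b) dE mxE !eqxx mulr1.
  by move=> j /negPf ji; rewrite -(lincomb_delta b) dE mxE ji mulr0.
Qed.

Lemma set_basis_prod W (V' : set W) m (d : 'I_m -> W) : set_basis V' d ->
  exists bd, @set_basis (U * W)%type (V `*` V') (n + m) bd.
Proof.
move=> [V'1 V'2 V'3]; have [V1 V2 V3] := bV.
pose bd (k : 'I_(n + m)) : (U * W)%type := match fintype.split k with
  inl i => (b i, 0) | inr j => (0, d j) end.
have E c c' : lincomb bd (row_mx c c') = (lincomb b c, lincomb d c').
  rewrite /lincomb big_split_ord /=.
  have -> : \sum_i row_mx c c' 0 (lshift m i) *: bd (lshift m i) = (lincomb b c, 0).
    rewrite /lincomb; under eq_bigr do rewrite row_mxEl /bd (unsplitK (inl _)).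
    apply: (big_ind2 (fun x y => x = (y, 0))) => [//|? ? ? ? -> ->|i _].
      by rewrite -[LHS]/(_, 0 + 0) addr0.
    by rewrite -[LHS]/(_, _ *: 0) scaler0.
  have -> : \sum_j row_mx c c' 0 (rshift n j) *: bd (rshift n j) = (0, lincomb d c').
    rewrite /lincomb; under eq_bigr do rewrite row_mxEr /bd (unsplitK (inr _)).
    apply: (big_ind2 (fun x y => x = (0, y))) => [//|? ? ? ? -> ->|i _].
      by rewrite -[LHS]/(0 + 0, _) addr0.
    by rewrite -[LHS]/(_ *: 0, _) scaler0.
  by rewrite -[LHS]/(lincomb b c + 0, 0 + lincomb d c') addr0 add0r.
exists bd; split=> [c|[u w] [/= /V2[c ->] /V'2[c' ->]]|c].
- by rewrite -(hsubmxK c) E; split; [exact: V1|exact: V'1].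
- by exists (row_mx c c'); rewrite E.
- rewrite -(hsubmxK c) E => -[/V3 -> /V'3 ->]; exact: row_mx0.
Qed.

End Basis.

Section Lagrangian.
Variables (U W : lmodType R) (A : set U) (r : nat) (a : 'I_r -> U) (aA : set_basis A a).
Variables (C : set W) (N : nat) (b : 'I_N -> W) (bC : set_basis C b).
Variable P : W -> W -> R.
Hypothesis PL : forall x e e' w, C e -> C e' -> C w -> P (x *: e + e') w = x * P e w + P e' w.
Hypothesis Psym : forall e w, C e -> C w -> P e w = P w e.
Hypothesis Pnondeg : forall e, C e -> (forall w, C w -> P e w = 0) -> e = 0.
Variable f : U -> W.
Hypothesis fL : forall x u v, A u -> A v -> f (x *: u + v) = x *: f u + f v.
Hypothesis fC : forall u, A u -> C (f u).
Hypothesis f_isotropic : forall u v, A u -> A v -> P (f u) (f v) = 0.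
Hypothesis f_inj : forall u, A u -> f u = 0 -> u = 0.

Let G : 'M[R]_N := \matrix_(i, j) P (b i) (b j).

Let PE c d : P (lincomb b c) (lincomb b d) = (c *m (G *m d^T)) 0 0.
Proof.
have [C1 _ _] := bC; have Cb := set_basis_in bC.
rewrite (lincomb_morph bC (f := P^~ (lincomb b d) : W -> R^o))//; last by move=> *; exact: PL.
rewrite mxE; apply: eq_bigr => i _; congr (_ * _).
rewrite Psym// (lincomb_morph bC (f := P^~ (b i) : W -> R^o))//; last by move=> *; exact: PL.
by rewrite mxE; apply: eq_bigr => j _; rewrite !mxE Psym// mulrC.
Qed.

Let G_unit : G \in unitmx.
Proof.
have [C1 C2 C3] := bC.
rewrite -row_free_unit; apply: inj_row_free => c cG; apply: C3; apply: Pnondeg => //.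
by move=> w /C2[d ->]; rewrite PE mulmxA cG mul0mx mxE.
Qed.

Let f_matrix : exists M : 'M[R]_(r, N),
  (forall c, f (lincomb a c) = lincomb b (c *m M)) /\ row_free M.
Proof.
have [A1 A2 A3] := aA.
have fL' c : f (lincomb a c) = lincomb (fun i => f (a i)) c.
  by apply: (lincomb_morph aA (f := f)) => // i; exact: (set_basis_in aA).
have [M ME] := set_basis_matrix aA fL' fC bC.
exists M; split=> //; apply: inj_row_free => c cM; apply: A3; apply: f_inj => //.
by rewrite ME cM lincomb0.
Qed.

(** In coordinates the orthogonal of the image is the kernel of G M^T, of dimension N - r because
    the Gram matrix G is invertible. By isotropy it contains the image, of dimension r. *)
Lemma lagrangian_dim :
  (f @` A = [set e | C e /\ forall e', (f @` A) e' -> P e e' = 0]) <-> N = (r + r)%N.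
Proof.
have [A1 A2 A3] := aA; have [C1 C2 C3] := bC.
have [M [ME fM]] := f_matrix.
pose Z := G *m M^T.
have PZ c d : P (lincomb b c) (f (lincomb a d)) = (c *m Z *m d^T) 0 0.
  by rewrite ME PE trmx_mul !mulmxA.
have perpE c : (forall e', (f @` A) e' -> P (lincomb b c) e' = 0) <-> (c <= kermx Z)%MS.
  split=> [h|/sub_kermxP cZ e' [u /A2[d ->] <-]]; last by rewrite PZ cZ mul0mx mxE.
  apply/sub_kermxP/rowP => i; have := h (f (lincomb a (delta_mx 0 i))) (imageP _ (A1 _)).
  by rewrite PZ trmx_delta -colE !mxE.
have MZ : (M <= kermx Z)%MS.
  apply/row_subP => i; apply/perpE => e' [u Au <-].
  have -> : row i M = delta_mx 0 i *m M by rewrite -rowE.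
  by rewrite -ME f_isotropic.
have rZ : \rank Z = r.
  rewrite -mxrank_tr trmx_mul trmxK mxrankMfree; first exact/eqP.
  by rewrite row_free_unit unitmx_tr.
have rN : (r <= N)%N by rewrite -(eqP fM) rank_leq_col.
have -> : (N = (r + r)%N) <-> (kermx Z <= M)%MS.
  rewrite -(mxrank_leqif_sup MZ) (eqP fM) mxrank_ker rZ.
  split=> [->|/eqP E]; first by rewrite addnK.
  by rewrite {2}E addnC subnK.
split=> [LE|ZM].
  apply/rV_subP => c /perpE cZ.
  have : [set e | C e /\ forall e', (f @` A) e' -> P e e' = 0] (lincomb b c) by split.
  rewrite -LE => -[u /A2[d ->]]; rewrite ME => /(lincomb_inj bC) <-.
  exact: submxMl.
apply/seteqP; split=> [_ [u Au <-]|e [/C2[c ->] /perpE cZ]].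
  by split=> [|_ [v Av <-]]; [exact: fC|exact: f_isotropic].
have /submxP[d ->] := submx_trans cZ ZM.
by exists (lincomb a d); rewrite ?ME.
Qed.

(** Since [f] is injective and [P] nondegenerate, G M^T has rank [r] and a left inverse. This
    provides surjectivity on cokernels in the quasi-isomorphism. *)
Lemma adjoint_surjective (z : U -> R) :
  (forall x u v, A u -> A v -> z (x *: u + v) = x * z u + z v) ->
  exists2 e, C e & forall u, A u -> P e (f u) = z u.
Proof.
move=> zL; have [A1 A2 A3] := aA; have [C1 C2 C3] := bC.
have [M [ME fM]] := f_matrix.
have /row_fullP[B BZ] : row_full (G *m M^T).
  rewrite /row_full -mxrank_tr trmx_mul trmxK mxrankMfree//.
  by rewrite row_free_unit unitmx_tr.
pose zr : 'rV[R]_r := \row_i z (a i).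
exists (lincomb b (zr *m B)) => // u /A2[c ->].
rewrite ME PE trmx_mul -!mulmxA (mulmxA G) (mulmxA B) BZ mul1mx.
rewrite (lincomb_morph aA (f := z : U -> R^o))//; last exact: set_basis_in.
by rewrite mxE; apply: eq_bigr => i _; rewrite !mxE mulrC.
Qed.

End Lagrangian.

End Subspace_bases.

(** * Smoothness of determinants *)

Section Det_smooth.
Variables (R : realType) (M : dspace R) (cM : closed_dspace M).

Lemma Cinf_det n (B : M -> 'M[R]_n) : (forall i j, Cinf (fun q => B q i j)) ->
  Cinf (fun q => \det (B q)).
Proof.
move=> CB; apply: Cinf_sum => // sg; apply: CinfZ => //; exact: Cinf_prod.
Qed.

Lemma Cinf_adj n (B : M -> 'M[R]_n) i j : (forall i j, Cinf (fun q => B q i j)) ->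
  Cinf (fun q => (\adj (B q)) i j).
Proof.
move=> CB; under eq_fun do rewrite mxE.
apply: CinfZ => //; apply: Cinf_det => k l.
by under eq_fun do rewrite !mxE; exact: CB.
Qed.

End Det_smooth.

(** * Lagrangian structures at a point *)

Lemma tangent_set_basis (R : realType) (M : manifold R) (p : M) :
  exists b : 'I_(mdim M) -> vect M, set_basis (tangent p) b.
Proof.
have [b [x [E [[Cb b0 Cx vE frE] _]]]] := manifold_frame p.
have [dE sE] := frE _ b0; have tE i : tangent p (E i p) by case: (vE i).
exists (fun i => E i p); split=> [c|v tv|c c0].
- by apply: tangent_sum => i; exact: tangentZ.
- exists (\row_i v (fun q => x q 0 i)); rewrite {1}(sE _ tv).
  by apply: eq_bigr => i _; rewrite mxE.
- apply/rowP => j; rewrite mxE.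
  have := congr1 (fun v : vect M => v (fun q => x q 0 j)) c0.
  rewrite /lincomb vect_sumE (bigD1 j)//= vect_scaleE dE eqxx mulr1 big1 ?addr0//.
  by move=> i /negPf ij; rewrite vect_scaleE dE eq_sym ij mulr0.
Qed.

Section Lagrangian_structure.
Variables (R : realType) (K : lie_group R).
Variables (Om : form2 (K2 K)) (Th : form3 K).
Variable H : lie_groupoid R.
Variable Phi : arr H -> K.
Variables (sigma : form2 (arr H)) (eta : form3 (obj H)).
Hypothesis K_symp : shifted_symplectic Om Th.
Hypothesis H_isot : isotropic_morphism Om Th Phi sigma eta.

Local Notation A := (arr H).
Local Notation N := (obj H).
Local Notation s := (@src R H).
Local Notation t := (@tgt R H).
Local Notation e := (@eps R H).
Local Notation C2 := (composable H).
Local Notation one := (gone K).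
Local Notation rho := (rho Phi sigma).
Local Notation L x := (rho x @` lie_algebroid x).

Let cA : closed_dspace A. Proof. by []. Qed.
Let cN : closed_dspace N. Proof. by []. Qed.
Let cK : closed_dspace K. Proof. by []. Qed.
Let fA : framed A. Proof. exact: manifold_framed. Qed.
Let se : @smooth_map R N A e. Proof. exact: eps_smooth. Qed.
Let st : @smooth_map R A N t. Proof. exact: tgt_smooth. Qed.
Let ss : @smooth_map R A N s. Proof. exact: src_smooth. Qed.
Let sPhi : @smooth_map R A K Phi. Proof. by case: H_isot => -[]. Qed.
Let fs : is_form2 sigma. Proof. by case: H_isot => _ []. Qed.
Let fOm : is_form2 Om. Proof. by case: K_symp => -[]. Qed.
Let fTh : is_form3 Th. Proof. by case: K_symp => -[]. Qed.

Lemma lie_algebroid_closed (x : N) a u v :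
  lie_algebroid x u -> lie_algebroid x v -> lie_algebroid x (a *: u + v).
Proof.
move=> [tu su] [tv sv]; split; first by apply: tangentD => //; exact: tangentZ.
by rewrite tmapD tmapZ su sv scaler0 addr0.
Qed.

Lemma lie_algebroid0 (x : N) : lie_algebroid x 0.
Proof. by split; [exact: tangent0|exact: tmap0]. Qed.

Lemma lie_algebroid_set_basis (x : N) : (mdim N <= mdim A)%N /\
  exists b : 'I_(mdim A - mdim N) -> vect A, set_basis (lie_algebroid x) b.
Proof.
have [b bT] := tangent_set_basis (e x); have [d dT] := tangent_set_basis x.
apply: (set_basis_kernel bT (f := tmap (M := A) (N := N) s) _ _ _ dT) => [a u v _ _|v tv|X].
- by rewrite tmapD tmapZ.
- by rewrite -(src_eps x); exact: tangent_tmap.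
- by rewrite -{1}(src_eps x) => /src_submersion[u tu uX]; exists u.
Qed.

Lemma cfibreE (x : N) : @cfibre R N K x = (tangent x `*` dual (tangent x)) `*` @lie_alg R K.
Proof. by apply/seteqP; split=> [[[X al] w] []|[[X al] w] [[]]]. Qed.

Lemma cfibre_set_basis (x : N) :
  exists b : 'I_(mdim N + mdim N + mdim K) -> cvect N K, set_basis (cfibre x) b.
Proof.
have [b bT] := tangent_set_basis x; have [d dT] := set_basis_dual bT.
have [w wK] := tangent_set_basis one; have [bd bdP] := set_basis_prod bT dT.
have [bdw bdwP] := set_basis_prod bdP wK.
by exists bdw; rewrite cfibreE.
Qed.

Lemma Om12_linl a u u' v : lie_alg u -> lie_alg u' -> lie_alg v ->
  Om12 Om (a *: u + u') v = a * Om12 Om u v + Om12 Om u' v.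
Proof.
move=> tu tu' tv; rewrite /Om12 tmapD tmapZ form2_linl//; try exact: tangent_inK1.
exact: tangent_inK2.
Qed.

Lemma Om12_linr a u v v' : lie_alg u -> lie_alg v -> lie_alg v' ->
  Om12 Om u (a *: v + v') = a * Om12 Om u v + Om12 Om u v'.
Proof.
move=> tu tv tv'; rewrite /Om12 tmapD tmapZ.
have T1 := tangent_inK1 tu; have T2 := tangent_inK2 tv; have T2' := tangent_inK2 tv'.
by rewrite form2_Dr ?form2_Zr//; exact: tangentZ.
Qed.

Lemma Om12_0l v : lie_alg v -> Om12 Om 0 v = 0.
Proof. by move=> tv; rewrite /Om12 tmap0 form2_0l//; exact: tangent_inK2. Qed.

Lemma lie_pairing_sym u v : lie_alg u -> lie_alg v -> lie_pairing Om u v = lie_pairing Om v u.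
Proof. by move=> tu tv; rewrite !lie_pairingE//; ring. Qed.

Lemma lie_pairing_linl a u u' v : lie_alg u -> lie_alg u' -> lie_alg v ->
  lie_pairing Om (a *: u + u') v = a * lie_pairing Om u v + lie_pairing Om u' v.
Proof.
move=> tu tu' tv; have tuu : lie_alg (a *: u + u').
  by apply: tangentD => //; exact: tangentZ.
by rewrite !lie_pairingE// Om12_linl// Om12_linr//; ring.
Qed.

Lemma lie_pairing0r u : lie_alg u -> lie_pairing Om u 0 = 0.
Proof.
move=> tu; have t0 : lie_alg (0 : vect K) by exact: tangent0.
rewrite lie_pairing_sym//; have := lie_pairing_linl (-1) t0 t0 tu.
by rewrite scaler0 addr0 mulN1r addNr.
Qed.

Lemma cpairing_lin (x : N) a (e1 e2 w : cvect N K) : cfibre x e1 -> cfibre x e2 -> cfibre x w ->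
  cpairing Om (a *: e1 + e2) w = a * cpairing Om e1 w + cpairing Om e2 w.
Proof.
move=> [X1 al1 w1] [X2 al2 w2] [X3 [al3 _] w3]; rewrite /cpairing /=.
rewrite al3// lie_pairing_linl//; rewrite -[_ w.1.1]/(a * e1.1.2 w.1.1 + e2.1.2 w.1.1).
ring.
Qed.

Lemma cpairing_sym (x : N) (e1 e2 : cvect N K) : cfibre x e1 -> cfibre x e2 ->
  cpairing Om e1 e2 = cpairing Om e2 e1.
Proof.
move=> [_ _ w1] [_ _ w2]; rewrite /cpairing lie_pairing_sym//.
by rewrite [e1.1.2 _ + _]addrC.
Qed.

Lemma restr_in (U : Type) (V : set U) (xi : U -> R) u : V u -> restr V xi u = xi u.
Proof. by move=> Vu; rewrite /restr /patch mem_set. Qed.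

Lemma dual0 (U : lmodType R) (V : set U) : dual V 0.
Proof. by split=> // a u v _ _; rewrite -[RHS]/(a * 0 + 0) mulr0 addr0. Qed.

Lemma dual_restr (U : lmodType R) (V : set U) (xi : U -> R) :
  (forall a u v, V u -> V v -> V (a *: u + v)) ->
  (forall a u v, V u -> V v -> xi (a *: u + v) = a * xi u + xi v) -> dual V (restr V xi).
Proof.
move=> VL xiL; split=> [a u v Vu Vv|u Vu]; rewrite /restr /patch; last by rewrite memNset.
by rewrite !mem_set//; [exact: xiL|exact: VL].
Qed.

Lemma tangent_lin (M : dspace R) (p : M) a u v :
  tangent p u -> tangent p v -> tangent p (a *: u + v : vect M).
Proof. by move=> tu tv; apply: tangentD => //; exact: tangentZ. Qed.

(** The components are detected one at a time: X by the covectors v |-> v f, al by tangent vectors,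
    w by the nondegenerate pairing of the Lie algebra. *)
Lemma cpairing_nondegenerate (x : N) (e1 : cvect N K) : cfibre x e1 ->
  (forall w, cfibre x w -> cpairing Om e1 w = 0) -> e1 = 0.
Proof.
case: e1 => [[X al] w] [/= tX dal tw] e0.
have t0 : tangent x (0 : vect N) by exact: tangent0.
have w0 : lie_alg (0 : vect K) by exact: tangent0.
have d0 : dual (tangent x) 0 by exact: dual0.
have nondeg u : lie_alg u -> (forall v, lie_alg v -> lie_pairing Om u v = 0) -> u = 0.
  by case: K_symp => _ [_ _ _ _]; exact.
have X0 : X = 0.
  apply: (vect_eq tX t0) => f Cf.
  have dxi : dual (tangent x) (restr (tangent x) (fun v : vect N => v f)).
    by apply: dual_restr => // a u v; exact: tangent_lin.
  have := e0 (0, restr (tangent x) (fun v : vect N => v f), 0); rewrite /cpairing /=.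
  move=> /(_ (And3 t0 dxi w0)); rewrite lie_pairing0r// restr_in//.
  have := dal.1 (-1) _ _ t0 t0; rewrite scaler0 addr0 mulN1r addNr => ->.
  by rewrite add0r addr0.
have al0 : al = 0.
  apply/funext => Y; have [tY|/dal.2//] := pselect (tangent x Y).
  have := e0 (Y, 0, 0); rewrite /cpairing /= => /(_ (And3 tY d0 w0)).
  by rewrite lie_pairing0r// !addr0.
have ww : w = 0.
  apply: nondeg => // v tv; have := e0 (0, 0, v); rewrite /cpairing /= => /(_ (And3 t0 d0 tv)).
  by rewrite al0 !add0r.
by rewrite X0 al0 ww.
Qed.

Lemma dual_lambda (x : N) u : lie_algebroid x u -> dual (tangent x) (lambda sigma x u).
Proof.
move=> [tu _]; apply: dual_restr => [a X Y|a X Y tX tY]; first exact: tangent_lin.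
have tE Z : tangent x Z -> tangent (e x) (tmap (M := N) (N := A) e Z).
  by move=> tZ; exact: tangent_tmap.
by rewrite tmapD tmapZ form2_Dr ?form2_Zr//; try exact: tE; apply: tangentZ; exact: tE.
Qed.

Lemma lambda_lin (x : N) a u v : lie_algebroid x u -> lie_algebroid x v ->
  lambda sigma x (a *: u + v) = a *: lambda sigma x u + lambda sigma x v.
Proof.
move=> [tu _] [tv _]; apply/funext => X.
rewrite -[RHS]/(a * lambda sigma x u X + lambda sigma x v X).
have [tX|tX] := pselect (tangent x X); last by rewrite !lambda_out// mulr0 addr0.
rewrite !lambdaE// form2_linl//; exact: tangent_tmap.
Qed.

Lemma rho_lin (x : N) a u v : lie_algebroid x u -> lie_algebroid x v ->
  rho x (a *: u + v) = a *: rho x u + rho x v.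
Proof.
move=> au av; rewrite /Defs.rho lambda_lin// /anchor /lie_map !tmapD !tmapZ.
by [].
Qed.

Lemma rho0 (x : N) : rho x 0 = 0.
Proof.
have := rho_lin (-1) (lie_algebroid0 x) (lie_algebroid0 x).
by rewrite scaler0 addr0 scaleN1r addNr.
Qed.

Lemma rho_fibre (x : N) u : lie_algebroid x u -> cfibre x (rho x u).
Proof.
move=> au; have [tu _] := au; split; first exact: anchor_tangent.
  exact: dual_lambda.
exact: (lie_alg_lie_map H_isot tu).
Qed.

Lemma cpairing_rho (x : N) (e1 : cvect N K) u :
  cpairing Om e1 (rho x u) =
  e1.1.2 (anchor u) + lambda sigma x u e1.1.1 + lie_pairing Om e1.2 (lie_map Phi u).
Proof. by []. Qed.

Lemma rho_isotropic_cpairing (x : N) u v : lie_algebroid x u -> lie_algebroid x v ->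
  cpairing Om (rho x u) (rho x v) = 0.
Proof. by move=> au av; rewrite cpairing_rho; exact: (rho_isotropic fOm H_isot). Qed.

Definition rho_injective (x : N) : Prop :=
  forall u, lie_algebroid x u -> rho x u = 0 -> u = 0.

Definition rho_lagrangian (x : N) : Prop :=
  L x = [set e1 | cfibre x e1 /\ forall e2, L x e2 -> cpairing Om e1 e2 = 0].

Lemma rho_set_inj (x : N) : set_inj (lie_algebroid x) (rho x) <-> rho_injective x.
Proof.
split=> [ri u au u0|ri u v /set_mem au /set_mem av uv].
  apply: ri; rewrite ?inE//; first exact: lie_algebroid0.
  by rewrite u0 rho0.
apply/eqP; rewrite -subr_eq0 addrC -scaleN1r; apply/eqP/ri; first exact: lie_algebroid_closed.
by rewrite rho_lin// uv scaleN1r addNr.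
Qed.

Lemma rho_lagrangian_dim (x : N) : rho_injective x ->
  (rho_lagrangian x <->
   mdim N + mdim N + mdim K = (mdim A - mdim N) + (mdim A - mdim N))%N.
Proof.
move=> ri; have [_ [a aA]] := lie_algebroid_set_basis x; have [b bC] := cfibre_set_basis x.
apply: (lagrangian_dim aA bC (P := cpairing Om)) => //.
- exact: cpairing_lin.
- exact: cpairing_sym.
- exact: cpairing_nondegenerate.
- exact: rho_lin.
- exact: rho_fibre.
- exact: rho_isotropic_cpairing.
Qed.

Local Notation dmap := (fun u => (anchor u, lie_map Phi u)).
Local Notation emap x := (fun al => restr (lie_algebroid x) (fun u => al (anchor u))).
Local Notation f1map x := (fun Xw : vect N * vect K => restr (lie_algebroid x)
  (fun u => - lambda sigma x u Xw.1 - lie_pairing Om Xw.2 (lie_map Phi u))).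
Local Notation quasi_iso x := (quasi_isomorphism (lie_algebroid x)
  (tangent x `*` @lie_alg R K) (dual (tangent x)) (dual (lie_algebroid x))
  dmap (emap x) (lambda sigma x) (f1map x)).

Lemma eq_restr (U : Type) (V : set U) (xi zeta : U -> R) :
  (forall u, V u -> xi u = zeta u) -> restr V xi = restr V zeta.
Proof.
move=> E; apply/funext => u; rewrite /restr /patch.
by case: ifP => // /set_mem /E.
Qed.

Lemma lambda_anchor (x : N) u v : lie_algebroid x u -> lie_algebroid x v ->
  lambda sigma x u (anchor v) =
  - lambda sigma x v (anchor u) - lie_pairing Om (lie_map Phi u) (lie_map Phi v).
Proof. by move=> au av; have := rho_isotropic fOm H_isot au av; lra. Qed.

(** Orthogonality of (X, al, w) to the image says that the chain map sends (X, w) to the image of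
    al. Injectivity on cokernels then gives u with anchor X and Lie Phi equal to w. The defect al -
    lambda(u) lies in the kernel of the second differential, and surjectivity on kernels corrects u
    by some v without changing X and w. *)
Lemma quasi_iso_rho (x : N) : quasi_iso x -> rho_injective x /\ rho_lagrangian x.
Proof.
move=> [_ _ [_ finj fsurj] fH1 _].
have [a0 r0] := (lie_algebroid0 x, rho0 x); split=> [u au u0|].
  have u0' : lambda sigma x u = lambda sigma x 0.
    by move: u0; rewrite -r0 => -[].
  apply: finj; rewrite ?inE//; split=> //.
    by rewrite /preimage /=; case: u0 => -> _ ->.
  by rewrite /preimage /=; case: r0 => -> _ ->.
apply/seteqP; split=> [_ [u au <-]|[[X al] w] [[/= tX dal tw] Lperp]].
  split; first exact: rho_fibre.
  by move=> _ [v av <-]; exact: rho_isotropic_cpairing.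
have perp v : lie_algebroid x v -> al (anchor v) =
    - lambda sigma x v X - lie_pairing Om w (lie_map Phi v).
  move=> av; have := Lperp _ (imageP _ av); rewrite cpairing_rho /=; lra.
have [|u au [Xu wu]] := fH1 (X, w) (conj tX tw).
  by exists al => //=; apply: eq_restr => v /perp.
have dlu := dual_lambda au.
pose be : vect N -> R := al - lambda sigma x u.
have dbe : dual (tangent x) be.
  split=> [a Y Z tY tZ|Y tY]; rewrite /be -![(al - _) _]/(al _ - lambda sigma x u _).
    by rewrite dal.1// dlu.1//; ring.
  by rewrite dal.2// dlu.2// subrr.
have [|v [av [a0' p0]] vbe] := fsurj be.
  split=> //; rewrite /preimage /=; apply/funext => v.
  have [av|av] := pselect (lie_algebroid x v); last by rewrite /restr /patch memNset.
  rewrite restr_in// /be -[(al - _) _]/(al _ - lambda sigma x u _) perp// Xu wu.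
  by rewrite (lambda_anchor au av) subrr.
exists (1 *: u + v); first exact: lie_algebroid_closed.
rewrite rho_lin// scale1r /Defs.rho a0' p0 vbe -Xu -wu.
by congr (_, _, _); rewrite ?addr0// /be addrC subrK.
Qed.

(** Commutation with the differentials is isotropy. Surjectivity on kernels and injectivity on
    cokernels both state that a vector orthogonal to the image belongs to it, in the first case a
    vector (0, al, 0). *)
Lemma rho_quasi_iso (x : N) : rho_injective x -> rho_lagrangian x -> quasi_iso x.
Proof.
move=> ri rl; have clA a u v := @lie_algebroid_closed x a u v.
have tanc u : lie_algebroid x u -> tangent x (anchor u) by case=> tu _; exact: anchor_tangent.
have tlie u : lie_algebroid x u -> lie_alg (lie_map Phi u).
  by case=> tu _; exact: (lie_alg_lie_map H_isot tu).
have inL X al w : tangent x X -> dual (tangent x) al -> lie_alg w ->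
    (forall v, lie_algebroid x v -> al (anchor v) =
      - lambda sigma x v X - lie_pairing Om w (lie_map Phi v)) ->
    exists2 u, lie_algebroid x u & rho x u = (X, al, w).
  move=> tX dal tw perp.
  suff : L x (X, al, w) by case=> u; exists u.
  rewrite rl; split; first by split.
  by move=> _ [v av <-]; rewrite cpairing_rho /= perp//; ring.
have t0 : tangent x (0 : vect N) by exact: tangent0.
have w0 : lie_alg (0 : vect K) by exact: tangent0.
have lam0 v : lie_algebroid x v -> lambda sigma x v 0 = 0.
  move=> av; have := (dual_lambda av).1 (-1) _ _ t0 t0.
  by rewrite scaler0 addr0 mulN1r addNr.
have pair0 v : lie_algebroid x v -> lie_pairing Om 0 (lie_map Phi v) = 0.
  by move=> av; rewrite lie_pairing_sym ?lie_pairing0r//; exact: tlie.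
have comm u : lie_algebroid x u -> emap x (lambda sigma x u) = f1map x (dmap u).
  by move=> au; apply: eq_restr => v av /=; exact: lambda_anchor.
split=> //.
- split=> [u au|al dal|u au|[X w] [/= tX tw]].
  + by split; [exact: tanc|exact: tlie].
  + apply: dual_restr => // a u v au av.
    by rewrite /anchor tmapD tmapZ dal.1//; exact: tanc.
  + exact: dual_lambda.
  + apply: dual_restr => // a u v au av.
    rewrite lambda_lin// -[(_ + _) X]/(a * lambda sigma x u X + lambda sigma x v X).
    have [tu tv] := (tlie _ au, tlie _ av); rewrite /lie_map tmapD tmapZ.
    rewrite !(lie_pairing_sym tw)//; last by apply: tangent_lin; [exact: tu|exact: tv].
    by rewrite lie_pairing_linl//; ring.
- split=> [u [au du]|u v /set_mem[au du] /set_mem[av dv] uv|al [dal eal]].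
  + split; first exact: dual_lambda.
    rewrite /preimage /= comm//; case: du => a0 p0; apply/funext => v /=.
    have [av|av] := pselect (lie_algebroid x v); last by rewrite /restr /patch memNset.
    by rewrite /= restr_in// a0 p0 lam0// pair0// oppr0 addr0.
  + have /rho_set_inj := ri; apply; rewrite ?inE//.
    move: du dv; rewrite /preimage /= => -[a0 p0] [a0' p0'].
    by rewrite /Defs.rho uv a0 p0 a0' p0'.
  + have [v av|u au [au0 lu pu0]] := inL 0 al 0 t0 dal w0.
      have := congr1 (fun f => f v) eal; rewrite /= restr_in// => ->.
      by rewrite lam0// pair0// oppr0 addr0.
    by exists u => //; split=> //; rewrite /preimage /= au0 pu0.
- move=> [X w] [/= tX tw] [al dal E]; have [v av|u au [Xu _ wu]] := inL X al w tX dal tw.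
    by have := congr1 (fun f => f v) E; rewrite /= !restr_in//= => ->.
  by exists u => //; rewrite Xu wu.
- move=> z dz; have [_ [a aA]] := lie_algebroid_set_basis x; have [b bC] := cfibre_set_basis x.
  (* The chain map carries minus signs while [cpairing] does not, so the functional is negated here
     and the covector below. *)
  have [|[[X al] w] [/= tX dal tw] E] := adjoint_surjective aA bC (P := cpairing Om)
    (@cpairing_lin x) (@cpairing_sym x) (@cpairing_nondegenerate x) (@rho_lin x)
    (@rho_fibre x) ri (z := fun u => - z u).
    by move=> c u v au av; rewrite dz.1//; ring.
  exists (X, w), (- al); split=> //.
    split=> [c Y Z tY tZ|Y tY]; rewrite -![(- al) _]/(- al _); first by rewrite dal.1//; ring.
    by rewrite dal.2// oppr0.
  apply/funext => u; rewrite -[RHS]/(f1map x (X, w) u + emap x (- al) u) /=.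
  have [au|au] := pselect (lie_algebroid x u); last first.
    by rewrite dz.2// /restr /patch memNset// addr0.
  rewrite !restr_in//= -[(- al) _]/(- al _); have := E _ au; rewrite cpairing_rho /=; lra.
Qed.

(** * The condition on kernels *)

Definition ker_at (h : A) : set (vect A) :=
  ker_form2 sigma h `&` ker_tmap Phi h `&` ker_tmap s h `&` ker_tmap t h.

Lemma ker_at_eps (x : N) v : ker_at (e x) v <-> lie_algebroid x v /\ rho x v = 0.
Proof.
split=> [[[[[tv sv] [_ Pv]] [_ srv]] [_ tgv]]|[[tv srv] [av lv pv]]].
  split; first by split.
  have l0 : lambda sigma x v = 0.
    apply/funext => X; have [tX|tX] := pselect (tangent x X); last by rewrite lambda_out.
    by rewrite lambdaE// sv//; exact: tangent_tmap.
  by rewrite /Defs.rho /anchor tgv l0 /lie_map Pv.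
split; [split; [split|]|]; split=> // w tw.
have lw : lie_alg (lie_map Phi w) by exact: (lie_alg_lie_map H_isot tw).
by rewrite (sigma_unit H_isot)// lv pv Om12_0l// subr0.
Qed.

Lemma ker_at_eps0 (x : N) : ker_at (e x) = [set 0] <-> rho_injective x.
Proof.
split=> [E u au u0|ri].
  by have /ker_at_eps : lie_algebroid x u /\ rho x u = 0 by []; rewrite E.
apply/seteqP; split=> [v /ker_at_eps[av]|_ ->]; first exact: ri.
by apply/ker_at_eps; split; [exact: lie_algebroid0|exact: rho0].
Qed.

(** Only [lambda] needs an argument. A tangent vector at t h lifts through T tgt to some w at [h],
    and w times its image under inversion is T eps of that vector. Multiplicativity then leaves
    sigma(v, w) and an [Om] term in Lie Phi v, both zero. *)
Lemma ker_at_unit (h : A) v : ker_at h v -> ker_at (e (t h)) (rtrans h (cinv h) v).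
Proof.
move=> [[[[tv sv] [_ Pv]] [_ srv]] [_ tgv]].
have kl g : s g = t (cinv g) by rewrite tgt_cinv.
have vv : vertical h v by split.
have [tr srr] := vertical_rtrans (kl h) vv; rewrite cmulVr in tr.
apply/ker_at_eps; split; first by split.
have a0 : anchor (rtrans h (cinv h) v) = 0 by rewrite /anchor tmap_tgt_rtrans.
have p0 : lie_map Phi (rtrans h (cinv h) v) = 0.
  by rewrite (lie_map_rtrans H_isot)// /lie_map Pv tmap0.
have l0 : lambda sigma (t h) (rtrans h (cinv h) v) = 0.
  apply/funext => Z; have [tZ|tZ] := pselect (tangent (t h) Z); last by rewrite lambda_out.
  have [w tw <-] := tgt_submersion tZ; rewrite lambdaE; last exact: tangent_tmap.
  have sinv : @smooth_map R A A (@cinv R H) by exact: cinv_smooth.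
  pose j : A -> C2 := fun g => cpair (kl g).
  have sj : @smooth_map R A C2 j.
    apply: (@smooth_map_sub R (prod_space A A) A (fun z => s z.1 = t z.2)
      (fun g => (g, cinv g)) kl) => //.
    exact: (smooth_map_pair cA (@smooth_map_id R A) sinv).
  have tz : tangent (cpair (kl h)) (tmap (M := A) (N := C2) j w).
    by apply: (@tangent_tmap R A C2 j h) => //; exact: sub_space_closed.
  have := sigma_mult H_isot vv tz; rewrite cmulVr.
  rewrite -(@tmap_comp R A C2 A j (@cmulc R H)); last exact: smooth_cmulc.
  have -> : (fun p : A => cmulc (j p)) = fun p => e (t p) by apply/funext => p; exact: cmulVr.
  rewrite (@tmap_comp R A N A t e)// => ->.
  have tz1 : tangent h (tmap (M := C2) (N := A) (@cfst R H) (tmap (M := A) (N := C2) j w)).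
    by apply: (@tangent_tmap R C2 A (@cfst R H) (cpair (kl h))) => //; exact: smooth_cfst.
  rewrite sv// /lie_map Pv tmap0 form2_0l ?subr0//.
  apply: (@tangent_tmap R C2 (K2 K) (fun z => (Phi (cfst z), Phi (csnd z))) (cpair (kl h))) => //.
    exact: prod_space_closed.
  apply: smooth_map_pair; first exact: sub_space_closed.
    exact: (smooth_map_comp (@smooth_cfst R H) sPhi).
  exact: (smooth_map_comp (@smooth_csnd R H) sPhi).
by rewrite /Defs.rho a0 p0 l0.
Qed.

Lemma ker_at0 (h : A) : ker_at (e (t h)) = [set 0] -> ker_at h = [set 0].
Proof.
move=> E; apply/seteqP; split=> [v kv|_ ->]; last first.
  have [t0 m0] := (tangent0 h, fun F : A -> N => tmap0 F).
  split; [split; [split|]|]; split=> //; try exact: tmap0.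
  by move=> w tw; exact: form2_0l.
have /= v0 := ker_at_unit kv; rewrite E in v0.
have vv : vertical h v by case: kv => -[_ sv] _.
have kl : s h = t (cinv h) by rewrite tgt_cinv.
have ll : s (cinv h) = t h by rewrite src_cinv.
(* Right translation by [h] undoes the one by [cinv h], so [v] is the translate of a zero vector. *)
have := rtrans_comp kl ll vv; rewrite v0 cmulVl rtrans_unit// cmulVr => <-.
have tt : s (e (t h)) = t h by rewrite src_eps.
apply: (@vect_eq _ _ (cmul (e (t h)) h)); [|exact: tangent0|].
  by apply: tangent_rtrans => //; split; [exact: tangent0|exact: tmap0].
move=> f Cf; have [F [b FP]] := mul_rep_exists tt Cf.
by rewrite (rtransE tt _ Cf FP)//; split; [exact: tangent0|exact: tmap0].
Qed.

(** * The Dirac structure *)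

Definition coord (x : N -> 'rV[R]_(mdim N)) (E : 'I_(mdim N) -> N -> vect N)
    (y : K -> 'rV[R]_(mdim K)) (q : N) (e1 : cvect N K) :
    'rV[R]_(mdim N + mdim N + mdim K) :=
  row_mx (row_mx (\row_i e1.1.1 (fun z => x z 0 i)) (\row_i e1.1.2 (E i q)))
         (\row_j e1.2 (fun z => y z 0 j)).

Lemma coordD x E y q e1 e2 : coord x E y q (e1 + e2) = coord x E y q e1 + coord x E y q e2.
Proof.
rewrite /coord !add_row_mx; congr row_mx; first congr row_mx; by apply/rowP => i; rewrite !mxE.
Qed.

Lemma coordZ x E y q a e1 : coord x E y q (a *: e1) = a *: coord x E y q e1.
Proof.
rewrite /coord !scale_row_mx; congr row_mx; first congr row_mx; by apply/rowP => i; rewrite !mxE.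
Qed.

Lemma coord_lin x E y q n (d : 'I_n -> cvect N K) c :
  coord x E y q (lincomb d c) = c *m \matrix_i coord x E y q (d i).
Proof.
have c0 : coord x E y q 0 = 0 by rewrite -(scale0r 0) coordZ scale0r.
rewrite /lincomb (big_morph _ (coordD x E y q) c0) mulmx_sum_row.
by apply: eq_bigr => i _; rewrite coordZ rowK.
Qed.

Lemma coord_inj (p : N) b (x : N -> 'rV[R]_(mdim N)) E c (y : K -> 'rV[R]_(mdim K)) F
    (q : N) (e1 : cvect N K) :
  frame p b (fun i z => x z 0 i) E -> frame one c (fun i z => y z 0 i) F ->
  0 < b q -> cfibre q e1 -> coord x E y q e1 = 0 -> e1 = 0.
Proof.
move=> [_ _ _ vE frE] [_ c0 _ _ frF] bq [tX dal tw].
move=> /eqP; rewrite !row_mx_eq0 => /andP[/andP[/eqP X0 /eqP al0] /eqP w0].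
have [_ sE] := frE _ bq; have [_ sF] := frF _ c0.
have X00 : e1.1.1 = 0.
  rewrite (sE _ tX) big1// => i _; have := congr1 (fun M : 'rV_(mdim N) => M 0 i) X0.
  by rewrite !mxE => ->; rewrite scale0r.
have w00 : e1.2 = 0.
  rewrite (sF _ tw) big1// => i _; have := congr1 (fun M : 'rV_(mdim K) => M 0 i) w0.
  by rewrite !mxE => ->; rewrite scale0r.
have al00 : e1.1.2 = 0.
  apply/funext => Y; have [tY|/dal.2//] := pselect (tangent q Y).
  have [d dT] := tangent_set_basis q.
  rewrite (sE _ tY) -[\sum_i _]/(\sum_i (Y (fun z => x z 0 i)) *: E i q).
  have -> : \sum_i Y (fun z => x z 0 i) *: E i q =
      lincomb (fun i => E i q) (\row_i Y (fun z => x z 0 i)).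
    by apply: eq_bigr => i _; rewrite mxE.
  rewrite (lincomb_morph dT (f := e1.1.2 : vect N -> R^o))//; first last.
    by move=> i; case: (vE i).
    exact: dal.1.
  rewrite /lincomb big1// => i _; have := congr1 (fun M : 'rV_(mdim N) => M 0 i) al0.
  by rewrite !mxE => ->; rewrite scaler0.
by case: e1 X00 w00 al00 {tX dal tw X0 al0 w0} => [[X al] w] /= -> -> ->.
Qed.

Lemma Cinf_coord (x : N -> 'rV[R]_(mdim N)) (E : 'I_(mdim N) -> N -> vect N)
    (y : K -> 'rV[R]_(mdim K)) (e1 : N -> cvect N K) j : (forall i, Cinf (fun z => x z 0 i)) ->
  (forall i, vfield (E i)) -> (forall i, Cinf (fun z => y z 0 i)) -> csection e1 ->
  Cinf (fun q => coord x E y q (e1 q) 0 j).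
Proof.
move=> Cx vE Cy [[_ X1] [_ al1] _ w1].
case: (split_ordP j) => {}j ->; last first.
  by under eq_fun do rewrite row_mxEr mxE; exact: w1.
under eq_fun do rewrite row_mxEl.
case: (split_ordP j) => {}j ->.
  by under eq_fun do rewrite row_mxEl mxE; exact: X1.
by under eq_fun do rewrite row_mxEr mxE; exact: al1.
Qed.

Lemma csection_rho a : asection a -> csection (fun x => rho x (a x)).
Proof.
move=> sa; have aA x := asection_algebroid x sa; split.
- exact: (vfield_anchor sa).
- split=> [x|X vX]; first exact: dual_lambda.
  have tX x : tangent x (X x) by case: vX.
  rewrite (_ : (fun x => _) = fun x : N => sigma (e x) (a x) (tmap (M := N) (N := A) e (X x))).
    apply: (Cinf_form2_along fs fA cN se) => //; first exact: sa.1.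
    exact: (vfield_along_tmap (F := id) cA se vX).
  by apply/funext => x; exact: lambdaE.
- by move=> x; case: (aA x) => tx _; exact: (lie_alg_lie_map H_isot tx).
- by move=> f Cf; case: (lie_alg_valued_Phi H_isot sa) => _; exact.
Qed.

Lemma rho_linE (q : N) n (d : 'I_n -> vect A) c : (forall i, lie_algebroid q (d i)) ->
  rho q (lincomb d c) = lincomb (fun i => rho q (d i)) c.
Proof.
move=> dA; have [_ [b bA]] := lie_algebroid_set_basis q.
by apply: (lincomb_morph bA) => //; exact: rho_lin.
Qed.

Local Notation r := (mdim A - mdim N)%N.

(* [phi] is a smooth left inverse of [rho] near [p], obtained by Cramer's rule
   from a nonzero minor of the coordinates of [rho] on a frame. *)
Lemma algebroid_frame (p : N) : rho_injective p -> exists u (a : 'I_r -> N -> vect A)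
    (phi : N -> cvect N K -> 'rV[R]_r),
  [/\ Cinf u, 0 < u p, forall i, asection (a i),
      forall e1, csection e1 -> forall j, Cinf (fun q => phi q (e1 q) 0 j) &
      forall q, 0 < u q -> set_basis (lie_algebroid q) (fun i => a i q) /\
        forall c, phi q (rho q (lincomb (fun i => a i q) c)) = c].
Proof.
move=> ri.
have [b [x [E [frN _]]]] := manifold_frame p.
have [d [y [F [frK _]]]] := manifold_frame one.
have [Cb b0 Cx vE _] := frN; have [_ _ Cy _ _] := frK.
have [_ [a0 a0A]] := lie_algebroid_set_basis p.
have /choice[a aP] i : exists a, asection a /\ a p = a0 i.
  by have [a sa ap] := asection_extension (set_basis_in a0A i); exists a.
have sa i : asection (a i) by case: (aP i).
have aA q i : lie_algebroid q (a i q) by exact: asection_algebroid.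
pose S q := \matrix_i coord x E y q (rho q (a i q)).
have SE q c : coord x E y q (rho q (lincomb (fun i => a i q) c)) = c *m S q.
  by rewrite rho_linE// coord_lin.
have Sp : row_free (S p).
  apply: inj_row_free => c; rewrite -SE (eq_lincomb _ (fun i => (aP i).2)) => C0.
  have [V1 _ V3] := a0A; apply/V3/ri => //.
  by apply: (coord_inj frN frK b0) => //; exact: rho_fibre.
have fS : row_full (S p)^T by rewrite /row_full mxrank_tr.
pose g := fullrankfun fS.
pose B q : 'M[R]_r := \matrix_(i, j) S q i (g j).
have uB : B p \in unitmx.
  rewrite -unitmx_tr; have := fullrowsub_unit fS.
  rewrite (_ : rowsub _ _ = (B p)^T)//.
  by apply/matrixP => i j; rewrite !mxE.
have CB i j : Cinf (fun q => B q i j).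
  under eq_fun => q do rewrite mxE /S mxE.
  by apply: Cinf_coord => //; exact: csection_rho.
pose D q := \det (B q).
have CD : Cinf D by exact: Cinf_det.
(* [Cinf_inv] inverts positive functions and the sign of the minor is unknown, so 1/D is obtained as
   D times the inverse of D^2. *)
have D0 : 0 < D p * D p.
  by rewrite -expr2 exprn_even_gt0//= -unitfE -unitmxE.
have CDD : Cinf (fun q => D q * D q) by exact: CinfM.
have [b1 [iv [Cb1 b10 Civ ivE]]] := Cinf_inv cN CDD D0.
have [u [Cu u0 uP]] := common_nbhd2 cN Cb Cb1 b0 b10.
pose sel q e1 : 'rV[R]_r := \row_j coord x E y q e1 0 (g j).
pose phi q e1 : 'rV[R]_r := sel q e1 *m ((D q * iv q) *: \adj (B q)).
have phiE q c : 0 < u q -> phi q (rho q (lincomb (fun i => a i q) c)) = c.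
  move=> /uP[_ /ivE[DD ivq]].
  have -> : phi q (rho q (lincomb (fun i => a i q) c)) =
      c *m B q *m ((D q * iv q) *: \adj (B q)).
    rewrite /phi; congr (_ *m _); apply/rowP => j; rewrite [LHS]mxE SE mxE [RHS]mxE.
    by apply: eq_bigr => i _; rewrite [B q i j]mxE.
  rewrite -mulmxA -scalemxAr mul_mx_adj -/(D q) scale_scalar_mx ivq.
  have DD0 : D q != 0 by apply: contraTneq DD => ->; rewrite mul0r ltxx.
  by rewrite invfM mulrA mulfV// mul1r mulVf// mulmx1.
exists u, a, phi; split=> // [e1 se1 j|q uq].
  under eq_fun => q do rewrite mxE.
  apply: Cinf_sum => // i; apply: CinfM => //.
    by under eq_fun do rewrite mxE; exact: Cinf_coord.
  under eq_fun do rewrite mxE.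
  by apply: CinfM => //; [exact: CinfM|exact: Cinf_adj].
split; last by move=> c; exact: phiE.
(* The left inverse gives independence at [q]; the rank is the same at every unit, so independent
   sections already form a basis. *)
have [_ [b2 b2A]] := lie_algebroid_set_basis q.
apply: (free_set_basis b2A) => // c c0; rewrite -(phiE q c uq) c0.
by rewrite -[X in rho q X](lincomb0 (fun i => a i q)) phiE.
Qed.

Hypothesis rho_inj : forall x, rho_injective x.

Lemma subbundle_rho : subbundle (fun x : N => L x).
Proof.
move=> p; have [u [a [phi [Cu u0 sa _ uP]]]] := algebroid_frame (@rho_inj p).
exists u, r, (fun i q => rho q (a i q)); split=> // [i|q uq]; first exact: csection_rho.
have [aA _] := uP _ uq; have [V1 V2 V3] := aA.
have rE c : \sum_i c i *: rho q (a i q) = rho q (lincomb (fun i => a i q) (\row_i c i)).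
  rewrite rho_linE; first by apply: eq_bigr => i _; rewrite mxE.
  exact: (set_basis_in aA).
split=> [|c]; last first.
  rewrite rE => /(rho_inj (V1 _))/V3 /rowP c0 i.
  by have := c0 i; rewrite !mxE.
apply/seteqP; split=> [_ [v /V2[c ->] <-]|_ [c ->]]; last first.
  by rewrite rE; exists (lincomb (fun i => a i q) (\row_i c i)).
exists (c 0); rewrite rE; congr (rho q (lincomb _ _)).
by apply/rowP => i; rewrite mxE.
Qed.

(** Preimages are chosen pointwise. They vary smoothly because [phi] computes their coefficients in
    a local frame from the given section. *)
Lemma section_lift e1 : section_of (fun x : N => L x) e1 ->
  exists2 a, asection a & forall x, rho x (a x) = e1 x.
Proof.
move=> [se1 Le1]; have /choice[a aP] x : exists v, lie_algebroid x v /\ rho x v = e1 x.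
  by have [v av vE] := Le1 x; exists v.
exists a; last by move=> x; case: (aP x).
split=> [|x]; last by case: (aP x) => -[].
split=> [x|f Cf]; first by case: (aP x) => -[].
apply: (Cinf_local cN) => p.
have [u [b [phi [Cu u0 sb Cphi uP]]]] := algebroid_frame (@rho_inj p).
exists u, (fun q => \sum_i phi q (e1 q) 0 i * b i q f); split=> // [|q uq].
  apply: Cinf_sum => // i; apply: CinfM => //; first exact: Cphi.
  by case: (sb i) => -[_ Cb] _; exact: Cb.
have [[_ V2 _] phiE] := uP _ uq; have [/V2[c ac] <-] := aP q.
rewrite ac phiE /lincomb vect_sumE; apply: eq_bigr => i _; by rewrite vect_scaleE.
Qed.

Lemma dirac_rho : (forall x, rho_lagrangian x) -> dirac_structure Om eta (fun x : N => L x).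
Proof.
move=> rl; split=> [|//|e1 e2 /section_lift[a sa aE] /section_lift[b sb bE]].
  exact: subbundle_rho.
have sab := asection_abracket sa sb.
exists (fun x => rho x (abracket a b x)); last first.
  have -> : e1 = fun x => rho x (a x) by apply/funext => x.
  have -> : e2 = fun x => rho x (b x) by apply/funext => x.
  exact: (cbracket_abracket fOm fTh H_isot).
split; first exact: csection_rho.
by move=> x; exists (abracket a b x) => //; exact: asection_algebroid.
Qed.

End Lagrangian_structure.

(** Since n <= m the truncated differences are exact, and both sides say that 2(m - n) = 2n + k. *)
Lemma dim_equation (m n k : nat) : (n <= m)%N ->
  m%:Q - 2 * n%:Q = k%:Q / 2 <-> (n + n + k = (m - n) + (m - n))%N.
Proof.
move=> /subnK <-; rewrite addnK; move: (m - n)%N => d.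
rewrite -!pmulrn natrD; split=> [E|E].
  apply/eqP; rewrite -(eqr_nat rat) !natrD; apply/eqP; lra.
have := congr1 (fun z : nat => z%:R : rat) E; rewrite !natrD; lra.
Qed.
Theorem proposition3p9 (R : realType) (K : lie_group R)
    (Om : form2 (K2 K)) (Th : form3 K)
    (H : lie_groupoid R) (Phi : arr H -> K)
    (sigma : form2 (arr H)) (eta : form3 (obj H))
    (K_symp : shifted_symplectic Om Th)
    (H_isot : isotropic_morphism Om Th Phi sigma eta) :
  let ker_at (h : arr H) :=
    ker_form2 sigma h `&` ker_tmap Phi h `&` ker_tmap (@src R H) h
    `&` ker_tmap (@tgt R H) h in
  let cond_a := lagrangian_structure Om Phi sigma in
  let cond_b :=
    (forall x : obj H, set_inj (lie_algebroid x) (rho Phi sigma x)) /\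
    dirac_structure Om eta (fun x : obj H => rho Phi sigma x @` lie_algebroid x) in
  let cond_c :=
    (mdim (arr H))%:Q - 2 * (mdim (obj H))%:Q = (mdim K)%:Q / 2 /\
    (forall h : arr H, ker_at h = [set 0]) in
  [/\ cond_a <-> cond_b,
      cond_b <-> cond_c &
      (forall h : arr H, ker_at h = [set 0]) <->
      (forall x : obj H, ker_at (eps x) = [set 0])].
Proof.
move=> ker_at cond_a cond_b cond_c.
(* Nonemptiness of the base is essential: the dimension equation of the third condition is read off
   from the pointwise statement at [p]. *)
have [p _] : exists p : obj H, True by case: (manifoldP (obj H)).
have [mn _] := lie_algebroid_set_basis p.
have dimP x : rho_injective Phi sigma x -> rho_lagrangian Om Phi sigma x <->
    (mdim (arr H))%:Q - 2 * (mdim (obj H))%:Q = (mdim K)%:Q / 2.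
  by move=> ri; rewrite (dim_equation _ mn); exact: (rho_lagrangian_dim K_symp H_isot ri).
have kerP : (forall h : arr H, ker_at h = [set 0]) <->
    (forall x, rho_injective Phi sigma x).
  split=> [E x|ri h].
    by apply/(ker_at_eps0 K_symp H_isot); exact: E.
  apply: (ker_at0 K_symp H_isot); apply/(ker_at_eps0 K_symp H_isot); exact: ri.
have bP : cond_b <-> forall x, rho_injective Phi sigma x /\ rho_lagrangian Om Phi sigma x.
  split=> [[ri [_ rl _]] x|rr].
    by split; [apply/(rho_set_inj H_isot); exact: ri|exact: rl].
  split=> [x|]; first by apply/(rho_set_inj H_isot); case: (rr x).
  by apply: (dirac_rho K_symp H_isot) => x; case: (rr x).
split.
- rewrite bP; split=> [la x|rr x]; first exact: (quasi_iso_rho K_symp H_isot (la x)).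
  by case: (rr x) => ri rl; exact: (rho_quasi_iso K_symp H_isot ri rl).
- rewrite bP; split=> [rr|[dim /kerP ri] x].
    have ri x : rho_injective Phi sigma x by case: (rr x).
    by split; [apply/(dimP p) => //; case: (rr p)|exact/kerP].
  by split; [exact: ri|apply/dimP].
- split=> [E x|E]; first exact: E.
  apply/kerP => x; apply/(ker_at_eps0 K_symp H_isot); exact: E.
Qed.
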